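(* For every $\lambda=(\lambda_1,\dots,\lambda_r)\vdash n$, \[ \epsilon_{q,\mathrm{LLT}}^\lambda=(\epsilon_{q,\mathrm{LLT}}^{\lambda_1}\otimes\cdots\otimes\epsilon_{q,\mathrm{LLT}}^{\lambda_r})\big\uparrow_{H_\lambda(q)}^{H_n(q)}, \] where for every $m$, $\epsilon_{q,\mathrm{LLT}}^{m}$ (the trace for the one-part partition $(m)$ of $m$) satisfies $\epsilon_{q,\mathrm{LLT}}^{m}(T_w)=1$ if $w=e$ and $0$ otherwise, for $w\in\mathfrak{S}_m$. Moreover, \[ \eta_{q,\mathrm{LLT}}^\lambda=(\eta_{q,\mathrm{LLT}}^{\lambda_1}\otimes\cdots\otimes\eta_{q,\mathrm{LLT}}^{\lambda_r})\big\uparrow_{H_\lambda(q)}^{H_n(q)}, \] where for every $m$ and $w\in\mathfrak{S}_m$, $\eta_{q,\mathrm{LLT}}^{m}(T_w)=R_{e,w}(q)$.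
   Context: $H_n(q)$ is the Hecke algebra of $\mathfrak{S}_n$ over $\mathbb{Z}[q^{1/2},q^{-1/2}]$ with natural basis $\{T_w\}$ ($T_{s_i}^2=(q-1)T_{s_i}+q$ plus braid relations); $\ell(w)$ is the length, $e$ the identity. $R_{v,w}(q)$ are the Kazhdan–Lusztig $R$-polynomials, defined by $T_{w^{-1}}^{-1}=q^{-\ell(w)}\sum_{v\le w}(-1)^{\ell(w)-\ell(v)}R_{v,w}(q)T_v$ (Bruhat order). Traces: linear functionals with $\theta(DD')=\theta(D'D)$. $H_\lambda(q)\cong H_{\lambda_1}(q)\otimes\cdots\otimes H_{\lambda_r}(q)$ is the parabolic subalgebra spanned by $T_w$ for $w\in\mathfrak{S}_{\lambda_1}\times\cdots\times\mathfrak{S}_{\lambda_r}$; induction $\uparrow$ of traces is induction of characters extended linearly (over $\mathbb{Q}(q^{1/2})$ every trace is a linear combination of irreducible characters). For $\lambda\vdash n$, $\epsilon_q^\lambda$ (resp. $\eta_q^\lambda$) is the character induced from $H_\lambda(q)$ of $T_v\mapsto(-1)^{\ell(v)}$ (resp. $T_v\mapsto q^{\ell(v)}$); the $\epsilon_q^\lambda$ form a basis of traces over $\mathbb{Q}(q^{1/2})$. Let $Y_q(D)=\sum_\lambda\epsilon_q^\lambda(D)m_\lambda$, $Z_q(D)=(q-1)^nY_q(D)[X/(q-1)]$ (plethysm $p_k\mapsto p_k/(q^k-1)$), $\epsilon_{q,\mathrm{LLT}}^\lambda(D)$ the coefficient of $m_\lambda$ in $Z_q(D)$, and for $\theta_q=\sum_\lambda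 b_\lambda\epsilon_q^\lambda$ set $\theta_{q,\mathrm{LLT}}=\sum_\lambda b_\lambda\epsilon_{q,\mathrm{LLT}}^\lambda$; $\eta_{q,\mathrm{LLT}}^\lambda$ is obtained this way from $\eta_q^\lambda$. These constructions apply for each $n$, in particular on each $H_{\lambda_i}(q)$. *)

(* Defs.v *)
From HB Require Import structures.
From mathcomp Require Import all_boot all_order all_fingroup all_algebra all_field.
From mathcomp Require Import zify ring.
From mathcomp Require Import mpoly.

Set Implicit Arguments.
Unset Strict Implicit.
Unset Printing Implicit Defensive.

Import GRing.Theory.
Local Open Scope ring_scope.

Section SymmetricGroup.
Variable n : nat.
Implicit Types (u v w : 'S_n) (i j : 'I_n.-1).

Lemma ltn_lpos i : (i < n)%N.
Proof. by case: n i => [|m] [i //=] /leq_trans; apply. Qed.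

Lemma ltn_rpos i : (i.+1 < n)%N.
Proof. by case: n i => [|m] [i ?]. Qed.

Definition lpos i : 'I_n := Ordinal (ltn_lpos i).
Definition rpos i : 'I_n := Ordinal (ltn_rpos i).

Definition simple i : 'S_n := tperm (lpos i) (rpos i).

Definition len w : nat :=
  #|[set p : 'I_n * 'I_n | (p.1 < p.2)%N && (w p.2 < w p.1)%N]|.

(* Bruhat order: generated by v < (a b) v whenever the length goes up. *)
Definition bruhat : rel 'S_n :=
  connect (fun v w => [exists a, exists b, w == (tperm a b * v)%g] &&
                      (len v < len w)%N).

Fixpoint redword_rec (k : nat) w : seq 'I_n.-1 :=
  if k is k'.+1 then
    if [pick i | (len (simple i * w)%g < len w)%N] is Some i
    then i :: redword_rec k' (simple i * w)%g else [::]
  else [::].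

Definition redword w := redword_rec (len w) w.

Definition descent i v := (v (rpos i) < v (lpos i))%N.

Lemma lrpos i : lpos i != rpos i.
Proof. by rewrite -val_eqE /= neq_ltn ltnSn. Qed.

Lemma simpleK i w : (simple i * (simple i * w))%g = w.
Proof. by rewrite mulgA tperm2 mul1g. Qed.

Lemma simpleKr i w : (w * simple i * simple i)%g = w.
Proof. by rewrite -mulgA tperm2 mulg1. Qed.

Lemma descentM i v : descent i (simple i * v)%g = ~~ descent i v.
Proof.
rewrite /descent !permM tpermL tpermR -leqNgt [RHS]leq_eqVlt.
case: eqP => //= /ord_inj/perm_inj/eqP.
by rewrite (negbTE (lrpos i)).
Qed.

Lemma simpleE i (a : 'I_n) : nat_of_ord (simple i a) =
  if nat_of_ord a == i then i.+1
  else if nat_of_ord a == i.+1 then nat_of_ord i else nat_of_ord a.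
Proof.
rewrite /simple; case: tpermP => [->|->|/eqP + /eqP] /=.
- by rewrite eqxx.
- by rewrite eqxx; case: eqP => //; lia.
- by rewrite -!val_eqE /= => /negbTE -> /negbTE ->.
Qed.

Lemma simple_lt i (a b : 'I_n) : (a < b)%N -> (a, b) != (lpos i, rpos i) ->
  (simple i a < simple i b)%N.
Proof.
move=> ab; rewrite xpair_eqE -!val_eqE /= !simpleE.
move: (nat_of_ord a) (nat_of_ord b) (nat_of_ord i) ab => x y z.
by case: (x =P z); case: (y =P z); case: (x =P z.+1); case: (y =P z.+1); lia.
Qed.

Definition inv' i w := #|[set p : 'I_n * 'I_n |
  [&& p != (lpos i, rpos i), (p.1 < p.2)%N & (w p.2 < w p.1)%N]]|.

Lemma len_inv' i w : len w = (descent i w + inv' i w)%N.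
Proof.
rewrite /len (cardsD1 (lpos i, rpos i)) inE /= ltnSn /=; congr addn.
by apply: eq_card => p; rewrite !inE.
Qed.

Lemma inv'M i w : inv' i (simple i * w)%g = inv' i w.
Proof.
pose f (p : 'I_n * 'I_n) := (simple i p.1, simple i p.2).
have fK : involutive f by case=> a b; rewrite /f /= !tpermK.
rewrite /inv' -[RHS](card_imset _ (inv_inj fK)); apply: eq_card => p.
rewrite -[p in RHS]fK (mem_imset _ _ (inv_inj fK)) !inE /= !permM.
apply/and3P/and3P; case: p => a b /= [ne lt inv]; rewrite {}inv; split=> //.
- apply/eqP => -[ea eb]; move: lt; rewrite -(tpermK (lpos i) (rpos i) a).
  by rewrite -(tpermK (lpos i) (rpos i) b) ea eb tpermL tpermR /= ltnNge leqnSn.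
- exact: simple_lt.
- apply/eqP => -[ea eb]; move: lt; rewrite ea eb tpermL tpermR /=.
  by rewrite ltnNge leqnSn.
- by have := simple_lt lt ne; rewrite !tpermK.
Qed.

Lemma len_simple i w :
  len (simple i * w)%g = if descent i w then (len w).-1 else (len w).+1.
Proof.
by rewrite !(len_inv' i) inv'M descentM; case: (descent i w); rewrite ?addn0.
Qed.

Lemma len_descent i w : descent i w -> (0 < len w)%N.
Proof. by rewrite (len_inv' i) => ->. Qed.

Lemma len_lt i w : (len (simple i * w)%g < len w)%N = descent i w.
Proof.
rewrite len_simple; case: ifP => [/len_descent|_]; first by case: (len w) => //= k; rewrite ltnS leqnn.
by rewrite ltnNge leqnSn.
Qed.

Lemma len1 : len 1 = 0%N.
Proof.
apply/eqP; rewrite cards_eq0; apply/eqP/setP => -[a b].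
by rewrite !inE !perm1 /=; case: ltngtP.
Qed.

Lemma no_descent w : (forall i, ~~ descent i w) -> w = 1%g.
Proof.
move=> nd.
have mono (a b : 'I_n) : (a < b)%N -> (w a < w b)%N.
  move: (ltn_ord b); case: b => b hb /= _; elim: b hb => // b IH hb.
  have hi : (b < n.-1)%N by case: (n) hb.
  have step : (w (Ordinal (ltnW hb)) < w (Ordinal hb))%N.
    have := nd (Ordinal hi); rewrite /descent -leqNgt leq_eqVlt.
    have -> : lpos (Ordinal hi) = Ordinal (ltnW hb) by apply: val_inj.
    have -> : rpos (Ordinal hi) = Ordinal hb by apply: val_inj.
    case/orP => // /eqP/ord_inj/perm_inj/(congr1 val)/= /eqP.
    by rewrite eq_sym (gtn_eqF (ltnSn _)).
  rewrite ltnS leq_eqVlt => /orP[/eqP e|lt]; last exact: ltn_trans (IH _ lt) step.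
  by have -> : a = Ordinal (ltnW hb) by apply: val_inj.
have ge (a : 'I_n) : (a <= w a)%N.
  case: a => a ha /=; elim: a ha => // a IH ha.
  exact: leq_ltn_trans (IH (ltnW ha)) (mono (Ordinal (ltnW ha)) (Ordinal ha) (ltnSn a)).
have es : (\sum_(a < n) w a = \sum_(a < n) a)%N.
  by rewrite [RHS](reindex_inj (@perm_inj _ w)).
apply/permP => a; rewrite perm1; apply/esym/val_inj/eqP => /=.
have /leqif_sum := fun (i : 'I_n) (_ : true) => leqif_eq (ge i).
move=> H; have := H; case=> _; rewrite es eqxx => /esym/forallP/(_ a).
by [].
Qed.

Lemma redword_simple w : w != 1%g ->
  exists2 i, descent i w & redword w = i :: redword (simple i * w)%g.
Proof.
move=> w1; rewrite /redword; case E: (len w) => [|k] /=.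
  case/eqP: w1; apply: no_descent => i; apply/negP => /len_descent.
  by rewrite E.
case: pickP => [i|/= nd].
  rewrite len_lt => di; exists i => //; rewrite len_simple di E //=.
by case/eqP: w1; apply: no_descent => i; rewrite -len_lt nd.
Qed.

Lemma redword1 : redword 1 = [::].
Proof. by rewrite /redword len1. Qed.

Lemma len_ind (P : 'S_n -> Prop) : P 1%g ->
  (forall i w, descent i w -> P (simple i * w)%g -> P w) -> forall w, P w.
Proof.
move=> P1 PS w; move: {2}(len w) (leqnn (len w)) => k; elim: k w => [|k IH] w le.
  by case: (eqVneq w 1%g) => [->//|/redword_simple[i /len_descent]]; case: (len w) le.
case: (eqVneq w 1%g) => [->//|/redword_simple[i di _]].
apply: (PS i) => //; apply: IH; move: le; rewrite len_simple di.
by move/len_descent: di; case: (len w).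
Qed.

(* Interaction of a left and a right multiplication by simple transpositions. *)
Lemma descent_mulr i j v : (simple i * v)%g != (v * simple j)%g ->
  descent i (v * simple j)%g = descent i v.
Proof.
move=> ne; rewrite /descent !permM.
have vne : v (lpos i) != v (rpos i) by rewrite (inj_eq perm_inj) lrpos.
case: (ltngtP (v (rpos i)) (v (lpos i))) => [lt|lt|/val_inj e]; last first.
- by rewrite e eqxx in vne.
- apply/negbTE; rewrite -leqNgt ltnW // simple_lt //.
  apply: contra ne => /eqP[ei ej]; apply/eqP/permP => a; rewrite !permM.
  rewrite /simple -ei -ej; case: (tpermP (lpos i)) => [->|->|ai aj].
  + by rewrite tpermL.
  + by rewrite tpermR.
  + by rewrite tpermD // (inj_eq perm_inj) eq_sym; apply/eqP.
- apply/simple_lt => //; apply: contra ne => /eqP[ei ej].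
  apply/eqP/permP => a; rewrite !permM.
  rewrite /simple -ei -ej; case: (tpermP (lpos i)) => [->|->|ai aj].
  + by rewrite tpermR.
  + by rewrite tpermL.
  + by rewrite tpermD // (inj_eq perm_inj) eq_sym; apply/eqP.
Qed.

Lemma simpleV i : (simple i)^-1%g = simple i.
Proof. exact: tpermV. Qed.

Lemma descentV_mull i j v : (simple i * v)%g != (v * simple j)%g ->
  descent j (simple i * v)^-1%g = descent j v^-1%g.
Proof.
move=> ne; rewrite invMg simpleV; apply: descent_mulr.
apply: contra ne => /eqP e; apply/eqP/invg_inj.
by rewrite !invMg !simpleV e.
Qed.

Lemma descent_eq i j v : (simple i * v)%g = (v * simple j)%g ->
  descent j v^-1%g = descent i v.
Proof.
move=> e.
have e2 : tperm (v (lpos i)) (v (rpos i)) = simple j.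
  by rewrite -tpermJ conjgE -/(simple i) e mulKg.
have er : simple j (v (lpos i)) = v (rpos i) by rewrite -e2 tpermL.
rewrite /descent -er /simple; case: tpermP => [el|el|/eqP nl /eqP nr].
- rewrite -{1}el permK; have -> : rpos j = v (rpos i).
    by rewrite -er el tpermL.
  by rewrite permK el -er el tpermL /= !ltnNge !leqnSn.
- rewrite -{1}el permK; have -> : lpos j = v (rpos i).
    by rewrite -er el tpermR.
  by rewrite permK el -er el tpermR /= !ltnSn.
- move: er; rewrite /simple tpermD 1?eq_sym // => /perm_inj/eqP.
  by rewrite (negbTE (lrpos i)).
Qed.

End SymmetricGroup.
(* The carrier of H_n(q) over the field F; the function w |-> f w encodes
   \sum_w f w T_w. *)
Definition hecke (F : fieldType) (q : F) (n : nat) : Type := {ffun 'S_n -> F^o}.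

Section HeckeAlgebra.
Variables (F : fieldType) (q : F) (n : nat).
Local Notation H := (hecke q n).
Implicit Types (D E : H) (u v w : 'S_n) (i j : 'I_n.-1).

HB.instance Definition _ := Vector.copy H {ffun 'S_n -> F^o}.

Definition coef D w : F := (D : {ffun 'S_n -> F^o}) w.

Definition T w : H := [ffun v => (v == w)%:R].

(* E |-> T_{s_i} E, where T_s T_w = T_{sw} if l(sw) > l(w) and
   T_s T_w = (q - 1) T_w + q T_{sw} otherwise. *)
Definition simple_mul i E : H :=
  [ffun v => if (len (simple i * v)%g < len v)%N
             then coef E (simple i * v)%g + (q - 1) * coef E v
             else q * coef E (simple i * v)%g].

Definition hecke_mul D E : H :=
  \sum_w coef D w *: foldr simple_mul E (redword w).

Lemma heckeP D E : (forall w, coef D w = coef E w) <-> D = E.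
Proof. by split=> [e|-> //]; apply/ffunP. Qed.

Lemma coefD D E w : coef (D + E) w = coef D w + coef E w.
Proof. by rewrite /coef ffunE. Qed.

Lemma coefZ a D w : coef (a *: D) w = a * coef D w.
Proof. by rewrite /coef ffunE. Qed.

Lemma coef_sum I (r : seq I) P (f : I -> H) w :
  coef (\sum_(i <- r | P i) f i) w = \sum_(i <- r | P i) coef (f i) w.
Proof. by rewrite /coef sum_ffunE. Qed.

Lemma coefT w v : coef (T w) v = (v == w)%:R.
Proof. by rewrite /coef ffunE. Qed.

Lemma hecke_sum D : D = \sum_w coef D w *: T w.
Proof.
apply/heckeP => v; rewrite coef_sum (bigD1 v) //= coefZ coefT eqxx mulr1.
rewrite big1 ?addr0 // => w ne.
by rewrite coefZ coefT eq_sym (negbTE ne) mulr0.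
Qed.

Lemma coef_simple_mul i E v : coef (simple_mul i E) v =
  if descent i v then coef E (simple i * v)%g + (q - 1) * coef E v
  else q * coef E (simple i * v)%g.
Proof. by rewrite {1}/coef ffunE len_lt. Qed.

Lemma simple_mul_is_linear i : linear (simple_mul i).
Proof.
move=> a D E; apply/heckeP => v; rewrite coefD coefZ !coef_simple_mul !coefD !coefZ.
by case: ifP => _; ring.
Qed.

HB.instance Definition _ i :=
  GRing.isLinear.Build F H H _ (simple_mul i) (simple_mul_is_linear i).

Lemma simple_neq i w : (w == simple i * w)%g = false.
Proof.
by apply/negbTE/eqP => e; have := descentM i w; rewrite -e; case: descent.
Qed.

Lemma simple_mulT i w : simple_mul i (T w) =
  if descent i w then (q - 1) *: T w + q *: T (simple i * w)%g
  else T (simple i * w)%g.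
Proof.
have eqs v : (simple i * v == w)%g = (v == simple i * w)%g.
  by apply/eqP/eqP => [<-|->]; rewrite simpleK.
apply/heckeP => v; rewrite coef_simple_mul !coefT !eqs.
case: (eqVneq v w) => [->|ne].
  by rewrite simple_neq; case: (descent i w);
    rewrite ?coefD ?coefZ !coefT ?eqxx simple_neq /=; ring.
case: (eqVneq v (simple i * w)%g) => [->|ne2].
  by rewrite descentM; case: (descent i w);
    rewrite ?coefD ?coefZ !coefT eqxx ?[_ == w]eq_sym ?simple_neq /=; ring.
by case: (descent i v); case: (descent i w);
  rewrite ?coefD ?coefZ !coefT ?(negbTE ne) ?(negbTE ne2) /=; ring.
Qed.

(* Right multiplication by T_{s_j}, used to prove associativity. *)
Let rmul j E : H :=
  [ffun v => if descent j v^-1%g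
             then coef E (v * simple j)%g + (q - 1) * coef E v
             else q * coef E (v * simple j)%g].

Let coef_rmul j E v : coef (rmul j E) v =
  if descent j v^-1%g then coef E (v * simple j)%g + (q - 1) * coef E v
  else q * coef E (v * simple j)%g.
Proof. by rewrite {1}/coef ffunE. Qed.

Let rmul_linear j a D E : rmul j (a *: D + E) = a *: rmul j D + rmul j E.
Proof.
apply/heckeP => v; rewrite coefD coefZ !coef_rmul !coefD !coefZ.
by case: ifP => _; ring.
Qed.

Let rmulT j w : ~~ descent j w^-1%g -> rmul j (T w) = T (w * simple j)%g.
Proof.
move=> nd; have eqs v : (v * simple j == w)%g = (v == w * simple j)%g.
  by apply/eqP/eqP => [<-|->]; rewrite simpleKr.
apply/heckeP => v; rewrite coef_rmul !coefT !eqs.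
case: (eqVneq v (w * simple j)%g) => [->|_].
  rewrite invMg simpleV descentM nd (_ : _ == _ = false); first by rewrite /=; ring.
  apply/negbTE/eqP => e; have := descentM j w^-1%g.
  by rewrite -{1}simpleV -invMg e; case: descent.
case: eqP => [->|_]; last by case: ifP => _; rewrite /=; ring.
by rewrite (negbTE nd) mulr0.
Qed.

Let simple_rmulC i j E : simple_mul i (rmul j E) = rmul j (simple_mul i E).
Proof.
apply/heckeP => v; rewrite coef_simple_mul !coef_rmul !coef_simple_mul.
case: (eqVneq (simple i * v)%g (v * simple j)%g) => [e|ne].
  have a1 : descent j (simple i * v)^-1%g = ~~ descent i v.
    by rewrite e invMg simpleV descentM (descent_eq e).
  have a2 : descent i (v * simple j)%g = ~~ descent i v by rewrite -e descentM.
  have c1 : (simple i * v * simple j)%g = v by rewrite e simpleKr.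
  have c2 : (simple i * (v * simple j))%g = v by rewrite -e simpleK.
  rewrite a1 a2 c1 c2 (descent_eq e) -e.
  by case: (descent i v) => /=; ring.
rewrite (descent_mulr ne) (descentV_mull ne) mulgA.
by case: (descent i v); case: (descent j v^-1)%g => /=; ring.
Qed.

Let commutant (f : H -> H) :=
  linear f /\ forall j E, f (rmul j E) = rmul j (f E).

Let commutant_eq f g : commutant f -> commutant g ->
  f (T 1) = g (T 1) -> f =1 g.
Proof.
move=> [lf cf] [lg cg] e1.
have eT w : f (T w) = g (T w).
  rewrite -[w]invgK; elim/len_ind: (w^-1)%g => {w} [|j w dj IH]; first by rewrite invg1.
  have nd : ~~ descent j (simple j * w)%g by rewrite descentM dj.
  have -> : (w^-1 = (simple j * w)^-1 * simple j)%g by rewrite invMg simpleV simpleKr.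
  by rewrite -rmulT ?invgK // cf cg IH.
pose hf := GRing.isLinear.Build F H H *:%R f lf.
pose hg := GRing.isLinear.Build F H H *:%R g lg.
pose f' : {linear H -> H} := HB.pack f hf.
pose g' : {linear H -> H} := HB.pack g hg.
move=> D; rewrite -[f D]/(f' D) -[g D]/(g' D) [D]hecke_sum !linear_sum.
by apply: eq_bigr => w _; rewrite !linearZ /= eT.
Qed.

Lemma foldr_simple_mul_linear s : linear (fun E => foldr simple_mul E s).
Proof. by move=> a D E; elim: s => //= i s ->; rewrite linearP. Qed.

Lemma foldr_redword w : foldr simple_mul (T 1) (redword w) = T w.
Proof.
move: {2}(len w) (leqnn (len w)) => k; elim: k w => [|k IH] w le;
  case: (eqVneq w 1%g) => [->|/redword_simple[i di ->]]; rewrite ?redword1 //.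
  by have := len_descent di; case: (len w) le.
have /IH e : (len (simple i * w)%g <= k)%N.
  by rewrite len_simple di; have := len_descent di; case: (len w) le.
by rewrite /= e simple_mulT descentM di simpleK.
Qed.

Lemma hecke_mul_linearl E : linear (hecke_mul^~ E).
Proof.
move=> a D D'; rewrite /hecke_mul scaler_sumr -big_split; apply: eq_bigr => w _ /=.
by rewrite coefD coefZ scalerDl scalerA.
Qed.

Lemma hecke_mul_linearr D : linear (hecke_mul D).
Proof.
move=> a E E'; rewrite /hecke_mul scaler_sumr -big_split; apply: eq_bigr => w _ /=.
by rewrite foldr_simple_mul_linear scalerDr !scalerA mulrC.
Qed.

Lemma hecke_mul1 : right_id (T 1) hecke_mul.
Proof.
move=> D; rewrite /hecke_mul [RHS]hecke_sum; apply: eq_bigr => w _.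
by rewrite foldr_redword.
Qed.

Lemma hecke_1mul : left_id (T 1) hecke_mul.
Proof.
move=> D; rewrite /hecke_mul (bigD1 1%g) //= coefT eqxx redword1 scale1r.
by rewrite big1 ?addr0 // => w ne; rewrite coefT (negbTE ne) scale0r.
Qed.

Let foldr_rmulC s j E :
  foldr simple_mul (rmul j E) s = rmul j (foldr simple_mul E s).
Proof. by elim: s => //= i s ->; rewrite simple_rmulC. Qed.

Let hecke_mul_commutant D : commutant (hecke_mul D).
Proof.
split; first exact: hecke_mul_linearr.
move=> j E; rewrite /hecke_mul.
pose hr := GRing.isLinear.Build F H H *:%R (rmul j) (rmul_linear j).
pose r' : {linear H -> H} := HB.pack (rmul j) hr.
rewrite -[RHS]/(r' _) linear_sum; apply: eq_bigr => w _.
by rewrite linearZ /= foldr_rmulC.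
Qed.

Lemma hecke_mulA : associative hecke_mul.
Proof.
move=> D E G; apply/esym.
apply: (@commutant_eq (hecke_mul (hecke_mul D E))
                      (fun X => hecke_mul D (hecke_mul E X))).
- exact: hecke_mul_commutant.
- have [lD cD] := hecke_mul_commutant D; have [lE cE] := hecke_mul_commutant E.
  by split=> [a X Y|j X]; rewrite ?lE ?lD ?cE ?cD.
- by rewrite !hecke_mul1.
Qed.

Fact hecke_mulDl : left_distributive hecke_mul +%R.
Proof. by move=> D E G; have := hecke_mul_linearl G 1 D E; rewrite !scale1r. Qed.

Fact hecke_mulDr : right_distributive hecke_mul +%R.
Proof. by move=> D E G; have := hecke_mul_linearr D 1 E G; rewrite !scale1r. Qed.

Fact hecke_1_neq0 : T 1 != 0.
Proof.
apply/eqP => /heckeP/(_ 1%g)/eqP; rewrite coefT eqxx.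
by rewrite /coef ffunE oner_eq0.
Qed.

HB.instance Definition _ := GRing.Zmodule_isNzRing.Build H
  hecke_mulA hecke_1mul hecke_mul1 hecke_mulDl hecke_mulDr hecke_1_neq0.

Fact hecke_scaleAl (a : F) D E : a *: (D * E) = (a *: D) * E.
Proof.
rewrite /GRing.mul /= /hecke_mul scaler_sumr; apply: eq_bigr => w _.
by rewrite coefZ scalerA.
Qed.

Fact hecke_scaleAr (a : F) D E : a *: (D * E) = D * (a *: E).
Proof.
have := hecke_mul_linearr D a E 0; rewrite addr0.
by rewrite (mulr0 D : hecke_mul D 0 = 0) addr0 => /esym.
Qed.

HB.instance Definition _ := GRing.Lmodule_isLalgebra.Build F H hecke_scaleAl.
HB.instance Definition _ := GRing.Lalgebra_isAlgebra.Build F H hecke_scaleAr.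
HB.instance Definition _ := Algebra_isFalgebra.Build F H.

Lemma T1 : T 1 = 1. Proof. by []. Qed.

Lemma simple_mulE i D : T (simple i) * D = simple_mul i D.
Proof.
apply: commutant_eq => [||]; first exact: hecke_mul_commutant.
  by split=> [|j E]; [exact: simple_mul_is_linear | exact: simple_rmulC].
rewrite [LHS]mulr1 simple_mulT mulg1 ifN //.
by rewrite /descent !perm1 /=; lia.
Qed.

Lemma T_simple_mul i w : (len w < len (simple i * w)%g)%N ->
  T (simple i) * T w = T (simple i * w)%g.
Proof.
rewrite simple_mulE simple_mulT len_simple; case: ifP => // /len_descent.
by move=> ? ?; exfalso; lia.
Qed.

Lemma T_simple_sqr i : T (simple i) ^+ 2 = (q - 1) *: T (simple i) + q *: 1.
Proof.
rewrite expr2 simple_mulE simple_mulT tperm2 T1 ifT //.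
by rewrite /descent tpermL tpermR /=.
Qed.

End HeckeAlgebra.

Section Induction.
Variables (F : fieldType) (A : falgType F).
(* B is meant to be a subalgebra of A. *)
Variable B : {vspace A}.

Section Representation.
Variables (d : nat) (rho : {linear A -> 'M[F]_d}).

(* rho is only used on B, which acts on column vectors. *)
Definition is_repr :=
  rho 1 = 1%:M /\ {in B &, forall u v, rho (u * v) = rho u *m rho v}.

(* A (x)_F F^d is encoded as {ffun 'I_d -> A}, with \sum_j h_j (x) e_j |-> h. *)
Definition tens (h : A) (v : 'cV[F]_d) : {ffun 'I_d -> A} :=
  [ffun j => v j 0 *: h].

(* hu (x) e_j - h (x) u e_j *)
Definition balance_rel (h u : A) (j : 'I_d) : {ffun 'I_d -> A} :=
  tens (h * u) (delta_mx j 0) - tens h (rho u *m delta_mx j 0).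

(* A (x)_B F^d is the quotient of A (x)_F F^d by this subspace. *)
Definition balanced : {vspace {ffun 'I_d -> A}} :=
  <<[seq balance_rel hu.1 hu.2 j
    | hu <- [seq (h, u) | h <- vbasis {:A}, u <- vbasis B], j <- enum 'I_d]>>%VS.

Definition tens_act (h : A) (m : {ffun 'I_d -> A}) : {ffun 'I_d -> A} :=
  [ffun j => h * m j].

Fact tens_act_is_linear h : linear (tens_act h).
Proof.
by move=> a m m'; apply/ffunP => j; rewrite !ffunE mulrDr scalerAr.
Qed.

HB.instance Definition _ h := GRing.isLinear.Build F {ffun 'I_d -> A}
  {ffun 'I_d -> A} _ (tens_act h) (tens_act_is_linear h).

End Representation.

Definition lftrace (V : vectType F) (f : 'End(V)) : F :=
  \sum_(i < \dim {:V}) coord (vbasis {:V}) i (f (vbasis {:V})`_i).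

(* For an f that stabilises U, the trace of the endomorphism of V / U induced
   by f: V / U is identified with the complement U^C, on which f is compressed. *)
Definition quotient_trace (V : vectType F) (U : {vspace V}) (f : 'End(V)) : F :=
  lftrace (daddv_pi U^C U \o f)%VF.

(* The character of the left A-module A (x)_B F^d. *)
Definition ind_char d (rho : {linear A -> 'M[F]_d}) (h : A) : F^o :=
  quotient_trace (balanced rho) (linfun (tens_act h)).

Fact ind_char_is_linear d (rho : {linear A -> 'M[F]_d}) : linear (ind_char rho).
Proof.
move=> a g h; rewrite /ind_char /quotient_trace /lftrace scaler_sumr -big_split.
apply: eq_bigr => i _ /=; rewrite !comp_lfunE !lfunE /=.
set m := _`_i; have -> : tens_act (a *: g + h) m = a *: tens_act g m + tens_act h m.
  by apply/ffunP => j; rewrite !ffunE mulrDl scalerAl.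
by rewrite !linearP.
Qed.

HB.instance Definition _ d (rho : {linear A -> 'M[F]_d}) :=
  GRing.isLinear.Build F A F^o _ (ind_char rho) (ind_char_is_linear rho).

(* Theta is the trace on A induced from the trace theta on B: induction of
   characters, extended linearly. *)
Definition induced_trace (theta Theta : A -> F) : Prop :=
  exists (k : nat) (c : 'I_k -> F) (d : 'I_k -> nat)
         (rho : forall i, {linear A -> 'M[F]_(d i)}),
    [/\ forall i, is_repr (rho i),
        {in B, forall u, theta u = \sum_i c i * \tr (rho i u)}
      & forall h, Theta h = \sum_i c i * ind_char (rho i) h].

End Induction.

Section Partitions.

Definition is_partition (n : nat) (la : seq nat) : bool :=
  [&& sorted geq la, 0%N \notin la & sumn la == n].

Definition partitions (n : nat) : seq (seq nat) :=
  [seq [seq val k | k <- val l] | l <- enum {: n.-bseq 'I_n.+1}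
     & is_partition n [seq val k | k <- val l]].

Lemma mem_partitions n la : (la \in partitions n) = is_partition n la.
Proof.
apply/mapP/idP => [[l + ->]|pl]; first by rewrite mem_filter => /andP[].
have /and3P[_ nz /eqP sl] := pl.
have sz : (size la <= n)%N.
  rewrite -sl; elim: (la) nz {pl sl} => //= x l IH; rewrite inE negb_or.
  by case/andP=> x0 /IH; lia.
have lt k : k \in la -> (k < n.+1)%N.
  rewrite ltnS -sl; elim: (la) {pl nz sl sz} => //= x l IH.
  by rewrite inE => /orP[/eqP ->|/IH]; lia.
have e : [seq val k | k <- [seq inord k | k <- la] : seq 'I_n.+1] = la.
  rewrite -map_comp -[RHS]map_id; apply/eq_in_map => k /lt kn /=.
  by rewrite inordK.
have sz' : (size [seq (inord k : 'I_n.+1) | k <- la] <= n)%N by rewrite size_map.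
exists (Bseq sz'); last by rewrite /= e.
by rewrite mem_filter /= e pl mem_enum.
Qed.

Lemma uniq_partitions n : uniq (partitions n).
Proof.
rewrite map_inj_uniq; first exact/filter_uniq/enum_uniq.
move=> l l' e.
by apply: val_inj; apply: (inj_map (@ord_inj n.+1)).
Qed.

End Partitions.

Section Young.
Variables (F : fieldType) (q : F) (n : nat) (la : seq nat).
Local Notation H := (hecke q n).

(* reshape_index la a is the index of the block of la containing a. *)
Definition young : {set 'S_n} :=
  [set w : 'S_n | [forall a, reshape_index la (w a) == reshape_index la a]].

Definition parabolic : {vspace H} := <<[seq T q w | w <- enum young]>>%VS.

(* The component in 'S_(la_k) of an element of the Young subgroup. *)
Definition young_proj (k : nat) (w : 'S_n) : 'S_(nth 0%N la k) :=
  odflt 1%g [pick u : 'S_(nth 0%N la k) |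
    [forall c, forall a : 'I_n, (val a == flatten_index la k (val c)) ==>
       (val (w a) == flatten_index la k (val (u c)))]].

Definition linear_ext (f : 'S_n -> F) (D : H) : F^o := \sum_w coef D w * f w.

Fact linear_ext_is_linear f : linear (linear_ext f).
Proof.
move=> a D E; rewrite /linear_ext scaler_sumr -big_split; apply: eq_bigr => w _ /=.
by rewrite coefD coefZ mulrDl -mulrA.
Qed.

HB.instance Definition _ f := GRing.isLinear.Build F H F^o _ (linear_ext f)
  (linear_ext_is_linear f).

(* theta_1 (x) ... (x) theta_r on H_la = H_(la_1) (x) ... (x) H_(la_r); only its
   values on [parabolic] matter. *)
Definition tensor_trace
    (theta : forall k, 'Hom(hecke q (nth 0%N la k), F^o)) : 'Hom(H, F^o) :=
  linfun (linear_ext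
    (fun w => \prod_(k < size la) theta k (T q (young_proj k w)))).

Definition linear_repr (f : 'S_n -> F) (D : H) : 'M[F]_1 := (linear_ext f D)%:M.

Fact linear_repr_is_linear f : linear (linear_repr f).
Proof.
by move=> a D E; rewrite /linear_repr linearP raddfD /= scale_scalar_mx.
Qed.

HB.instance Definition _ f := GRing.isLinear.Build F H 'M[F]_1 _ (linear_repr f)
  (linear_repr_is_linear f).

Definition eps : 'Hom(H, F^o) :=
  linfun (ind_char parabolic (linear_repr (fun w => (-1) ^+ len w))).

Definition eta : 'Hom(H, F^o) :=
  linfun (ind_char parabolic (linear_repr (fun w => q ^+ len w))).

End Young.

Section LLT.
Variables (F : fieldType) (q : F) (n : nat).
Local Notation H := (hecke q n).

(* Homogeneous symmetric functions of degree n are represented by their images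
   in n.+1 variables: this loses nothing as n.+1 >= n, and the library makes
   homogeneous polynomials a vectType only for a positive number of variables. *)
Local Notation Lam := (dhomog n.+1 F n).

Definition msym_fun (la : seq nat) : {mpoly F[n.+1]} :=
  \sum_(m : 'X_{1..n.+1 < n.+1} | perm_eq [seq k <- m : seq nat | (0 < k)%N] la)
     'X_[m].

Definition psum_fun (k : nat) : {mpoly F[n.+1]} := \sum_(i < n.+1) 'X_i ^+ k.

Lemma sumn_filter_pos (s : seq nat) : sumn [seq k <- s | (0 < k)%N] = sumn s.
Proof. by elim: s => //= -[|k] s /= ->. Qed.

Lemma msym_fun_homog la : is_partition n la -> msym_fun la \is n.-homog.
Proof.
case/and3P=> _ _ /eqP sl; apply: rpred_sum => m /perm_sumn e.
rewrite dhomogX /=; apply/eqP; transitivity (sumn la) => //.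
by rewrite -e sumn_filter_pos mdegE sumnE big_tuple.
Qed.

Lemma psum_fun_homog k : psum_fun k \is k.-homog.
Proof.
apply: rpred_sum => i _; rewrite mpolyXn dhomogX /=.
by rewrite mdegMn mdeg1 mul1n.
Qed.

Lemma psum_prod_homog la (c : nat -> F) : is_partition n la ->
  \prod_(k <- la) (c k *: psum_fun k) \is n.-homog.
Proof.
case/and3P=> _ _ /eqP sl.
suff : \prod_(k <- la) (c k *: psum_fun k) \is (sumn la).-homog by rewrite sl.
elim: la {sl} => [|k la IH]; first by rewrite big_nil dhomog1.
by rewrite big_cons; apply: dhomogM => //; apply/rpredZ/psum_fun_homog.
Qed.

Definition psum_tuple : (size (partitions n)).-tuple Lam :=
  map_tuple (fun la => indhomog n (\prod_(k <- la) psum_fun k))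
    (in_tuple (partitions n)).

(* f |-> f[X/(q-1)]: the p_la-expansion of f, with each p_k replaced by
   p_k / (q^k - 1). *)
Definition pleth (f : Lam) : Lam :=
  \sum_i coord psum_tuple i f *: indhomog n
    (\prod_(k <- tnth (in_tuple (partitions n)) i) ((q ^+ k - 1)^-1 *: psum_fun k)).

Definition Yq (D : H) : Lam :=
  \sum_(la <- partitions n) eps q n la D *: indhomog n (msym_fun la).

Definition Zq (D : H) : Lam := (q - 1) ^+ n *: pleth (Yq D).

(* The coefficient of m_la is the coefficient of x^la. *)
Definition mcoef (la : seq nat) (f : Lam) : F^o :=
  (f : {mpoly F[n.+1]})@_[multinom nth 0%N la i | i < n.+1].

Definition eps_LLT_fun (la : seq nat) (D : H) : F^o := mcoef la (Zq D).

Fact eps_LLT_is_linear la : linear (eps_LLT_fun la).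
Proof.
move=> a D E; rewrite /eps_LLT_fun /Zq.
have -> : Yq (a *: D + E) = a *: Yq D + Yq E.
  rewrite /Yq scaler_sumr -big_split; apply: eq_bigr => mu _ /=.
  by rewrite linearP scalerDl scalerA.
have -> : pleth (a *: Yq D + Yq E) = a *: pleth (Yq D) + pleth (Yq E).
  rewrite /pleth scaler_sumr -big_split; apply: eq_bigr => i _ /=.
  by rewrite linearP scalerDl scalerA.
by rewrite scalerDr scalerA mulrC -scalerA /mcoef /= mcoeffD mcoeffZ.
Qed.

HB.instance Definition _ la :=
  GRing.isLinear.Build F H F^o _ (eps_LLT_fun la) (eps_LLT_is_linear la).

Definition eps_LLT (la : seq nat) : 'Hom(H, F^o) := linfun (eps_LLT_fun la).

Definition eps_tuple : (size (partitions n)).-tuple 'Hom(H, F^o) :=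
  map_tuple (eps q n) (in_tuple (partitions n)).

(* theta |-> theta_LLT, from the expansion of theta in the basis of the eps. *)
Definition LLT (theta : 'Hom(H, F^o)) : 'Hom(H, F^o) :=
  \sum_i coord eps_tuple i theta *: eps_LLT (tnth (in_tuple (partitions n)) i).

Definition eta_LLT (la : seq nat) : 'Hom(H, F^o) := LLT (eta q n la).

(* The values R v w for v not below w in Bruhat order are irrelevant. *)
Definition is_R_polynomials (R : 'S_n -> 'S_n -> {poly int}) : Prop :=
  forall w, (T q w^-1%g)^-1 = q ^- len w *:
    \sum_(v | bruhat v w)
       ((-1) ^+ (len w - len v)%N * (map_poly intr (R v w)).[q]) *: T q v.

End LLT.

(* Q(q^{1/2}), with q^{1/2} the indeterminate. *)
Definition Qqh : fieldType := {fraction {poly rat}}.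
Definition qh : Qqh := tofrac 'X.
Definition qgen : Qqh := qh ^+ 2.

(* Main.v *)
(* Let [T_J] be the product of the [T_s], [s] in
   a set [J] of simple reflections, in increasing order.  A trace on [H_n(q)] that
   vanishes on all [T_J] is zero, because [H_m = H_{m-1} + H_{m-1} T_s H_{m-1}] with
   [s] the last reflection of [S_m].  So it is enough to compare traces on the [T_J].

   Let [f] be a functional on the parabolic subalgebra with value [k^m] on every
   product of [m] distinct simple [T_s]: [k = -1] for the sign character, [k = q] for
   [q^l], [k = 0] for [T_w |-> delta_{w,e}], and [k = q - 1] for
   [T_w |-> R_{e,w}(q)], which is the coefficient of [T_e] after the automorphism
   [T_s |-> - q T_s^-1].  Expanding [T_J T_d] over minimal coset representatives [d],
   the value at [T_J] of the functional induced from [H_la] is the coefficient of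
   [x^la] in a sum [W_k(J)] over words, where a pair of positions linked by [J] weighs
   [q - 1], [k] or [0] according to whether the letters decrease, agree or increase.
   The generating function of a run of linked letters is
   [\prod_x (1 - (k - q + 1) x u) / (1 - k x u)], so by Newton's identities [W_k(J)] is
   a universal polynomial in the [(k^j - (k - q + 1)^j) p_j].  Hence [omega] maps
   [W_{-1}] to [W_q] and [W_0] to [W_{q-1}], while [(q-1)^n] times the plethysm
   [p_j |-> p_j / (q^j - 1)] maps [W_{-1}] to [W_0].

   As [Y_q(T_J) = W_{-1}(J)] is symmetric, this identifies [eps_LLT^la] and
   [eta_LLT^la] with the functionals induced from [k = 0] and [k = q - 1]; for the
   one-row shape these are [delta_e] and [R_{e,.}] themselves.  These two are then
   combinations of characters of [H_n(q)], whose restrictions to [H_la] give the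
   representations required to exhibit the induced traces. *)
Require Import Defs.
From HB Require Import structures.
From mathcomp Require Import all_boot all_order all_fingroup all_algebra all_field.
From mathcomp Require Import zify ring.
From mathcomp Require Import mpoly.

(* [poly] and [mpoly] also export [coefD] and [coefZ]. *)
Import Defs.

Set Implicit Arguments.
Unset Strict Implicit.
Unset Printing Implicit Defensive.

Import GRing.Theory.
Local Open Scope ring_scope.

(** * The Hecke algebra *)

Section Basics.
Variables (F : fieldType) (q : F) (n : nat).
Local Notation H := (hecke q n).
Local Notation T := (T q).
Implicit Types (D E : H) (u v w : 'S_n) (i j : 'I_n.-1) (P : pred 'S_n).

(** The inversion [(a, b)] of [w] becomes the inversion [(w b, w a)] of [w^-1]. *)
Lemma lenV w : len w^-1%g = len w.
Proof.
pose f (p : 'I_n * 'I_n) := (w p.2, w p.1).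
have fI : injective f by case=> a b [c d] [/perm_inj -> /perm_inj ->].
rewrite /len -[RHS](card_imset _ fI); apply: eq_card => -[x y].
have e : (x, y) = f (w^-1 y, w^-1 x)%g by rewrite /f /= !permKV.
by rewrite [in RHS]e (mem_imset _ _ fI) !inE /= !permKV andbC.
Qed.

Lemma T_simpleM i w : T (simple i) * T w =
  if descent i w then (q - 1) *: T w + q *: T (simple i * w)%g
  else T (simple i * w)%g.
Proof. by rewrite simple_mulE simple_mulT. Qed.

(** The product is built from left multiplications, so the right-handed rule needs an induction on a
    left descent. The two reflections act independently unless [simple i * v1 = v1 * simple j],
    which [nd] excludes. *)
Lemma T_Msimple j v : ~~ descent j v^-1%g -> T v * T (simple j) = T (v * simple j)%g.
Proof.
elim/len_ind: v => [|i v di IH] nd; first by rewrite T1 !mul1r mul1g.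
set v1 := (simple i * v)%g in IH nd *.
have nd1 : ~~ descent i v1 by rewrite descentM di.
have Ev : v = (simple i * v1)%g by rewrite simpleK.
have TE : T v = T (simple i) * T v1 by rewrite T_simpleM (negbTE nd1) -Ev.
case: (eqVneq (simple i * v1)%g (v1 * simple j)%g) => [e|ne].
  move: nd; rewrite Ev e invMg simpleV descentM negbK => dj.
  by rewrite (descent_eq e) (negbTE nd1) in dj.
rewrite TE -mulrA IH; last by rewrite -(descentV_mull ne) -Ev.
by rewrite T_simpleM (descent_mulr ne) (negbTE nd1) mulgA -Ev.
Qed.

Lemma len_ind_r (P : 'S_n -> Prop) : P 1%g ->
  (forall j v, ~~ descent j v^-1%g -> P v -> P (v * simple j)%g) -> forall v, P v.
Proof.
move=> P1 PS v; rewrite -[v]invgK; elim/len_ind: v^-1%g => [|j u dj IH].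
  by rewrite invg1.
rewrite -[u in (u^-1)%g](simpleK j) invMg simpleV; apply: PS => //.
by rewrite invgK descentM dj.
Qed.

(** The symmetrizing form of the Hecke algebra, obtained by moving the letters of [v] one at a time
    to the right factor. Its symmetry makes the coefficient of [T 1] a trace. *)
Lemma coef1_TT v w : coef (T v * T w) 1%g = if (v * w == 1)%g then q ^+ len v else 0.
Proof.
elim/len_ind_r: v w => [|j v nd IH] w.
  by rewrite T1 mul1r coefT mul1g eq_sym len1 expr0; case: eqP.
have inv_eq x : (x * w == 1)%g -> w = x^-1%g.
  by move/eqP/(congr1 (mulg x^-1%g)); rewrite mulKg mulg1.
rewrite -T_Msimple // -mulrA T_simpleM; case: ifP => dw.
  rewrite mulrDr -!scalerAr coefD !coefZ !IH mulgA.
  case: eqP => [/eqP/inv_eq e|_]; first by rewrite e (negbTE nd) in dw.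
  case: eqP => [_|]; last by rewrite !mulr0 addr0.
  rewrite mulr0 add0r -exprS; congr (_ ^+ _).
  by rewrite -[RHS]lenV invMg simpleV len_simple (negbTE nd) lenV.
rewrite IH mulgA; case: eqP => // /eqP/inv_eq e.
by move: dw; rewrite e invMg simpleV descentM nd.
Qed.

Lemma coef1_trace D E : coef (D * E) 1%g = coef (E * D) 1%g.
Proof.
have TT v w : coef (T v * T w) 1%g = coef (T w * T v) 1%g.
  rewrite !coef1_TT; case: eqP => [/eqP e|ne]; last first.
    by case: eqP => // e; case: ne; apply: (mulgI w); rewrite mulgA e mul1g mulg1.
  have ew : (v^-1 = w)%g by apply/eqP; rewrite eq_invg_mul.
  by rewrite -ew mulVg eqxx lenV.
rewrite (hecke_sum D) (hecke_sum E) !mulr_suml !coef_sum.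
transitivity (\sum_v \sum_w coef D v * coef E w * coef (T v * T w) 1%g).
  apply: eq_bigr => v _; rewrite mulr_sumr coef_sum; apply: eq_bigr => w _.
  by rewrite -scalerAl -scalerAr !coefZ mulrA.
rewrite exchange_big; apply: eq_bigr => w _; rewrite mulr_sumr coef_sum.
apply: eq_bigr => v _; rewrite -scalerAl -scalerAr !coefZ TT; ring.
Qed.

Definition supp_in P D := forall w, ~~ P w -> coef D w = 0.

Lemma supp_in0 P : supp_in P 0.
Proof. by move=> w _; rewrite -(scale0r (T 1)) coefZ mul0r. Qed.

Lemma supp_inD P D E : supp_in P D -> supp_in P E -> supp_in P (D + E).
Proof. by move=> sD sE w Pw; rewrite coefD sD ?sE ?addr0. Qed.

Lemma supp_inZ P a D : supp_in P D -> supp_in P (a *: D).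
Proof. by move=> sD w Pw; rewrite coefZ sD ?mulr0. Qed.

Lemma supp_in_sum P I (r : seq I) (Q : pred I) (f : I -> H) :
  (forall k, Q k -> supp_in P (f k)) -> supp_in P (\sum_(k <- r | Q k) f k).
Proof. by move=> sf; elim/big_rec: _ => [|k D /sf]; [exact: supp_in0|exact: supp_inD]. Qed.

Lemma supp_inT P w : P w -> supp_in P (T w).
Proof.
by move=> Pw v; rewrite coefT; case: (eqVneq v w) => [->|//]; rewrite Pw.
Qed.

Lemma supp_in_simple P i D : (forall w, P (simple i * w)%g = P w) ->
  supp_in P D -> supp_in P (T (simple i) * D).
Proof.
move=> Pi sD w Pw; rewrite simple_mulE coef_simple_mul !sD ?Pi //.
by case: ifP => _; rewrite ?mulr0 ?addr0.
Qed.

(** Induction along a reduced word whose suffixes stay in [P]; when [P] is a parabolic subgroup,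
    only its own reflections have to be checked. *)
Lemma T_ind (K : H -> Prop) (P : pred 'S_n) : P 1%g ->
  (forall i w, descent i w -> P w -> P (simple i * w)%g) ->
  (forall i w D, descent i w -> P w -> K D -> K (T (simple i) * D)) ->
  forall w D, P w -> K D -> K (T w * D).
Proof.
move=> P1 PS KS w; elim/len_ind: w => [|i w di IH] D Pw KD; first by rewrite T1 mul1r.
have -> : T w = T (simple i) * T (simple i * w)%g.
  by rewrite T_simpleM descentM di /= simpleK.
by rewrite -mulrA; apply: (KS _ w) => //; apply: IH => //; apply: PS.
Qed.

Hypothesis q0 : q != 0.

Lemma T_simple_unit i : T (simple i) \is a GRing.unit.
Proof.
(* The inverse is read off from [T_s^2 = (q - 1) T_s + q]. *)
apply/unitrP; exists (q^-1 *: (T (simple i) - (q - 1) *: 1)).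
have e : T (simple i) * T (simple i) = (q - 1) *: T (simple i) + q *: 1.
  by rewrite -expr2 T_simple_sqr.
split; rewrite -?scalerAl -?scalerAr ?mulrBr ?mulrBl -?scalerAl -?scalerAr;
  by rewrite ?mulr1 ?mul1r e addrC addKr scalerA mulVf // scale1r.
Qed.

Lemma T_unit w : T w \is a GRing.unit.
Proof.
elim/len_ind: w => [|i w di IH]; first by rewrite T1 unitr1.
have -> : T w = T (simple i) * T (simple i * w)%g.
  by rewrite T_simpleM descentM di /= simpleK.
by rewrite unitrMl // T_simple_unit.
Qed.

(** The image of [T w] under the automorphism that sends [T_s] to [- q T_s^-1]. It is linear and
    fixes [q], unlike the Kazhdan-Lusztig bar involution. *)
Definition alpha_fun w : H := (- q) ^+ len w *: (T w^-1%g)^-1.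

Definition alpha D : H := \sum_w coef D w *: alpha_fun w.

Fact alpha_is_linear : linear alpha.
Proof.
move=> a D E; rewrite /alpha scaler_sumr -big_split; apply: eq_bigr => w _ /=.
by rewrite coefD coefZ scalerDl -scalerA.
Qed.

HB.instance Definition _ := GRing.isLinear.Build F H H _ alpha alpha_is_linear.

Lemma alphaT w : alpha (T w) = alpha_fun w.
Proof.
rewrite /alpha (bigD1 w) //= coefT eqxx scale1r big1 ?addr0 // => v ne.
by rewrite coefT (negbTE ne) scale0r.
Qed.

Lemma alpha_simple i : alpha (T (simple i)) = (q - 1) *: 1 - T (simple i).
Proof.
rewrite alphaT /alpha_fun simpleV.
have -> : len (simple i) = 1%N.
  by rewrite -[simple i]mulg1 len_simple /descent !perm1 /= ltnNge leqnSn /= len1.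
rewrite expr1; apply: (mulIr (T_simple_unit i)).
rewrite -scalerAl mulVr ?T_simple_unit // mulrBl -expr2 T_simple_sqr -scalerAl mul1r.
by rewrite opprD addrA subrr add0r scaleNr.
Qed.

(** Without a descent lengths add and inverses multiply. With a descent, what matters is that
    [alpha (T_s)] satisfies the same quadratic relation as [T_s]. *)
Lemma alpha_simpleM i D : alpha (T (simple i) * D) = alpha (T (simple i)) * alpha D.
Proof.
have key w : ~~ descent i w -> alpha_fun (simple i * w)%g = alpha (T (simple i)) * alpha_fun w.
  move=> nd; rewrite alphaT /alpha_fun invMg simpleV len_simple (negbTE nd).
  have -> : len (simple i) = 1%N.
    by rewrite -[simple i]mulg1 len_simple /descent !perm1 /= ltnNge leqnSn /= len1.
  rewrite -T_Msimple ?invgK // invrM ?T_unit // exprS expr1.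
  by rewrite -scalerAl -scalerAr scalerA.
rewrite (hecke_sum D) mulr_sumr !linear_sum mulr_sumr; apply: eq_bigr => w _.
rewrite -scalerAr !linearZ /= -scalerAr; congr (_ *: _).
rewrite T_simpleM; case: ifPn => di; last by rewrite !(alphaT w) alphaT key.
have Ew : w = (simple i * (simple i * w))%g by rewrite simpleK.
set w1 := (simple i * w)%g in Ew *.
have nd : ~~ descent i w1 by rewrite descentM di.
rewrite linearD !linearZ /= !(alphaT w) (alphaT w1) Ew key // mulrA.
have -> : alpha (T (simple i)) * alpha (T (simple i)) =
    (q - 1) *: alpha (T (simple i)) + q *: 1.
  have sq : T (simple i) * T (simple i) = (q - 1) *: T (simple i) + q *: 1.
    by rewrite -expr2 T_simple_sqr.
  rewrite alpha_simple mulrBl !mulrBr sq -!scalerAl !mul1r -scalerAr mulr1.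
  apply/heckeP => v; have cN D' : coef (- D') v = - coef D' v.
    by rewrite -scaleN1r coefZ mulN1r.
  by rewrite !(coefD, coefZ, cN, opprD, opprB, scalerBr); ring.
by rewrite mulrDl -!scalerAl mul1r.
Qed.

Lemma alphaM D E : alpha (D * E) = alpha D * alpha E.
Proof.
have TM w : alpha (T w * E) = alpha (T w) * alpha E.
  rewrite -[T w]mulr1; move: w.
  suff K w : xpredT w -> alpha 1 * alpha E = alpha (1 * E) ->
      alpha (T w * 1) * alpha E = alpha (T w * 1 * E).
    by move=> w; rewrite K // -T1 alphaT /alpha_fun len1 invg1 T1 invr1 expr0 scale1r !mul1r.
  apply: (@T_ind (fun D => alpha D * alpha E = alpha (D * E)) xpredT) => //.
  by move=> i ? G di _ e; rewrite -mulrA !alpha_simpleM -mulrA e.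
rewrite (hecke_sum D) mulr_suml !linear_sum mulr_suml; apply: eq_bigr => w _.
by rewrite -scalerAl !linearZ /= -scalerAl TM.
Qed.

(* [R_{e,w}(q)], read off the coefficient of [T_e] in [T_{w^-1}^-1]. *)
Definition Rtrace D : F^o := coef (alpha D) 1%g.

Fact Rtrace_is_linear : linear Rtrace.
Proof. by move=> a D E; rewrite /Rtrace linearP coefD coefZ. Qed.

HB.instance Definition _ := GRing.isLinear.Build F H F^o _ Rtrace Rtrace_is_linear.

Lemma Rtrace_comm D E : Rtrace (D * E) = Rtrace (E * D).
Proof. by rewrite /Rtrace !alphaM coef1_trace. Qed.

(** Guarantees that the term [v = e] occurs in the sum defining the [R]-polynomials. *)
Lemma bruhat1 w : bruhat 1%g w.
Proof.
elim/len_ind: w => [|i w di IH]; first exact: connect0.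
apply: connect_trans IH (connect1 _); rewrite len_lt di andbT.
by apply/existsP; exists (lpos i); apply/existsP; exists (rpos i); rewrite simpleK.
Qed.

Lemma RtraceE (R : 'S_n -> 'S_n -> {poly int}) w : is_R_polynomials q R ->
  Rtrace (T w) = (map_poly intr (R 1%g w)).[q].
Proof.
move/(_ w) => e; rewrite /Rtrace alphaT /alpha_fun e !coefZ coef_sum.
rewrite (bigD1 1%g) ?bruhat1 //= coefZ coefT eqxx mulr1 len1 subn0.
rewrite big1 => [|v /andP[_ ne]]; last first.
  by rewrite coefZ coefT eq_sym (negbTE ne) mulr0.
(* All scalars cancel: [(-q)^l * q^-l * (-1)^l = 1] with [l = len w]. *)
rewrite addr0 mulrCA !mulrA -exprVn -!exprMn mulrN1 mulrN mulVf // opprK.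
by rewrite expr1n mul1r.
Qed.

End Basics.

(** * Parabolic subalgebras and minimal coset representatives *)

Section Blocks.
Variables (n : nat) (b : 'I_n -> nat).
Hypothesis b_mono : forall x y : 'I_n, (x <= y)%N -> (b x <= b y)%N.
Implicit Types (d u v w : 'S_n) (i j : 'I_n.-1) (x y a : 'I_n).

(* [b x] is the block containing the value [x], so that [a |-> b (w a)] is the word
   attached to the coset [w * blockgrp], on which [simple i * _] acts by permuting
   positions. *)
Definition blockgrp : {set 'S_n} := [set w : 'S_n | [forall a, b (w a) == b a]].

(* The minimal length representatives of the cosets [d * blockgrp]. *)
Definition minrep : {set 'S_n} := [set d : 'S_n |
  [forall x : 'I_n, forall y : 'I_n, (x < y)%N && (b (d x) == b (d y)) ==> (d x < d y)%N]].

Lemma blockP w : reflect (forall a, b (w a) = b a) (w \in blockgrp).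
Proof. by rewrite inE; apply: (iffP forallP) => H a; apply/eqP. Qed.

Lemma minrepP d : reflect (forall x y, (x < y)%N -> b (d x) = b (d y) -> (d x < d y)%N)
  (d \in minrep).
Proof.
rewrite inE; apply: (iffP forallP) => [H x y lt e|H x].
  by have /forallP/(_ y) := H x; rewrite lt e eqxx.
by apply/forallP => y; apply/implyP => /andP[lt /eqP]; exact: H.
Qed.

Lemma b_lt x y : (b x < b y)%N -> (x < y)%N.
Proof. by rewrite ltnNge [(x < y)%N]ltnNge; apply: contra => /b_mono. Qed.

Lemma block1 : 1%g \in blockgrp.
Proof. by apply/blockP => a; rewrite perm1. Qed.

Lemma blockM u v : u \in blockgrp -> v \in blockgrp -> (u * v)%g \in blockgrp.
Proof. by move=> /blockP hu /blockP hv; apply/blockP => a; rewrite permM hv hu. Qed.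

Lemma blockV u : u \in blockgrp -> u^-1%g \in blockgrp.
Proof. by move=> /blockP hu; apply/blockP => a; rewrite -hu permKV. Qed.

Lemma block_simple i : (simple i \in blockgrp) = (b (lpos i) == b (rpos i)).
Proof.
apply/blockP/eqP => [/(_ (rpos i))|e a]; first by rewrite tpermR.
by rewrite /simple; case: tpermP => [->|->|].
Qed.

(** [v] preserves blocks and [b] is weakly increasing, so an inversion at [i] forces both positions
    into one block. *)
Lemma block_desc i v : v \in blockgrp -> descent i v -> simple i \in blockgrp.
Proof.
rewrite block_simple => /blockP hv; rewrite /descent => lt.
rewrite eqn_leq [X in X && _]b_mono /= ?leqnSn //.
by rewrite -(hv (lpos i)) -(hv (rpos i)) b_mono // ltnW.
Qed.

Lemma minrep1 : 1%g \in minrep.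
Proof. by apply/minrepP => x y; rewrite !perm1. Qed.

Lemma minrep_simple d i : d \in minrep -> b (d (lpos i)) != b (d (rpos i)) ->
  (simple i * d)%g \in minrep.
Proof.
move=> /minrepP hd ne; apply/minrepP => x y lt; rewrite !permM => e.
apply: (hd) => //; apply: simple_lt => //; apply: contra_neq ne => -[ex ey].
by move: e; rewrite ex ey tpermL tpermR => ->.
Qed.

(** In a minimal representative equal letters stand in increasing order of value, so only strict
    descents of the word remain. *)
Lemma minrep_desc d i : d \in minrep ->
  descent i d = (b (d (rpos i)) < b (d (lpos i)))%N.
Proof.
move=> /minrepP hd; rewrite /descent; apply/idP/idP => [lt|]; last exact: b_lt.
rewrite ltn_neqAle b_mono ?andbT; last exact: ltnW.
by apply/eqP => /esym/(hd _ _ (ltnSn _ : (lpos i < rpos i)%N)) /ltn_trans/(_ lt); rewrite ltnn.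
Qed.

(** Deodhar's lemma. A value strictly between [d (lpos i)] and [d (rpos i)] would lie in their
    block, hence would need a position strictly between two adjacent ones; so the two values are
    adjacent. *)
Lemma minrep_same d i : d \in minrep -> b (d (lpos i)) = b (d (rpos i)) ->
  exists j : 'I_n.-1, [/\ lpos j = d (lpos i), rpos j = d (rpos i)
     & (simple i * d = d * simple j)%g].
Proof.
move=> /minrepP hd e; have lt : (d (lpos i) < d (rpos i))%N by apply: hd => /=.
have adj : nat_of_ord (d (rpos i)) = (d (lpos i)).+1.
  apply/eqP; rewrite eqn_leq lt andbT leqNgt; apply/negP => lt2.
  have hx : ((d (lpos i)).+1 < n)%N by apply: ltn_trans lt2 _.
  set x : 'I_n := Ordinal hx.
  have bx : b x = b (d (lpos i)).
    apply/eqP; rewrite eqn_leq [X in _ && X]b_mono ?leqnSn // e andbT b_mono // ltnW.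
  have [y Ey] : exists y, x = d y by exists (d^-1%g x); rewrite permKV.
  have [|le] := ltnP (lpos i) y => [lty|].
    have [|ge] := ltnP y (rpos i); first by move: lty => /=; lia.
    have : (rpos i < y)%N.
      rewrite ltn_neqAle ge andbT; apply/eqP => /ord_inj ey.
      by move: lt2; rewrite ey -Ey /= ltnn.
    by move/hd; rewrite -Ey bx e => /(_ erefl) /=; lia.
  have : (y < lpos i)%N.
    rewrite ltn_neqAle le andbT; apply/eqP => /ord_inj ey.
    by move: Ey => /(congr1 val); rewrite ey /=; lia.
  by move/hd; rewrite -Ey bx => /(_ erefl) /=; lia.
have hj : (d (lpos i) < n.-1)%N by have := ltn_ord (d (rpos i)); rewrite adj; lia.
exists (Ordinal hj).
have el : lpos (Ordinal hj) = d (lpos i) by apply: val_inj.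
have er : rpos (Ordinal hj) = d (rpos i) by apply: val_inj; rewrite /= adj.
by split=> //; rewrite /simple el er -tpermJ conjgE !mulgA mulgV mul1g.
Qed.

(** A simple reflection on the left either moves [d] to another representative or passes through [d]
    into the block group. *)
Lemma minrep_decomp w :
  exists d v, [/\ d \in minrep, v \in blockgrp & w = (d * v)%g].
Proof.
elim/len_ind: w => [|i w _ [d [v [hd hv e]]]].
  by exists 1%g, 1%g; rewrite minrep1 block1 mulg1.
have ew : w = (simple i * d * v)%g by rewrite -mulgA -e simpleK.
case: (eqVneq (b (d (lpos i))) (b (d (rpos i)))) => [same|diff]; last first.
  by exists (simple i * d)%g, v; rewrite minrep_simple.
have [j [el er ej]] := minrep_same hd same.
exists d, (simple j * v)%g; split=> //; last by rewrite ew ej mulgA.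
by apply: blockM => //; rewrite block_simple el er same.
Qed.

(** If the words agree, [d^-1 * d'] preserves blocks and has no descent. *)
Lemma minrep_word_inj d d' : d \in minrep -> d' \in minrep ->
  (forall a, b (d a) = b (d' a)) -> d = d'.
Proof.
move=> /minrepP hd /minrepP hd' e; pose u := (d^-1 * d')%g.
suff : u = 1%g by move/(congr1 (mulg d)); rewrite mulKVg mulg1.
have bu a : b (u a) = b a by rewrite permM -e permKV.
apply: no_descent => i; rewrite /descent -leqNgt ltnW //.
have [eb|ne] := eqVneq (b (lpos i)) (b (rpos i)); last first.
  by apply: b_lt; rewrite !bu ltn_neqAle ne b_mono.
rewrite !permM; apply: hd'; last by rewrite -!e !permKV.
rewrite ltnNge; apply/negP; rewrite leq_eqVlt => /orP[/eqP/ord_inj/perm_inj/eqP|].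
  by rewrite eq_sym (negbTE (lrpos i)).
by move/hd; rewrite !permKV eb => /(_ erefl) /=; rewrite ltnNge leqnSn.
Qed.

Lemma minrep_mul_inj d d' v v' : d \in minrep -> d' \in minrep ->
  v \in blockgrp -> v' \in blockgrp -> (d * v = d' * v')%g -> d = d' /\ v = v'.
Proof.
move=> hd hd' /blockP hv /blockP hv' e.
have ed : d = d'.
  by apply: minrep_word_inj => // a; rewrite -hv -permM e permM hv'.
by split=> //; apply: (mulgI d); rewrite e ed.
Qed.

Lemma sum_minrep (R : nmodType) (f : 'S_n -> R) :
  \sum_w f w = \sum_(d in minrep) \sum_(v in blockgrp) f (d * v)%g.
Proof.
pose X := setX minrep blockgrp; pose m (p : 'S_n * 'S_n) := (p.1 * p.2)%g.
rewrite pair_big_dep /=.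
transitivity (\sum_(w in m @: X) f w).
  apply: eq_bigl => w; have [d [v [hd hv ->]]] := minrep_decomp w.
  by apply/esym/imsetP; exists (d, v); rewrite ?in_setX ?hd.
rewrite big_imset => [|[d v] [d' v']].
  by apply: eq_bigl => -[d v]; rewrite in_setX.
rewrite !in_setX /= => /andP[hd hv] /andP[hd' hv'] /= e.
by have [-> ->] := minrep_mul_inj hd hd' hv hv' e.
Qed.

Lemma minrep_descM d v i : d \in minrep -> v \in blockgrp ->
  b (d (lpos i)) != b (d (rpos i)) -> descent i (d * v)%g = descent i d.
Proof.
move=> hd /blockP hv ne; rewrite (minrep_desc i hd) /descent !permM.
case: (ltngtP (b (d (rpos i))) (b (d (lpos i)))) => [lt|lt|e].
- by apply: b_lt; rewrite !hv.
- by apply/negbTE; rewrite -leqNgt ltnW // b_lt // !hv.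
- by rewrite e eqxx in ne.
Qed.

Section Hecke.
Variables (F : fieldType) (q : F).
Local Notation H := (hecke q n).
Local Notation T := (T q).
Implicit Types (h D E : H).

Lemma T_minrepM d v : d \in minrep -> v \in blockgrp -> T d * T v = T (d * v)%g.
Proof.
move=> + hv; elim/len_ind: d => [|i d di IH] hd; first by rewrite T1 mul1r mul1g.
have ne : b (d (lpos i)) != b (d (rpos i)).
  by move: di; rewrite minrep_desc // ltn_neqAle eq_sym => /andP[].
have hd1 := minrep_simple hd ne.
have Td : T d = T (simple i) * T (simple i * d)%g.
  by rewrite T_simpleM descentM di /= simpleK.
rewrite Td -mulrA IH // T_simpleM -mulgA descentM minrep_descM // di /=.
by rewrite simpleK.
Qed.

(** For [b] the block index of [la] this is convertible to [parabolic]. *)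
Definition block_alg : {vspace H} := <<[seq T w | w <- enum blockgrp]>>%VS.

Lemma block_algT v : v \in blockgrp -> T v \in block_alg.
Proof. by move=> hv; apply/memv_span/map_f; rewrite mem_enum. Qed.

Lemma mem_block_alg h : h \in block_alg <-> supp_in (mem blockgrp) h.
Proof.
split=> [|sh]; last first.
  rewrite (hecke_sum h); apply: rpred_sum => w _.
  case: (boolP (w \in blockgrp)) => [/block_algT hw|nw]; first exact: memvZ.
  by rewrite sh // scale0r mem0v.
move/(@coord_span _ _ _ (in_tuple [seq T w | w <- enum blockgrp])) => ->.
apply: supp_in_sum => k _; apply: supp_inZ.
have := mem_tnth k (in_tuple [seq T w | w <- enum blockgrp]).
rewrite (tnth_nth 0) => /mapP[w].
by rewrite mem_enum => hw ->; apply: supp_inT.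
Qed.

Lemma block_algM : {in block_alg &, forall h h', h * h' \in block_alg}.
Proof.
have K u D : u \in blockgrp -> D \in block_alg -> T u * D \in block_alg.
  apply: (@T_ind _ q _ (fun D => D \in block_alg) (mem blockgrp)) => [|i v dv hv|i v E dv hv hE].
  - exact: block1.
  - by apply: blockM => //; apply: block_desc dv.
  - apply/mem_block_alg/supp_in_simple; last exact/mem_block_alg.
    move=> x /=; have si := block_desc hv dv.
    apply/idP/idP => hx; last exact: blockM.
    by rewrite -(simpleK i x); apply: blockM.
move=> h h' /mem_block_alg sh hh'; rewrite (hecke_sum h) mulr_suml.
apply: rpred_sum => w _; rewrite -scalerAl.
case: (boolP (w \in blockgrp)) => [hw|nw]; last by rewrite sh // scale0r mem0v.
exact/memvZ/K.
Qed.

(** The coordinate at [T d] of [h], the Hecke algebra being a free right module over [block_alg]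
    with basis the [T d], [d] in [minrep]. *)
Definition block_coef d h : H := \sum_(v in blockgrp) coef h (d * v)%g *: T v.

Fact block_coef_is_linear d : linear (block_coef d).
Proof.
move=> a h h'; rewrite /block_coef scaler_sumr -big_split; apply: eq_bigr => w _ /=.
by rewrite coefD coefZ scalerDl -scalerA.
Qed.

HB.instance Definition _ d := GRing.isLinear.Build F H H _ (block_coef d) (block_coef_is_linear d).

Lemma block_coefP d (c : F) h h' :
  block_coef d (c *: h + h') = c *: block_coef d h + block_coef d h'.
Proof. exact: linearP. Qed.

Lemma block_coefZ d (c : F) h : block_coef d (c *: h) = c *: block_coef d h.
Proof. exact: linearZ. Qed.

Lemma block_coef_mem d h : block_coef d h \in block_alg.
Proof. by apply: rpred_sum => v hv; apply/memvZ/block_algT. Qed.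

Lemma block_coefE h : h = \sum_(d in minrep) T d * block_coef d h.
Proof.
rewrite {1}(hecke_sum h) sum_minrep; apply: eq_bigr => d hd.
rewrite mulr_sumr; apply: eq_bigr => v hv.
by rewrite -scalerAr T_minrepM.
Qed.

Lemma block_sum (u : H) : u \in block_alg -> u = \sum_(v in blockgrp) coef u v *: T v.
Proof.
move=> /mem_block_alg su; rewrite {1}(hecke_sum u) (bigID (mem blockgrp)) /=.
by rewrite [X in _ + X]big1 ?addr0 // => v nv; rewrite su // scale0r.
Qed.

Lemma block_coefM d d' (u : H) : d \in minrep -> d' \in minrep -> u \in block_alg ->
  block_coef d' (T d * u) = if d' == d then u else 0.
Proof.
move=> hd hd' hu; rewrite {1}(block_sum hu) mulr_sumr linear_sum /=.
have K v : v \in blockgrp -> block_coef d' (T d * (coef u v *: T v)) =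
    if d' == d then coef u v *: T v else 0.
  move=> hv; rewrite -scalerAr linearZ /= T_minrepM // /block_coef.
  rewrite (eq_bigr (fun v' => ((d' == d) && (v' == v))%:R *: T v')) => [|v' hv'].
    case: eqP => /= _; last by rewrite big1 ?scaler0 // => ? _; rewrite scale0r.
    rewrite (bigD1 v) //= eqxx scale1r big1 ?addr0 // => v' /andP[_ /negbTE ->].
    by rewrite scale0r.
  rewrite coefT; congr (_%:R *: _); congr nat_of_bool.
  apply/eqP/andP => [/minrep_mul_inj[]// -> ->|[/eqP -> /eqP -> //]].
  by rewrite !eqxx.
rewrite (eq_bigr _ K); case: eqP => _; first by rewrite -block_sum.
by rewrite big1.
Qed.

Lemma block_coefMr d h (u : H) : d \in minrep -> u \in block_alg ->
  block_coef d (h * u) = block_coef d h * u.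
Proof.
move=> hd hu; rewrite {1}(block_coefE h) mulr_suml linear_sum /=.
rewrite (bigD1 d) //= big1 ?addr0 => [|d' /andP[hd' /negbTE ne]].
  by rewrite -mulrA block_coefM // ?eqxx // block_algM // block_coef_mem.
by rewrite -mulrA block_coefM 1?eq_sym ?ne // block_algM // block_coef_mem.
Qed.

End Hecke.
End Blocks.

(** * Induced characters *)

Section QuotientTrace.
Variables (F : fieldType) (V : vectType F) (U : {vspace V}) (f : 'End(V)).
Variables (X : finType) (e : X -> V) (phi : X -> {linear V -> F^o}).
Hypothesis phiU : forall x u, u \in U -> phi x u = 0.
Hypothesis eU : forall v, v - \sum_x phi x v *: e x \in U.
Hypothesis fU : forall u, u \in U -> f u \in U.

(** Modulo [U], every [v] is recovered from the numbers [phi x v] through the [e x]. So [f] on the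
    quotient factors through the index set [X], and the trace is taken there with the factors in the
    other order. *)
Lemma quotient_traceE : quotient_trace U f = \sum_x phi x (f (e x)).
Proof.
pose pi := daddv_pi U^C U.
have cap0 : (U^C :&: U = 0)%VS by rewrite capvC capv_compl.
have sum1 : (U^C + U = fullv)%VS by rewrite addvC addv_complf.
have piE v : v - pi v \in U.
  rewrite -{1}(daddv_pi_add cap0 (_ : v \in (U^C + U)%VS)); last by rewrite sum1 memvf.
  by rewrite addrAC subrr add0r memv_pi.
have piU u : u \in U -> pi u = 0.
  move=> hu; apply/eqP; rewrite -memv0 -cap0 memv_cap memv_pi /=.
  by rewrite -(subKr u (pi u)) rpredB // piE.
have phi_pi x v : phi x (pi v) = phi x v.
  by apply/esym/eqP; rewrite -subr_eq0 -linearB /= phiU.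
have decomp v : pi v = \sum_x phi x v *: pi (e x).
  have := piU _ (eU v); rewrite linearB /= => /eqP; rewrite subr_eq0 => /eqP ->.
  by rewrite linear_sum; apply: eq_bigr => x _; rewrite linearZ.
have fpi v x : phi x (f (pi v)) = phi x (f v).
  apply/esym/eqP; rewrite -subr_eq0 -!linearB /=; apply/eqP/phiU/fU/piE.
rewrite /quotient_trace /lftrace.
transitivity (\sum_(i < \dim {:V}) \sum_x
   coord (vbasis {:V}) i (pi (e x)) * phi x (f (vbasis {:V})`_i)).
  apply: eq_bigr => i _; rewrite comp_lfunE -/pi decomp linear_sum.
  by apply: eq_bigr => x _; rewrite linearZ /= mulrC.
rewrite exchange_big; apply: eq_bigr => x _ /=.
rewrite -fpi [in RHS](coord_vbasis (memvf (pi (e x)))) !linear_sum.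
by apply: eq_bigr => i _; rewrite !linearZ.
Qed.

End QuotientTrace.

Section Balanced.
Variables (F : fieldType) (A : falgType F) (B : {vspace A}) (d : nat).
Variable rho : {linear A -> 'M[F]_d}.
Implicit Types (g h u : A) (j : 'I_d).
Local Notation V := {ffun 'I_d -> A}.

Lemma balance_relE h u j k : balance_rel rho h u j k =
  (delta_mx j 0 : 'cV[F]_d) k 0 *: (h * u) - (rho u *m delta_mx j 0 : 'cV_d) k 0 *: h.
Proof. by rewrite !ffunE. Qed.

Fact balance_rel_linear_l u j : linear (fun h => balance_rel rho h u j).
Proof.
move=> a g h; apply/ffunP => k; rewrite [LHS]balance_relE [RHS]ffunE ffunE !balance_relE.
move: (_ k 0) (_ k 0) => x y; rewrite mulrDl -scalerAl !scalerDr !scalerN.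
by rewrite !scalerA ![_ * a]mulrC opprD addrACA.
Qed.

Fact balance_rel_linear_r h j : linear (balance_rel rho h ^~ j).
Proof.
move=> a u v; apply/ffunP => k; rewrite [LHS]balance_relE [RHS]ffunE ffunE !balance_relE.
rewrite linearP mulmxDl -scalemxAl ![(_ + _ : 'cV_d) k 0]mxE ![(a *: _ : 'cV_d) k 0]mxE.
move: (_ k 0) (_ k 0) (_ k 0) => x y z; rewrite mulrDr -scalerAr !scalerDr scalerDl !scalerN.
by rewrite !scalerA ![_ * a]mulrC opprD addrACA.
Qed.

(** [balanced] is spanned by the relations at basis vectors; bilinearity yields the others. *)
Lemma balance_relU h u j : u \in B -> balance_rel rho h u j \in balanced B rho.
Proof.
move=> hu.
pose rl u : {linear A -> V} := HB.pack (fun h => balance_rel rho h u j)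
  (GRing.isLinear.Build F A V _ _ (balance_rel_linear_l u j)).
pose rr h : {linear A -> V} := HB.pack (balance_rel rho h ^~ j)
  (GRing.isLinear.Build F A V _ _ (balance_rel_linear_r h j)).
rewrite -[balance_rel _ _ _ _]/(rl u h) (coord_vbasis (memvf h)) linear_sum.
apply: rpred_sum => i _; rewrite linearZ; apply: memvZ.
rewrite -[rl _ _]/(rr _ u) (coord_vbasis hu) linear_sum.
apply: rpred_sum => k _; rewrite linearZ; apply: memvZ.
apply/memv_span/allpairsP; exists ((vbasis {:A})`_i, (vbasis B)`_k, j) => /=.
split=> //; last by rewrite mem_enum.
by apply/allpairsP; exists ((vbasis {:A})`_i, (vbasis B)`_k); split => //;
  apply: mem_nth; rewrite size_tuple ltn_ord.
Qed.

Lemma balanced_act h m : m \in balanced B rho -> tens_act h m \in balanced B rho.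
Proof.
move/(@coord_span _ _ _ (in_tuple _)) => ->; rewrite linear_sum.
apply: rpred_sum => k _; rewrite linearZ; apply: memvZ.
have := mem_tnth k (in_tuple [seq balance_rel rho hu.1 hu.2 j
    | hu <- [seq (h, u) | h <- vbasis {:A}, u <- vbasis B], j <- enum 'I_d]).
rewrite (tnth_nth 0) => /allpairsP[[[g u] j] /= [/allpairsP[[g' u'] /= [_ hu [-> ->]]] _ ->]].
have -> : tens_act h (balance_rel rho g' u' j) = balance_rel rho (h * g') u' j.
  by apply/ffunP => i; rewrite ffunE !balance_relE mulrBr -!scalerAr mulrA.
exact/balance_relU/vbasis_mem.
Qed.

Lemma balanced_ind (W : lmodType F) (f : {linear V -> W}) :
  (forall h u j, u \in B -> f (balance_rel rho h u j) = 0) ->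
  forall m, m \in balanced B rho -> f m = 0.
Proof.
move=> f0 m /(@coord_span _ _ _ (in_tuple _)) ->; rewrite linear_sum big1 // => k _.
have := mem_tnth k (in_tuple [seq balance_rel rho hu.1 hu.2 j
    | hu <- [seq (h, u) | h <- vbasis {:A}, u <- vbasis B], j <- enum 'I_d]).
rewrite (tnth_nth 0) => /allpairsP[[[g u] j] /= [/allpairsP[[g' u'] /= [_ hu [-> ->]]] _ e]].
by rewrite linearZ /= e f0 ?scaler0 // vbasis_mem.
Qed.

End Balanced.

(** * Matrices and characters of induced modules *)

Section Induced.
Variables (n : nat) (b : 'I_n -> nat).
Hypothesis b_mono : forall x y : 'I_n, (x <= y)%N -> (b x <= b y)%N.
Variables (F : fieldType) (q : F).
Local Notation H := (hecke q n).
Local Notation T := (T q).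
Local Notation B := (block_alg b q).
Local Notation D := (minrep b).
Variables (d : nat) (rho : {linear H -> 'M[F]_d}).
Hypothesis rho_repr : is_repr B rho.
Implicit Types (g h u : H) (w : 'S_n).

Local Notation V := {ffun 'I_d -> H}.
Local Notation U := (balanced B rho).

Definition ind_index : finType := ({w | w \in D} * 'I_d)%type.
Implicit Types x y : ind_index.

(** In the tensor product over the subalgebra, [T w * u] tensored with [e_k] is [T w] tensored with
    [rho u e_k]; this is the resulting coordinate at [x = (w, j)]. *)
Definition ind_coord_fun x (m : V) : F^o :=
  \sum_k rho (block_coef b (val x.1) (m k)) x.2 k.

Fact ind_coord_is_linear x : linear (ind_coord_fun x).
Proof.
move=> a m m'; rewrite /ind_coord_fun scaler_sumr -big_split; apply: eq_bigr => k _ /=.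
rewrite ffunE [(a *: m) k]ffunE.
by rewrite block_coefP linearP /= !mxE.
Qed.

Definition ind_coord x : {linear V -> F^o} := HB.pack (ind_coord_fun x)
  (GRing.isLinear.Build F V F^o _ _ (ind_coord_is_linear x)).

Lemma ind_coordB x m m' : ind_coord x (m - m') = ind_coord x m - ind_coord x m'.
Proof. exact: raddfB. Qed.

Lemma ind_coordZ x a m : ind_coord x (a *: m) = a * ind_coord x m.
Proof. exact: linearZ. Qed.

Definition ind_vec x : V := tens (T (val x.1)) (delta_mx x.2 0).

Lemma ind_coord_tens x h (v : 'cV_d) :
  ind_coord x (tens h v) = (rho (block_coef b (val x.1) h) *m v) x.2 0.
Proof.
rewrite mxE; apply: eq_bigr => k _; rewrite ffunE.
by rewrite block_coefZ linearZ /= mxE mulrC.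
Qed.

Lemma ind_coord_balanced x m : m \in U -> ind_coord x m = 0.
Proof.
apply: balanced_ind => h u j hu; rewrite /balance_rel ind_coordB !ind_coord_tens block_coefMr //; last exact: valP.
have [_ rhoM] := rho_repr.
by rewrite rhoM ?block_coef_mem // mulmxA subrr.
Qed.

Lemma ind_vec_span m : m - \sum_x ind_coord x m *: ind_vec x \in U.
Proof.
have td h k k' : tens h (delta_mx k' 0) k = (k == k')%:R *: h.
  by rewrite ffunE mxE eqxx andbT.
have key h j : tens h (delta_mx j 0) - \sum_x
    ind_coord x (tens h (delta_mx j 0)) *: ind_vec x \in U.
  pose f w k : V := (rho (block_coef b w h) *m delta_mx j 0 : 'cV_d) k 0 *: tens (T w) (delta_mx k 0).
  rewrite (eq_bigr (fun x => f (val x.1) x.2)) => [|x _]; last by rewrite ind_coord_tens.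
  rewrite -(pair_bigA _ (fun (w : {w | w \in D}) k => f (val w) k)) /=.
  rewrite -(big_sub_cond D xpredT (fun w => \sum_k f w k)) /=.
  rewrite (eq_bigl (mem D)) => [|w]; last by rewrite andbT.
  have -> : tens h (delta_mx j 0) =
      \sum_(w in D) tens (T w * block_coef b w h) (delta_mx j 0).
    apply/ffunP => k; rewrite sum_ffunE ffunE {1}(block_coefE b_mono h) scaler_sumr.
    by apply: eq_bigr => w _; rewrite ffunE.
  rewrite -sumrB; apply: rpred_sum => w hw.
  have -> : \sum_k f w k = tens (T w) (rho (block_coef b w h) *m delta_mx j 0).
    apply/ffunP => k; rewrite sum_ffunE (bigD1 k) //= ffunE td eqxx scale1r.
    rewrite big1 ?addr0 => [|k' ne]; first by rewrite ffunE.
    by rewrite ffunE td eq_sym (negbTE ne) scale0r scaler0.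
  exact/balance_relU/block_coef_mem.
have -> : m = \sum_j tens (m j) (delta_mx j 0).
  apply/ffunP => k; rewrite sum_ffunE (bigD1 k) //= td eqxx scale1r.
  by rewrite big1 ?addr0 // => j ne; rewrite td eq_sym (negbTE ne) scale0r.
set g := BIG_F.
rewrite (eq_bigr (fun x => \sum_j ind_coord x (g j) *: ind_vec x)) => [|x _]; last first.
  by rewrite linear_sum scaler_suml.
by rewrite exchange_big -sumrB; apply: rpred_sum => j _; apply: key.
Qed.

(** An explicit matrix form of the induced module, so that its restriction to another parabolic
    subalgebra can be used as a representation. *)
Definition ind_mx h : 'M[F]_#|ind_index| :=
  \matrix_(x, y) ind_coord (enum_val x) (tens_act h (ind_vec (enum_val y))).

Fact ind_mx_is_linear : linear ind_mx.
Proof.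
move=> a g h; apply/matrixP => x y; rewrite !mxE.
have -> : tens_act (a *: g + h) (ind_vec (enum_val y)) =
  a *: tens_act g (ind_vec (enum_val y)) + tens_act h (ind_vec (enum_val y)).
  by apply/ffunP => k; rewrite !ffunE mulrDl scalerAl.
by rewrite linearP.
Qed.

HB.instance Definition _ := GRing.isLinear.Build F H 'M[F]_#|ind_index| _ ind_mx ind_mx_is_linear.

Lemma tens_act_tens g h (v : 'cV_d) : tens_act g (tens h v) = tens (g * h) v.
Proof. by apply/ffunP => k; rewrite !ffunE scalerAr. Qed.

Lemma ind_mx1 : ind_mx 1 = 1%:M.
Proof.
apply/matrixP => x y; rewrite !mxE /ind_vec tens_act_tens mul1r ind_coord_tens.
have [rho1 _] := rho_repr; set x' := enum_val x; set y' := enum_val y.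
rewrite -[T _]mulr1 block_coefM ?(valP x'.1) ?(valP y'.1) //; last first.
  by rewrite -T1 block_algT // block1.
rewrite -(inj_eq enum_val_inj) -/x' -/y'.
have -> : (x' == y') = (val x'.1 == val y'.1) && (x'.2 == y'.2) by [].
case: eqP => _; last by rewrite linear0 mul0mx mxE.
by rewrite rho1 mul1mx mxE andbT.
Qed.

Lemma ind_mxM g h : ind_mx (g * h) = ind_mx g *m ind_mx h.
Proof.
apply/matrixP => x y; rewrite !mxE.
set x' := enum_val x; set v := ind_vec _.
have -> : tens_act (g * h) v = tens_act g (tens_act h v).
  by apply/ffunP => k; rewrite !ffunE mulrA.
set m := tens_act h v.
(* Modulo [balanced], [m] equals its expansion in the [ind_vec]; [tens_act g] preserves [balanced],
   where all coordinates vanish. *)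
have := ind_coord_balanced x' (balanced_act g (ind_vec_span m)).
rewrite linearB ind_coordB => /eqP; rewrite subr_eq0 => /eqP ->.
rewrite !linear_sum.
rewrite (reindex_onto (@enum_val ind_index predT) enum_rank) /=; last first.
  by move=> z _; rewrite enum_rankK.
apply: eq_big => [z|z _]; first by rewrite enum_valK eqxx.
have tZ c m' : tens_act g (c *: m') = c *: tens_act g m' by exact: linearZ.
by rewrite !mxE tZ -[LHS]/(ind_coord x' _) ind_coordZ mulrC.
Qed.

Lemma ind_mx_tr h : \tr (ind_mx h) = ind_char B rho h.
Proof.
rewrite /ind_char (quotient_traceE (phi := ind_coord) (e := ind_vec)).
- rewrite /mxtrace [RHS](reindex_onto (@enum_val ind_index predT) enum_rank) /=; last first.
    by move=> z _; rewrite enum_rankK.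
  apply: eq_big => [z|z _]; first by rewrite enum_valK eqxx.
  by rewrite mxE lfunE.
- exact: ind_coord_balanced.
- exact: ind_vec_span.
- by move=> u hu; rewrite lfunE; apply: balanced_act.
Qed.

(** The sum runs over diagonal blocks: the block at [(w, w)] is [rho] of the [w]-coordinate of
    [h * T w]. *)
Lemma ind_charE h : ind_char B rho h = \sum_(w in D) \tr (rho (block_coef b w (h * T w))).
Proof.
rewrite /ind_char (quotient_traceE (phi := ind_coord) (e := ind_vec)).
- pose f w k := rho (block_coef b w (h * T w)) k k.
  rewrite (eq_bigr (fun x => f (val x.1) x.2)) => [|x _]; last first.
    rewrite lfunE -[LHS]/(ind_coord x (tens_act h (ind_vec x))) tens_act_tens.
    rewrite ind_coord_tens mxE.
    rewrite (bigD1 x.2) //= mxE !eqxx mulr1 big1 ?addr0 // => k ne.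
    by rewrite mxE (negbTE ne) mulr0.
  rewrite -(pair_bigA _ (fun (w : {w | w \in D}) k => f (val w) k)) /=.
  rewrite -(big_sub_cond D xpredT (fun w => \sum_k f w k)) /=.
  by apply: eq_bigl => w; rewrite andbT.
- exact: ind_coord_balanced.
- exact: ind_vec_span.
- by move=> u hu; rewrite lfunE; apply: balanced_act.
Qed.

Lemma ind_char_comm g h : ind_char B rho (g * h) = ind_char B rho (h * g).
Proof. by rewrite -!ind_mx_tr !ind_mxM mxtrace_mulC. Qed.

End Induced.

(** * Traces are determined by increasing products *)

Section TraceDetermined.
Variables (F : fieldType) (q : F) (n : nat).
Local Notation H := (hecke q n).
Local Notation T := (T q).
Implicit Types (D E : H) (u v w : 'S_n) (i j : 'I_n.-1) (s : seq 'I_n.-1).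

Definition increasing s := sorted (fun i j => (i < j)%N) s.

Definition Tseq s : H := \prod_(i <- s) T (simple i).

Lemma Tseq_cons i s : Tseq (i :: s) = T (simple i) * Tseq s.
Proof. exact: big_cons. Qed.

(** Truncated subtraction puts all positions up to [m] in block [0] and separates the others, so the
    block group is the copy of [S_(m+1)] fixing every [a > m]. *)
Local Notation tailblk m := (fun a : 'I_n => (a - m)%N).

Fact tailblk_mono m : forall x y : 'I_n, (x <= y)%N -> (tailblk m x <= tailblk m y)%N.
Proof. by move=> x y le; apply: leq_sub2r. Qed.

Lemma tailblkP m u : reflect (forall a : 'I_n, (m < a)%N -> u a = a) (u \in blockgrp (tailblk m)).
Proof.
apply: (iffP (blockP _ _)) => [hu a lt|hu a].
  by apply: val_inj => /=; have := hu a; lia.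
have [le|] := leqP a m; last by move/hu ->.
have [|lt] := leqP (u a) m; first by move: le; rewrite -!subn_eq0 => /eqP -> /eqP ->.
by have /perm_inj <- := hu _ lt; rewrite hu.
Qed.

Lemma commute_tail m u i : u \in blockgrp (tailblk m) -> (m < i)%N ->
  T u * T (simple i) = T (simple i) * T u.
Proof.
move=> hu lt; have fixl x : x \in blockgrp (tailblk m) -> x (lpos i) = lpos i.
  by move/tailblkP; apply.
have fixr x : x \in blockgrp (tailblk m) -> x (rpos i) = rpos i.
  by move/tailblkP; apply; apply: ltnW.
have nd x : x \in blockgrp (tailblk m) -> ~~ descent i x.
  by move=> hx; rewrite /descent fixl // fixr //= -leqNgt.
rewrite T_simpleM (negbTE (nd _ hu)) T_Msimple ?nd ?blockV //; congr T.
have e : (simple i = simple i ^ u)%g by rewrite /simple tpermJ fixl // fixr.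
by rewrite {1}e conjgE mulKVg.
Qed.

Variable theta : {linear H -> F^o}.
Hypothesis theta_comm : forall D E, theta (D * E) = theta (E * D).
Hypothesis theta_inc : forall s, increasing s -> theta (Tseq s) = 0.

(** When the last reflection of the parabolic occurs, the factor to its right lies in the smaller
    parabolic: it commutes with [Tseq s] and cyclicity moves it to the front, while the reflection
    joins the increasing product. *)
Lemma trace_vanish_tail m (a : H) s : (m < n)%N -> a \in block_alg (tailblk m) q ->
  increasing s -> all (fun i => m <= i)%N s -> theta (a * Tseq s) = 0.
Proof.
elim: m a s => [|m IH] a s ltm ha incs alls.
  rewrite (block_sum ha) mulr_suml linear_sum big1 // => v hv.
  rewrite -scalerAl linearZ /=.
  have -> : v = 1%g.
    apply/permP => x; rewrite perm1; have [|] := ltnP 0 x; first by move/tailblkP: hv; apply.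
    move=> x0; have [|lt] := leqP (v x) 0; first by move=> v0; apply: val_inj => /=; lia.
    by have /perm_inj := (tailblkP _ _ hv) _ lt.
  by rewrite T1 mul1r theta_inc ?scaler0.
have ltm' : (m < n.-1)%N by lia.
pose im := Ordinal ltm'.
have allm : all (fun i => m <= i)%N s.
  by apply: sub_all alls => i; apply: ltnW.
have subm x : x \in blockgrp (tailblk m) -> x \in blockgrp (tailblk m.+1).
  by move/tailblkP => hx; apply/tailblkP => y lty; apply: hx; apply: ltnW.
have max u : u \in blockgrp (tailblk m.+1) -> forall x : 'I_n, (x <= m.+1)%N -> (u x <= m.+1)%N.
  move=> /tailblkP hu x le; rewrite leqNgt; apply/negP => lt.
  by have /perm_inj e := hu _ lt; rewrite e ltnNge le in lt.
(* [j] is the position that [u] sends to the last letter [m + 1], [c] bounds its distance from its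
   own place, and [a'] collects the reflections stripped from [u]. *)
suff K c u (j : 'I_n) a' : u \in blockgrp (tailblk m.+1) -> u j = rpos im ->
    (m.+1 - j <= c)%N -> a' \in block_alg (tailblk m) q -> theta (a' * T u * Tseq s) = 0.
  rewrite (block_sum ha) mulr_suml linear_sum big1 // => v hv.
  rewrite -scalerAl linearZ /= -[T v]mul1r (K m.+1 v (v^-1%g (rpos im))) ?scaler0 //.
  - by rewrite permKV.
  - exact: leq_subr.
  - by rewrite -T1 block_algT // block1.
elim: c u j a' => [|c IHc] u j a' hu uj le ha'.
  have ltj : (m < j)%N by lia.
  have ej : j = rpos im.
    have [lt|le'] := ltnP m.+1 j; first by move/tailblkP: hu => /(_ _ lt); rewrite uj.
    by apply: val_inj => /=; lia.
  apply: IH => //; first exact: ltnW.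
  apply: (block_algM (@tailblk_mono m)) => //; apply: block_algT; apply/tailblkP => x.
  rewrite leq_eqVlt => /orP[/eqP ex|]; last by move/tailblkP: hu; apply.
  by have -> : x = rpos im by [apply: val_inj]; rewrite -{1}ej uj.
have [|lej] := leqP (m.+1 - j) c; first by move/IHc => K; apply: (K u).
have ltj : (j <= m)%N by lia.
have ltj' : (j < n.-1)%N by lia.
pose ij := Ordinal ltj'.
have elj : lpos ij = j by apply: val_inj.
have di : descent ij u.
  rewrite /descent elj uj /= ltn_neqAle max ?andbT //=.
  apply/eqP => e; have : u (rpos ij) = u j by rewrite uj; apply: val_inj.
  by move/perm_inj/(congr1 val) => /=; lia.
have hij : simple ij \in blockgrp (tailblk m.+1).
  by rewrite block_simple /=; apply/eqP; lia.
set u1 := (simple ij * u)%g.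
have hu1 : u1 \in blockgrp (tailblk m.+1) by apply: blockM.
have u1j : u1 (rpos ij) = rpos im by rewrite permM tpermR elj.
have Tu : T u = T (simple ij) * T u1 by rewrite T_simpleM descentM di simpleK.
(* A reflection below [m] is absorbed into [a']; the reflection [m] itself becomes the new head of
   the increasing product. *)
have [ltm2|lem] := ltnP j m.
  rewrite Tu mulrA; apply: (IHc u1 (rpos ij)) => //; first by move: le ltm2; clear=> /= ? ?; lia.
  by apply: (block_algM (@tailblk_mono m)) => //; apply: block_algT; rewrite block_simple /=; apply/eqP; move: ltm2; clear; lia.
have eij : ij = im by apply: val_inj; move: ltj lem; clear=> /= ? ?; lia.
have hu1m : u1 \in blockgrp (tailblk m).
  apply/tailblkP => x; rewrite leq_eqVlt => /orP[/eqP ex|]; last by move/tailblkP: hu1; apply.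
  have -> : x = rpos im by apply: val_inj.
  by rewrite -{1}eij.
have com : T u1 * Tseq s = Tseq s * T u1.
  elim: (s) alls => [|i s' IHs] /=; first by rewrite /Tseq big_nil mulr1 mul1r.
  case/andP=> lti /IHs e; rewrite Tseq_cons mulrA (commute_tail hu1m) //.
  by rewrite -mulrA e mulrA.
rewrite Tu -!mulrA com 2!mulrA theta_comm -!mulrA -Tseq_cons mulrA.
apply: IH => //; first exact: ltnW.
- by apply: (block_algM (@tailblk_mono m)) => //; apply: block_algT.
- rewrite eij /increasing /=; move: incs alls; clear; case: s => //= i s pth.
  by case/andP => lt _; rewrite pth andbT.
- by rewrite /= allm andbT.
Qed.

Theorem trace_eq0 D : theta D = 0.
Proof.
(* For [n = 0] there is no [m < n] to start from, so this trivial algebra is treated apart. *)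
have [n0|n0] := posnP n.
  have e1 w : w = 1%g by apply/permP => a; have := ltn_ord a; rewrite [X in (_ < X)%N]n0.
  rewrite (hecke_sum D) linear_sum big1 // => w _; rewrite (e1 w) linearZ /=.
  have -> : T 1 = Tseq [::] by rewrite /Tseq big_nil T1.
  by rewrite theta_inc ?scaler0.
rewrite -[D]mulr1; have -> : (1 : H) = Tseq [::] by rewrite /Tseq big_nil.
apply: (@trace_vanish_tail n.-1) => //; first by rewrite prednK.
apply/mem_block_alg => w /tailblkP []; move=> a; have := ltn_ord a; lia.
Qed.

End TraceDetermined.

Theorem trace_ext (F : fieldType) (q : F) n (f g : {linear hecke q n -> F^o}) :
  (forall D E, f (D * E) = f (E * D)) -> (forall D E, g (D * E) = g (E * D)) ->
  (forall s, increasing s -> f (Tseq q s) = g (Tseq q s)) -> f =1 g.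
Proof.
move=> fC gC e D; apply/eqP; rewrite -subr_eq0.
pose h : {linear hecke q n -> F^o} := (f \- g)%R.
rewrite -[_ - _]/(h D); apply/eqP; apply: trace_eq0 => [E E'|s hs] /=.
  by rewrite fC gC.
by rewrite e ?subrr.
Qed.

(** * Induced functionals on increasing products *)

Section InducedOnTseq.
Variables (n : nat) (b : 'I_n -> nat).
Hypothesis b_mono : forall x y : 'I_n, (x <= y)%N -> (b x <= b y)%N.
Variables (F : fieldType) (q : F).
Local Notation H := (hecke q n).
Local Notation T := (T q).
Local Notation B := (block_alg b q).
Implicit Types (d u v w : 'S_n) (i j : 'I_n.-1) (s : seq 'I_n.-1).

(* The diagonal coefficient of [T_s] acting on words, at adjacent letters [x], [y]:
   [k] is the value on [T_s] of the functional being induced. *)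
Definition wt (k : F) (x y : nat) : F :=
  if (y < x)%N then q - 1 else if x == y then k else 0.

(** The formula of [ind_charE], with any functional in place of the trace of [rho]. *)
Definition induce (f : H -> F) (h : H) : F^o :=
  \sum_(d in minrep b) f (block_coef b d (h * T d)).

Lemma T_minrep_supp d (u : H) : d \in minrep b -> u \in B ->
  supp_in (fun w => [forall a, b (w a) == b (d a)]) (T d * u).
Proof.
move=> hd hu; rewrite (block_sum hu) mulr_sumr; apply: supp_in_sum => v hv.
rewrite -scalerAr; apply: supp_inZ; rewrite (T_minrepM b_mono) //; apply: supp_inT.
by apply/forallP => a; rewrite permM (blockP _ _ hv).
Qed.

(* Once a letter has moved, position [a] carries a wrong letter which the
   remaining, smaller, reflections never touch. *)
Lemma Tseq_minrep k d m s : d \in minrep b -> increasing s -> all (fun i => m <= i)%N s ->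
  exists (c : F) (s' : seq 'I_n.-1) (E : H),
  [/\ Tseq q s * T d = c *: (T d * Tseq q s') + E,
      supp_in (fun w => [exists a : 'I_n, (m < a)%N && (b (w a) != b (d a))]) E,
      uniq s' /\ {in s', forall j, exists2 i, i \in s & lpos j = d (lpos i)},
      Tseq q s' \in B
    & c * k ^+ size s' = \prod_(i <- s) wt k (b (d (lpos i))) (b (d (rpos i)))].
Proof.
move=> hd; elim: s m => [|i s IH] m incs /=.
  exists 1, [::], 0; split=> //; first by rewrite scale1r addr0 /Tseq big_nil mulr1 mul1r.
  - exact: supp_in0.
  - by rewrite /Tseq big_nil -T1 block_algT // block1.
  - by rewrite big_nil mulr1.
case/andP=> lemi alls.
have alls' : all (fun j => i < j)%N s.
  by move: incs; rewrite /increasing /= path_sortedE => [/andP[]|x y z]; last exact: ltn_trans.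
have incs' : increasing s by move: incs => /path_sorted.
have [c [s' [E [e sE [us hs'] hB hc]]]] := IH i.+1 incs' alls'.
set P := (fun w : 'S_n => _) in sE.
have sE' : supp_in (fun w => [exists a : 'I_n, (m < a)%N && (b (w a) != b (d a))])
    (T (simple i) * E).
  have := @supp_in_simple _ q _ P i E _ sE => sE'.
  move=> w nw; apply: sE' => [v|].
    apply/existsP/existsP => -[a /andP[lta ne]]; exists a; rewrite lta /=;
    move: ne; rewrite permM /simple tpermD // -val_eqE /=; apply/eqP; move: lta; clear; lia.
  apply: contra nw => /existsP[a /andP[lta ne]]; apply/existsP; exists a.
  by rewrite ne andbT; lia.
rewrite Tseq_cons -mulrA e mulrDr -scalerAr mulrA T_simpleM big_cons -hc /wt.
rewrite -(minrep_desc b_mono i hd).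
set x := b (d (lpos i)); set y := b (d (rpos i)).
have moved : x != y -> supp_in (fun w => [exists a : 'I_n, (m < a)%N && (b (w a) != b (d a))])
    (T (simple i * d)%g * Tseq q s').
  move=> ne w nw; have hd1 := minrep_simple hd ne.
  apply: (T_minrep_supp hd1 hB); apply: contra nw => /forallP hw.
  apply/existsP; exists (rpos i); rewrite (eqP (hw _)) permM tpermR ne andbT /=.
  by lia.
(* Decreasing letters: the diagonal coefficient is [q - 1], and the term in [T (simple i * d)] goes
   into the error. *)
case: ifP => [di|ndi].
  have ne : x != y.
    by move: di; rewrite (minrep_desc b_mono) // ltn_neqAle eq_sym => /andP[].
  exists (c * (q - 1)), s', (c *: (q *: (T (simple i * d)%g * Tseq q s')) + T (simple i) * E).
  split=> //.
  - by rewrite mulrDl scalerDr -!scalerAl !scalerA addrA.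
  - by apply: supp_inD => //; do 2!apply: supp_inZ; apply: moved.
  - by split=> // j /hs'[i' hi' ej]; exists i' => //; rewrite inE hi' orbT.
  - by rewrite mulrAC mulrC.
(* Equal letters: [simple i * d = d * simple j], so a factor [T (simple j)], worth [k], enters the
   parabolic. Increasing letters leave no diagonal term. *)
case: eqP => [exy|/eqP ne].
  have [j [el er ej]] := minrep_same b_mono hd exy.
  have hj : simple j \in blockgrp b by rewrite block_simple el er; apply/eqP.
  exists c, (j :: s'), (T (simple i) * E); split=> //=.
  - by rewrite Tseq_cons mulrA ej (T_minrepM b_mono).
  - split=> [|j'].
      rewrite us andbT; apply/negP => /hs'[i' hi']; rewrite el => /perm_inj/(congr1 val) /= e'.
      by have /allP/(_ _ hi') := alls'; rewrite e' ltnn.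
    rewrite inE => /orP[/eqP ->|/hs'[i' hi' ej']]; first by exists i; rewrite ?mem_head.
    by exists i' => //; rewrite inE hi' orbT.
  - by rewrite Tseq_cons block_algM // block_algT.
  - by rewrite exprS mulrCA.
exists 0, [::], (c *: (T (simple i * d)%g * Tseq q s') + T (simple i) * E); split=> //.
- by rewrite scale0r add0r.
- by apply: supp_inD => //; apply: supp_inZ; apply: moved.
- by rewrite /Tseq big_nil -T1 block_algT // block1.
- by rewrite !mul0r.
Qed.

Lemma induce_Tseq (f : {linear H -> F^o}) k s :
  (forall s', uniq s' -> f (Tseq q s') = k ^+ size s') -> increasing s ->
  induce f (Tseq q s) =
  \sum_(d in minrep b) \prod_(i <- s) wt k (b (d (lpos i))) (b (d (rpos i))).
Proof.
move=> hf incs; apply: eq_bigr => d hd.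
have alls : all (fun i => 0 <= i)%N s by apply/allP.
have [c [s' [E [e sE [us _] hB <-]]]] := Tseq_minrep k hd incs alls.
rewrite e block_coefP block_coefM // eqxx.
have -> : block_coef b d E = 0.
  rewrite /block_coef big1 // => v hv; rewrite sE ?scale0r //.
  apply/existsP => -[a /andP[_]]; rewrite permM.
  by rewrite (blockP _ _ hv) eqxx.
by rewrite addr0 linearZ /= hf.
Qed.

End InducedOnTseq.

(** * Words *)

Section YoungWords.
Variables (n : nat) (la : seq nat).
Hypothesis la_sum : sumn la = n.

Definition yblk (a : 'I_n) : nat := reshape_index la a.

Lemma yblk_mono (x y : 'I_n) : (x <= y)%N -> (yblk x <= yblk y)%N.
Proof.
by rewrite /yblk (reshape_leq la x y) => /orP[/ltnW //|/andP[/eqP ->]].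
Qed.

Lemma yblk_lt (x : 'I_n) : (yblk x < size la)%N.
Proof. by rewrite reshape_indexP // la_sum. Qed.

Lemma card_yblk k : #|[set x : 'I_n | yblk x == k]| = nth 0%N la k.
Proof.
have lt (c : 'I_(nth 0%N la k)) : (flatten_index la k c < n)%N.
  by rewrite -la_sum flatten_indexP.
pose g c : 'I_n := Ordinal (lt c).
have gI : injective g.
  move=> c c' [e]; apply: val_inj => /=.
  by rewrite -(flatten_indexKr (ltn_ord c)) e flatten_indexKr.
rewrite -[RHS]card_ord -(card_imset _ gI); apply: eq_card => x; rewrite inE.
apply/eqP/imsetP => [e|[c _ ->]]; last by rewrite /yblk /= flatten_indexKl.
have hc : (reshape_offset la x < nth 0%N la k)%N.
  by rewrite -e reshape_offsetP // la_sum.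
exists (Ordinal hc) => //; apply: val_inj.
by rewrite /= -e reshape_indexK.
Qed.

Variable N : nat.
Hypothesis la_N : (size la <= N.+1)%N.

Definition content (f : {ffun 'I_n -> 'I_N.+1}) : 'X_{1..N.+1} :=
  (\sum_a U_(f a))%MM.

Lemma contentE f k : content f k = #|[set a | f a == k]|.
Proof.
rewrite /content mnm_sumE -sum1_card [RHS]big_mkcond; apply: eq_bigr => a _.
by rewrite mnm1E inE; case: eqP.
Qed.

Definition shape_mon : 'X_{1..N.+1} := [multinom nth 0%N la i | i < N.+1].

Definition word (d : 'S_n) : {ffun 'I_n -> 'I_N.+1} := [ffun a => inord (yblk (d a))].

Lemma wordE d a : val (word d a) = yblk (d a).
Proof. by rewrite ffunE /= inordK // (leq_trans (yblk_lt _)). Qed.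

Lemma content_word d : content (word d) = shape_mon.
Proof.
apply/mnmP => k; rewrite contentE mnmE -card_yblk.
rewrite -(card_imset _ (@perm_inj _ d)); apply: eq_card => x; rewrite !inE.
apply/imsetP/idP => [[a]|e].
  by rewrite inE -val_eqE wordE => /eqP e ->; rewrite e.
exists (d^-1%g x); last by rewrite permKV.
by rewrite inE -val_eqE wordE permKV.
Qed.

Lemma word_inj : {in minrep yblk &, injective word}.
Proof.
move=> d d' hd hd' /ffunP e; apply: (minrep_word_inj yblk_mono hd hd') => a.
by rewrite -!wordE e.
Qed.

(** [f] has the letter counts of [word 1], hence is its rearrangement by some [p]; the
    representative of the coset of [p] has the same word. *)
Lemma word_surj f : content f = shape_mon -> exists2 d, d \in minrep yblk & f = word d.
Proof.
move=> cf; pose w0 := word 1.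
have : perm_eq [tuple f a | a < n] [tuple w0 a | a < n].
  apply/allP => k _ /=; have cnt (g : {ffun 'I_n -> 'I_N.+1}) : count_mem k [tuple g a | a < n] = content g k.
    rewrite contentE -sum1_count big_tuple -sum1_card; apply: eq_bigl => a.
    by rewrite tnth_mktuple inE.
  by rewrite [count _ _]cnt [X in _ == X]cnt cf content_word.
case/tuple_permP => p e.
have fE a : f a = w0 (p a).
  by have := congr1 (fun t => tnth t a) (val_inj e); rewrite !tnth_mktuple.
have [d [v [hd hv ep]]] := minrep_decomp yblk_mono p.
exists d => //; apply/ffunP => a; apply: val_inj; rewrite fE !wordE perm1 ep permM.
by rewrite (blockP _ _ hv).
Qed.

Lemma sum_words (R : nmodType) (G : ('I_n -> nat) -> R) :
  (forall g g', g =1 g' -> G g = G g') ->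
  \sum_(d in minrep yblk) G (fun a => yblk (d a)) =
  \sum_(f : {ffun 'I_n -> 'I_N.+1} | content f == shape_mon) G (fun a => f a).
Proof.
move=> Gext; transitivity (\sum_(f in word @: minrep yblk) G (fun a => f a)).
  rewrite big_imset; last exact: word_inj.
  by apply: eq_bigr => d _; apply: Gext => a; rewrite wordE.
apply: eq_bigl => f; apply/imsetP/eqP => [[d _ ->]|]; first exact: content_word.
by case/word_surj => d hd ->; exists d.
Qed.

End YoungWords.

Section WordPolynomial.
Variables (F : fieldType) (q : F) (n N : nat).
Implicit Types (s : seq 'I_n.-1) (k : F).

(** The sum [W_k(J)] over words, with [s] listing [J]. *)
Definition Wpoly k s : {mpoly F[N.+1]} :=
  \sum_(f : {ffun 'I_n -> 'I_N.+1})
     (\prod_(i <- s) wt q k (f (lpos i)) (f (rpos i))) *: \prod_a 'X_(f a).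

Lemma induce_Wpoly la (g : {linear hecke q n -> F^o}) k s :
  sumn la = n -> (size la <= N.+1)%N ->
  (forall s', uniq s' -> g (Tseq q s') = k ^+ size s') -> increasing s ->
  induce (yblk la) g (Tseq q s) = (Wpoly k s)@_(shape_mon la N).
Proof.
move=> sla lN hg incs; rewrite (induce_Tseq (@yblk_mono n la) hg incs).
pose G (x : 'I_n -> nat) := \prod_(i <- s) wt q k (x (lpos i)) (x (rpos i)).
rewrite (sum_words sla lN (G := G)) => [|x y e]; last first.
  by apply: eq_bigr => i _; rewrite !e.
rewrite /Wpoly raddf_sum big_mkcond; apply: eq_bigr => f _ /=.
have -> : \prod_a 'X_(f a) = 'X_[F, content f].
  by rewrite /content (big_morph _ (@mpolyXD _ F) (@mpolyX0 _ F)).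
by rewrite mcoeffZ mcoeffX; case: eqP => _; rewrite ?mulr1 ?mulr0.
Qed.

End WordPolynomial.

(** * Generating functions of words *)

Section Convolution.
Variable R : comPzRingType.
Implicit Types (A B c : nat -> R) (y : R).

(** The coefficient of [u^k] in [u c(u) A(u)], the right-hand side of Newton's identities. *)
Definition conv c A (k : nat) : R := \sum_(j < k) c j * A (k - j.+1)%N.

(** The hypotheses say [(1 - y u) A(u) = (1 - y' u) B(u)]; both sides are multiplied by [u c(u)]. *)
Lemma conv_rec c A B y y' : A 0%N = B 0%N ->
  (forall k, A k.+1 - y * A k = B k.+1 - y' * B k) ->
  forall k, conv c A k.+1 - y * conv c A k = conv c B k.+1 - y' * conv c B k.
Proof.
move=> e0 e k; rewrite /conv !big_ord_recr /= !subnn e0 !mulr_sumr.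
rewrite addrAC [RHS]addrAC; congr (_ + _); rewrite -!sumrB; apply: eq_bigr => j _.
by rewrite subSS -(subnSK (ltn_ord j)) !(mulrCA _ (c j)) -!mulrBr e.
Qed.

(** Here [u c(u) = y u / (1 - y u)]. *)
Lemma conv_exp A y k : conv (fun j => y ^+ j.+1) A k.+1 =
  y * A k + y * conv (fun j => y ^+ j.+1) A k.
Proof.
rewrite /conv big_ord_recl /= subSS subn0 expr1; congr (_ + _).
by rewrite mulr_sumr; apply: eq_bigr => j _; rewrite /bump /= add1n subSS mulrA -exprS.
Qed.

Lemma convD c c' A k : conv (fun j => c j + c' j) A k = conv c A k + conv c' A k.
Proof. by rewrite /conv -big_split; apply: eq_bigr => j _; rewrite mulrDl. Qed.

Lemma convN c A k : conv (fun j => - c j) A k = - conv c A k.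
Proof. by rewrite /conv -sumrN; apply: eq_bigr => j _; rewrite mulNr. Qed.

Lemma eq_conv c c' A k : c =1 c' -> conv c A k = conv c' A k.
Proof. by move=> e; apply: eq_bigr => j _; rewrite e. Qed.

(* The coefficient of [u^k] in [\prod_(x <- l) (1 - z' x u) / (1 - z x u)]. *)
Fixpoint ratser (z z' : R) (l : seq R) (k : nat) {struct l} : R :=
  if l is x :: l' then
    (fix rs k := if k is k'.+1
       then z * x * rs k' + ratser z z' l' k - z' * x * ratser z z' l' k' else 1) k
  else (k == 0%N)%:R.

Lemma ratser0 z z' l : ratser z z' l 0 = 1. Proof. by case: l. Qed.

Lemma ratserS z z' x l k : ratser z z' (x :: l) k.+1 =
  z * x * ratser z z' (x :: l) k + ratser z z' l k.+1 - z' * x * ratser z z' l k.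
Proof. by []. Qed.

(** The logarithmic derivative of the product, computed by adding one factor at a time. *)
Lemma ratser_newton z z' l k : k%:R * ratser z z' l k =
  conv (fun j => (z ^+ j.+1 - z' ^+ j.+1) * \sum_(x <- l) x ^+ j.+1) (ratser z z' l) k.
Proof.
elim: l k => [|x l IH] k.
  rewrite /conv big1 => [|j _]; last by rewrite big_nil mulr0 mul0r.
  by case: k => [|k] /=; rewrite ?mul0r ?mulr0.
set A := ratser z z' (x :: l); set B := ratser z z' l in IH *.
set c' := (fun j => (z ^+ j.+1 - z' ^+ j.+1) * \sum_(x <- l) x ^+ j.+1) in IH.
pose y := z * x; pose y' := z' * x.
have A0 : A 0%N = B 0%N by rewrite /A /B !ratser0.
have AB m : A m.+1 - y * A m = B m.+1 - y' * B m by rewrite /A ratserS -/A -/B -/y -/y'; ring.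
pose cy y j : R := y ^+ j.+1.
have -> : conv (fun j => (z ^+ j.+1 - z' ^+ j.+1) * \sum_(x0 <- x :: l) x0 ^+ j.+1) A k =
   conv c' A k + conv (cy y) A k - conv (cy y') A k.
  rewrite -convN -!convD; apply: eq_conv => j.
  by rewrite big_cons /c' /cy /y /y' !exprMn; ring.
elim: k => [|k IHk]; first by rewrite /conv !big_ord0 mul0r addr0 subr0.
(* [r1] to [r4] step the convolutions from [k] to [k + 1]; together with [IHk] they reduce the goal
   to a ring identity. *)
have r1 := conv_rec c' A0 AB k; rewrite -!IH in r1.
have r2 := conv_exp A y k.
have r3 := conv_rec (cy y') A0 AB k; have r4 := conv_exp B y' k.
have eA : A k.+1 = y * A k + B k.+1 - y' * B k by have := AB k => /eqP; rewrite subr_eq => /eqP ->; ring.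
move/eqP: r1; rewrite subr_eq => /eqP ->; rewrite r2.
move/eqP: r3; rewrite subr_eq => /eqP ->; rewrite r4.
rewrite eA -natr1.
transitivity (y * (k%:R * A k) + y * A k + (k%:R + 1) * (B k.+1 - y' * B k)); first by ring.
by rewrite IHk; ring.
Qed.

End Convolution.

(** * Transfer matrices and runs of linked letters *)

Section Transfer.
Variables (R : comPzRingType) (M : nat) (x : 'I_M -> R) (w : 'I_M -> 'I_M -> R).

(* The weight of the words on [m.+1] positions ending with the letter [a]. *)
Fixpoint transfer (L : pred nat) (m : nat) (a : 'I_M) : R :=
  if m is m'.+1
  then \sum_a' transfer L m' a' * (if L m' then w a' a else 1) * x a else x a.

Lemma transferE L m a : transfer L m a =
  \sum_(f : {ffun 'I_m.+1 -> 'I_M} | f ord_max == a)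
     (\prod_(i < m | L i) w (f (widen_ord (leqnSn m) i)) (f (lift ord0 i))) *
      \prod_i x (f i).
Proof.
elim: m a => [|m IH] a /=.
  rewrite (bigD1 [ffun=> a]) /=; last by rewrite ffunE.
  rewrite big_ord0 big_ord1 ffunE mul1r big1 ?addr0 // => f /andP[/eqP e /eqP[]].
  by apply/ffunP => i; rewrite ffunE -e [i]ord1 [ord_max]ord1.
pose ext (f : {ffun 'I_m.+1 -> 'I_M}) : {ffun 'I_m.+2 -> 'I_M} :=
  [ffun i => if unlift ord_max i is Some j then f j else a].
pose res (f : {ffun 'I_m.+2 -> 'I_M}) : {ffun 'I_m.+1 -> 'I_M} :=
  [ffun j => f (lift ord_max j)].
have extK : cancel ext res by move=> f; apply/ffunP => j; rewrite !ffunE liftK.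
rewrite (reindex_onto ext res) /=; last first.
  move=> f /eqP e; apply/ffunP => i; rewrite !ffunE.
  by case: unliftP => [j ->|->]; rewrite ?ffunE.
rewrite [RHS](eq_bigl xpredT) => [|f]; last by rewrite extK eqxx andbT ffunE unlift_none eqxx.
rewrite [RHS](partition_big (fun f : {ffun 'I_m.+1 -> 'I_M} => f ord_max) xpredT) //=.
apply: eq_bigr => a' _; rewrite IH !mulr_suml; apply: eq_bigr => f /eqP fa'.
have ew (j : 'I_m.+1) : ext f (widen_ord (leqnSn m.+1) j) = f j.
  have -> : widen_ord (leqnSn m.+1) j = lift ord_max j.
    by apply: val_inj; rewrite /= /bump leqNgt ltn_ord.
  by rewrite ffunE liftK.
have em : ext f ord_max = a by rewrite ffunE unlift_none.
rewrite [in RHS]big_mkcond [in RHS]big_ord_recr [X in _ = _ * X]big_ord_recr /= em.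
rewrite !ew.
have -> : \prod_(i < m.+1) x (ext f (widen_ord (leqnSn m.+1) i)) = \prod_i x (f i).
  by apply: eq_bigr => i _; rewrite ew.
have -> : lift ord0 (ord_max : 'I_m.+1) = ord_max :> 'I_m.+2 by apply: val_inj.
rewrite em fa' -fa'.
rewrite -!mulrA; congr (_ * _); last by rewrite mulrCA.
rewrite [LHS]big_mkcond; apply: eq_bigr => i _ /=; case: (L i) => //.
by rewrite ew; congr w; rewrite -[LHS]ew; congr (ext f _); apply: val_inj.
Qed.

(* Lengths, minus one, of the maximal runs of positions joined by [L]; the current
   run comes first. *)
Fixpoint runs (L : pred nat) (m : nat) : nat * seq nat :=
  if m is m'.+1 then
    let: (r, t) := runs L m' in if L m' then (r.+1, t) else (0%N, r :: t)
  else (0%N, [::]).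

Lemma sumn_runs L m (rs := runs L m) : sumn [seq r.+1 | r <- rs.1 :: rs.2] = m.+1.
Proof.
rewrite {}/rs; elim: m => //= m; case: runs => r t /= IH.
by case: (L m) => /=; lia.
Qed.

Local Notation U := (transfer xpredT).

(** Where [L] fails, the next letter is unconstrained, so the total of the finished run splits off
    as a factor. *)
Lemma transfer_runs L m a (rs := runs L m) :
  transfer L m a = (\prod_(r <- rs.2) \sum_a' U r a') * U rs.1 a.
Proof.
rewrite {}/rs; elim: m a => [|m IH] a /=; first by rewrite big_nil mul1r.
case: (runs L m) IH => r t /= IH; case: (L m) => /=.
  rewrite mulr_sumr; apply: eq_bigr => a' _.
  by rewrite IH !mulrA.
rewrite big_cons -mulr_suml; congr (_ * _).
by rewrite mulrC mulr_sumr; apply: eq_bigr => a' _; rewrite IH mulr1.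
Qed.

End Transfer.

Section DescendingTransfer.
Variables (R : comPzRingType) (M : nat) (x : nat -> R) (z t : R).

Local Notation w := (fun a b : 'I_M => if (b < a)%N then t else if a == b then z else 0).
Local Notation U := (transfer (fun a : 'I_M => x a) w xpredT).
Local Notation xs a := (drop a (mkseq x M)).
Local Notation G := (ratser z (z - t)).

(** A run ending in [a] uses only letters at least [a], so it is counted by the difference between
    the alphabets starting at [a] and at [a + 1]. Keeping [t] as a factor avoids dividing by it. *)
Lemma transfer_ratser r (a : 'I_M) :
  t * U r a = G (xs a) r.+1 - G (xs a.+1) r.+1.
Proof.
have dropE (b : 'I_M) : xs b = x b :: xs b.+1.
  by rewrite (drop_nth 0) ?size_mkseq // nth_mkseq.
elim: r a => [|r IH] a; first by rewrite /= dropE ratserS !ratser0; ring.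
rewrite /= -mulr_suml mulrA mulr_sumr.
have -> : \sum_a' t * (U r a' * (if (a < a')%N then t else if a' == a then z else 0)) =
   t * G (xs a.+1) r.+1 + z * (G (xs a) r.+1 - G (xs a.+1) r.+1).
  (* The letters above [a] telescope; the letter [a] itself brings the weight [z]. *)
  rewrite (bigID (fun a' : 'I_M => (a < a')%N)) /=; congr (_ + _).
    under eq_bigr => a' lt do rewrite lt mulrA IH.
    rewrite -mulr_suml mulrC; congr (_ * _).
    have := telescope_sumr (fun b => G (xs b) r.+1) (ltn_ord a : (a.+1 <= M)%N).
    rewrite [xs M]drop_oversize ?size_mkseq // [G [::] _]/= => /(congr1 -%R).
    rewrite sub0r opprK -sumrN => <-.
    rewrite [RHS](@big_nat_widenl _ _ _ a.+1 0) //= [RHS]big_mkord.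
    by apply: eq_bigr => b _; rewrite opprB.
  rewrite (bigD1 a) ?ltnn //= eqxx big1 ?addr0 => [|b /andP[nlt ne]].
    by rewrite mulrA IH mulrC.
  by rewrite (negbTE nlt) (negbTE ne) !mulr0.
rewrite [G (xs a) r.+2](_ : _ = z * x a * G (xs a) r.+1 + G (xs a.+1) r.+2
    - (z - t) * x a * G (xs a.+1) r.+1); last by rewrite dropE.
by ring.
Qed.

Lemma transfer_total r : t * (\sum_a U r a) = G (mkseq x M) r.+1.
Proof.
rewrite mulr_sumr; under eq_bigr => a _ do rewrite transfer_ratser.
have := telescope_sumr (fun b => G (xs b) r.+1) (leq0n M).
rewrite drop_oversize ?size_mkseq // drop0 [G [::] _]/= sub0r big_mkord => /(congr1 -%R).
rewrite opprK -sumrN => <-; apply: eq_bigr => a _; by rewrite opprB.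
Qed.

End DescendingTransfer.

Section Factorization.
Variables (F : fieldType) (q : F) (n N : nat).
Local Notation R := {mpoly F[N.+1]}.
Implicit Types (s : seq 'I_n.-1) (k : F).

Definition Wser k : nat -> R :=
  ratser k%:MP (k%:MP - (q - 1)%:MP) (mkseq (fun a => 'X_(inord a)) N.+1).

Lemma Wser0 k : Wser k 0 = 1. Proof. exact: ratser0. Qed.

Lemma Wser_newton k j : j%:R * Wser k j =
  \sum_(i < j) (k ^+ i.+1 - (k - (q - 1)) ^+ i.+1) *:
     ((\sum_(a < N.+1) 'X_a ^+ i.+1) * Wser k (j - i.+1)).
Proof.
rewrite /Wser ratser_newton; apply: eq_bigr => i _.
have -> : \sum_(x <- mkseq (fun a => 'X_(inord a)) N.+1) x ^+ i.+1 =
    \sum_(a < N.+1) ('X_a : R) ^+ i.+1.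
  rewrite /mkseq big_map -[iota 0 N.+1]/(index_iota 0 N.+1) big_mkord.
  by apply: eq_bigr => a _; rewrite inord_val.
by rewrite -mpolyCB -!rmorphXn -mpolyCB -mulrA mul_mpolyC.
Qed.

End Factorization.

Section Runs.
Variables (F : fieldType) (q : F) (m N : nat).
Local Notation R := {mpoly F[N.+1]}.

Definition links (s : seq 'I_m) : pred nat := [pred i | i \in [seq val j | j <- s]].

(** Each run costs one factor [q - 1], the [t] of [transfer_total], whence the exponent. *)
Lemma Wpoly_runs (s : seq 'I_m.+1.-1) (al := runs (links s) m) k : uniq s ->
  (q - 1) ^+ (size al.2).+1 *: Wpoly q N k s =
  \prod_(r <- al.1 :: al.2) Wser q N k r.+1.
Proof.
move=> us; rewrite {}/al; set L := links s.
pose x (a : nat) : R := 'X_(inord a).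
pose w (a b : 'I_N.+1) : R :=
  if (b < a)%N then (q - 1)%:MP else if a == b then k%:MP else 0.
have -> : Wpoly q N k s = \sum_a transfer (fun a : 'I_N.+1 => x a) w L m a.
  under [RHS]eq_bigr => a _ do rewrite transferE.
  rewrite /Wpoly (partition_big (fun f : {ffun 'I_m.+1 -> 'I_N.+1} => f ord_max) xpredT) //=.
  apply: eq_bigr => a _; apply: eq_bigr => f _.
  rewrite -mul_mpolyC; congr (_ * _); last first.
    by apply: eq_bigr => i _; rewrite /x inord_val.
  rewrite rmorph_prod big_uniq //= ; apply: eq_big => i.
    by rewrite /L /links /= mem_map //; apply: val_inj.
  move=> _; have -> : @lpos m.+1 i = widen_ord (leqnSn m) i by apply: val_inj.
  have -> : @rpos m.+1 i = lift ord0 i by apply: val_inj.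
  rewrite /wt /w val_eqE; by do 2!case: ifP => // _.
rewrite (eq_bigr _ (fun a _ => transfer_runs (fun a : 'I_N.+1 => x a) w L m a)).
rewrite -mulr_sumr big_cons.
have tot r : Wser q N k r.+1 = (q - 1)%:MP * \sum_a transfer (fun a : 'I_N.+1 => x a) w xpredT r a.
  by rewrite (@transfer_total R N.+1 x k%:MP (q - 1)%:MP r).
rewrite tot (eq_bigr _ (fun r _ => tot r)) big_split /= big_const_seq count_predT.
rewrite -mul_mpolyC rmorphXn exprS; set P := \prod_(r <- _) _.
set V := \sum_a _; rewrite -Monoid.iteropE -/(GRing.exp _ _).
by ring.
Qed.


Lemma eq_runs L L' m' : (forall i, (i < m')%N -> L i = L' i) -> runs L m' = runs L' m'.
Proof.
elim: m' => //= m' IH e; rewrite IH => [|i lt]; last by rewrite e // ltnW.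
by rewrite e.
Qed.

(** The last link is present exactly when the current run [r] is positive; the earlier links come by
    induction. *)
Lemma runs_onto r t m' : sumn [seq j.+1 | j <- r :: t] = m'.+1 ->
  exists L, runs L m' = (r, t).
Proof.
elim: m' r t => [|m' IH] [|r] [|r' t] //= e; try by exfalso; lia.
- by exists xpred0.
- have [|L hL] := IH r' t; first by rewrite /=; lia.
  exists (fun i => (i != m') && L i); rewrite eqxx /= (@eq_runs _ L) ?hL // => i lt.
  by rewrite neq_ltn lt.
- have [|L hL] := IH r [::]; first by rewrite /=; lia.
  exists (fun i => (i == m') || L i); rewrite eqxx /= (@eq_runs _ L) ?hL // => i lt.
  by rewrite (ltn_eqF lt).
- have [|L hL] := IH r (r' :: t); first by rewrite /=; lia.
  exists (fun i => (i == m') || L i); rewrite eqxx /= (@eq_runs _ L) ?hL // => i lt.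
  by rewrite (ltn_eqF lt).
Qed.

End Runs.

Section Compositions.
Variables (F : fieldType) (q : F) (n N : nat).
Implicit Types (s : seq 'I_n.-1) (k : F) (al : seq nat).

Lemma Wpoly0 (n0 : n = 0%N) k s : Wpoly q N k s = 1.
Proof.
case: n s n0 => // s _; rewrite /Wpoly.
rewrite (bigD1 [ffun=> ord0]) //= [X in _ + X]big1 ?addr0.
  by rewrite big_ord0 big1_seq ?scale1r // => -[].
by move=> f /eqP[]; apply/ffunP => -[].
Qed.

Lemma Wpoly_factor s : uniq s -> exists al : seq nat, [/\ all (leq 1) al, sumn al = n &
  forall k, (q - 1) ^+ size al *: Wpoly q N k s = \prod_(r <- al) Wser q N k r].
Proof.
have [n0|] := posnP n; first by exists [::]; split=> // k; rewrite big_nil scale1r Wpoly0.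
case: n s => // m s _ us; set rs := runs (links (s : seq 'I_m)) m.
exists [seq r.+1 | r <- rs.1 :: rs.2]; split.
- by apply/allP => _ /mapP[r _ ->].
- exact: sumn_runs.
by move=> k; rewrite big_map size_map -Wpoly_runs.
Qed.

(** Used for linear independence of the [eps]: every product of [Wser] of degree [n] is reached. *)
Lemma Wpoly_onto al : all (leq 1) al -> sumn al = n ->
  exists2 s : seq 'I_n.-1, increasing s &
  forall k, (q - 1) ^+ size al *: Wpoly q N k s = \prod_(r <- al) Wser q N k r.
Proof.
move=> h; have -> : al = [seq r.+1 | r <- [seq r.-1 | r <- al]].
  rewrite -map_comp -[LHS]map_id; apply/eq_in_map => r /(allP h) /=.
  by case: r.
case: [seq r.-1 | r <- al] => [|r t] /= es.
  by exists [::] => // k; rewrite scale1r big_nil Wpoly0.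
move: es; case: n => // m es; have [L hL] := @runs_onto r t m es.
pose s : seq 'I_m := [seq i <- enum 'I_m | L (val i)].
exists s.
  rewrite /increasing sorted_filter => [//|x y z|]; first exact: ltn_trans.
  have := iota_ltn_sorted 0 m; rewrite -val_enum_ord sorted_map.
  by [].
move=> k; have us : uniq s by rewrite filter_uniq // enum_uniq.
have := @Wpoly_runs F q m N s k us; rewrite (@eq_runs _ L) ?hL /= ?size_map => [|i lt].
  by move=> ->; rewrite !big_cons big_map.
rewrite /links /=; apply/mapP/idP => [[j]|hi].
  by rewrite mem_filter => /andP[hj _] ->.
by exists (Ordinal lt); rewrite // mem_filter hi mem_enum.
Qed.

End Compositions.

(** * Symmetric functions *)

Section PowerSums.
Variables (F : fieldType) (n : nat).
Hypothesis char0 : forall j, j.+1%:R != 0 :> F.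
Local Notation R := {mpoly F[n.+1]}.
Local Notation Lam := (dhomog n.+1 F n).
Local Notation P := (psum_fun F n).
Local Notation parts := (partitions n).
Implicit Types (la mu s : seq nat) (e : nat -> F).

Lemma part_sorted la : la \in parts -> sorted geq la.
Proof. by rewrite mem_partitions => /and3P[]. Qed.

Lemma part_pos la : la \in parts -> 0%N \notin la.
Proof. by rewrite mem_partitions => /and3P[]. Qed.

Lemma part_sum la : la \in parts -> sumn la = n.
Proof. by rewrite mem_partitions => /and3P[_ _ /eqP]. Qed.

Lemma size_le_sumn s : 0%N \notin s -> (size s <= sumn s)%N.
Proof.
elim: s => //= x s IH; rewrite inE negb_or => /andP[x0 /IH]; move: x0; rewrite eq_sym -lt0n; lia.
Qed.

Lemma part_size la : la \in parts -> (size la <= n)%N.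
Proof. by move=> h; rewrite -(part_sum h) size_le_sumn // part_pos. Qed.

Lemma sort_part s : 0%N \notin s -> sumn s = n -> sort geq s \in parts.
Proof.
move=> s0 sn; rewrite mem_partitions /is_partition sort_sorted; last by move=> x y; exact: leq_total.
by rewrite mem_sort s0 /= (perm_sumn (permEl (perm_sort _ _))) sn eqxx.
Qed.

Lemma part_eq la mu : la \in parts -> mu \in parts -> perm_eq la mu -> la = mu.
Proof.
move=> /part_sorted sl /part_sorted sm; apply: sorted_eq sl sm.
  by move=> x y z /= xy zx; exact: leq_trans zx xy.
by move=> x y /= xy; apply/eqP; rewrite eqn_leq andbC.
Qed.

Lemma psum_prod_expand s : \prod_(k <- s) P k =
  \sum_(f : {ffun 'I_(size s) -> 'I_n.+1}) 'X_[F, \sum_i U_(f i) *+ nth 0%N s i].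
Proof.
rewrite (big_nth 0%N) big_mkord /psum_fun bigA_distr_bigA; apply: eq_bigr => f _.
rewrite (big_morph _ (@mpolyXD _ F) (@mpolyX0 _ F)); apply: eq_bigr => i _.
by rewrite mpolyXn.
Qed.

Lemma shape_monE la (i : 'I_n.+1) : (size la <= n)%N -> 0%N \notin la ->
  (shape_mon la n i != 0%N) = (i < size la)%N.
Proof.
move=> sl l0; rewrite mnmE; case: ltnP => [lt|ge]; last by rewrite nth_default.
by apply: contraNN l0 => /eqP <-; apply: mem_nth.
Qed.

(** The coefficient of [m_la] in [p_mu]: the number of ways of merging the parts of [mu] into those
    of [la]. *)
Definition psum_words la mu := #|[set f : {ffun 'I_(size mu) -> 'I_n.+1} |
   (\sum_i U_(f i) *+ nth 0%N mu i == shape_mon la n)%MM]|.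

Lemma mcoeff_psum_prod la mu : (\prod_(k <- mu) P k)@_(shape_mon la n) = (psum_words la mu)%:R.
Proof.
rewrite psum_prod_expand raddf_sum /= /psum_words -sum1_card natr_sum [RHS]big_mkcond.
by apply: eq_bigr => f _; rewrite mcoeffX inE; case: eqP.
Qed.

Lemma psum_words_word la mu (f : {ffun 'I_(size mu) -> 'I_n.+1}) (j : 'I_n.+1) :
  (\sum_i U_(f i) *+ nth 0%N mu i = shape_mon la n)%MM ->
  shape_mon la n j = (\sum_(i | f i == j) nth 0 mu i)%N.
Proof.
move=> <-; rewrite mnm_sumE [RHS]big_mkcond; apply: eq_bigr => i _.
by rewrite mulmnE mnm1E; case: eqP => _; rewrite ?mul1n ?mul0n.
Qed.

(** Triangularity of power sums in the monomial basis: merging parts shortens a partition, and equal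
    lengths mean that nothing was merged. *)
Lemma psum_words_gt0 la mu : la \in parts -> mu \in parts ->
  (0 < psum_words la mu)%N -> (size la <= size mu)%N /\ (size la = size mu -> la = mu).
Proof.
move=> hla hmu /card_gt0P[f]; rewrite inE => /eqP hf.
pose A := [set j : 'I_n.+1 | (j < size la)%N].
have cA : #|A| = size la.
  rewrite -[RHS]card_ord; have lt (i : 'I_(size la)) : (i < n.+1)%N.
    by rewrite ltnS (leq_trans (ltnW (ltn_ord i))) // part_size.
  pose g i : 'I_n.+1 := Ordinal (lt i).
  have gI : injective g by move=> i i' [/val_inj].
  rewrite -(card_imset _ gI); apply: eq_card => j; rewrite inE.
  apply/idP/imsetP => [lt'|[i _ ->]]; last by rewrite /= ltn_ord.
  by exists (Ordinal lt') => //; apply: val_inj.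
have sub : A \subset f @: setT.
  apply/subsetP => j; rewrite inE -shape_monE ?part_size ?part_pos // (psum_words_word _ hf).
  rewrite sum_nat_eq0 negb_forall => /existsP[i]; rewrite negb_imply => /andP[/eqP <- _].
  by apply: imset_f; rewrite inE.
have le2 : (#|f @: setT| <= size mu)%N.
  by rewrite (leq_trans (leq_imset_card _ _)) // cardsT card_ord.
split=> [|es]; first by rewrite -cA (leq_trans (subset_leq_card sub)).
have fI : injective f.
  have /imset_injP fI : #|f @: setT| == #|[set: 'I_(size mu)]|.
    rewrite cardsT card_ord eqn_leq le2 /=; apply: (leq_trans _ (subset_leq_card sub)).
    by rewrite cA es.
  by move=> i i'; apply: fI; rewrite inE.
have fA : A = f @: setT.
  by apply/eqP; rewrite eqEcard sub; apply: (leq_trans le2); rewrite cA es.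
apply: part_eq => //.
have fv (i : 'I_(size mu)) : nth 0%N la (f i) = nth 0%N mu i.
  have := psum_words_word (f i) hf; rewrite mnmE => ->.
  by rewrite (big_pred1 i) // => i'; rewrite (inj_eq fI).
have emu : [seq nth 0%N la j | j <- [seq val (f i) | i <- enum 'I_(size mu)]] = mu.
  rewrite -map_comp (eq_map (g := nth 0%N mu \o val)) // map_comp val_enum_ord.
  exact: mkseq_nth.
rewrite -emu.
rewrite -{1}(mkseq_nth 0%N la) /mkseq; apply/perm_map/uniq_perm.
- exact: iota_uniq.
- rewrite map_inj_uniq ?enum_uniq // => i i' /val_inj; exact: fI.
move=> j; rewrite mem_iota /= add0n; apply/idP/mapP => [lt|[i _ ->]].
  have lt' : (j < n.+1)%N by rewrite ltnS (leq_trans (ltnW lt)) // part_size.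
  have : Ordinal lt' \in A by rewrite inE.
  by rewrite fA => /imsetP[i _ ei]; exists i; rewrite ?mem_enum // -ei.
have : f i \in A by rewrite fA imset_f // inE.
by rewrite inE.
Qed.

Lemma psum_words_refl la : la \in parts -> (0 < psum_words la la)%N.
Proof.
move=> hla; apply/card_gt0P.
exists [ffun i => inord (val i)]; rewrite inE; apply/eqP/mnmP => j.
rewrite mnm_sumE mnmE; have [lt|ge] := ltnP j (size la).
  rewrite (bigD1 (Ordinal lt)) //= ffunE inord_val mulmnE mnm1E eqxx mul1n.
  rewrite big1 ?addn0 // => i ne; rewrite mulmnE mnm1E ffunE -val_eqE /= inordK.
    by case: eqP => // e; case/eqP: ne; apply: val_inj.
  by rewrite ltnS (leq_trans (ltnW (ltn_ord i))) // part_size.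
rewrite nth_default // big1 // => i _; rewrite mulmnE mnm1E ffunE -val_eqE /= inordK.
  by case: eqP => // ei; have := ltn_ord i; rewrite ei ltnNge ge.
by rewrite ltnS (leq_trans (ltnW (ltn_ord i))) // part_size.
Qed.

Local Notation part i := (tnth (in_tuple parts) i).

Lemma part_mem i : part i \in parts. Proof. exact: mem_tnth. Qed.

Lemma part_inj i j : part i = part j -> i = j.
Proof.
rewrite !(tnth_nth [::]) => /eqP; rewrite nth_uniq ?ltn_ord ?uniq_partitions //.
by move/eqP/val_inj.
Qed.

Lemma part_index la : la \in parts -> exists i, la = part i.
Proof. by move/(tnthP (in_tuple parts)). Qed.

Lemma val_indhomog (p : R) : p \is n.-homog -> val (indhomog n p : Lam) = p.
Proof. by move=> hp; rewrite insubdK. Qed.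

Lemma psum_homog la : la \in parts -> \prod_(k <- la) P k \is n.-homog.
Proof.
rewrite mem_partitions => /(psum_prod_homog (fun=> 1 : F)).
by rewrite (eq_bigr P) // => k _; rewrite scale1r.
Qed.

Lemma psum_tupleE (i : 'I_(size parts)) : val ((psum_tuple F n)`_i) = \prod_(k <- part i) P k.
Proof.
rewrite -tnth_nth tnth_map val_indhomog // psum_homog // part_mem //.
Qed.

Lemma val_lincomb I (r : seq I) (b : I -> F) (X : I -> Lam) :
  val (\sum_(i <- r) b i *: X i) = \sum_(i <- r) b i *: val (X i) :> R.
Proof.
rewrite -[LHS]/(mpoly_of_dhomog _) linear_sum.
by apply: eq_bigr => i _; rewrite linearZ.
Qed.

(** Among the partitions with a nonzero coefficient take one of maximal length: by triangularity it
    alone contributes to its own monomial. *)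
Lemma free_psum : free (psum_tuple F n).
Proof.
apply/freeP => b b0 i0; apply/eqP; apply/negPn/negP => bi0.
case: (@arg_maxnP _ i0 (fun i => b i != 0) (fun i => size (part i)) bi0) => i bi max.
have := congr1 (fun f : Lam => (val f)@_(shape_mon (part i) n)) b0.
rewrite /= val_lincomb raddf_sum mcoeff0 (bigD1 i) //= big1 => [|j ne].
  rewrite addr0 mcoeffZ psum_tupleE mcoeff_psum_prod => /eqP.
  rewrite mulf_eq0 (negbTE bi) /=; have := psum_words_refl (part_mem i).
  by case: psum_words => // k _; rewrite (negbTE (char0 k)).
rewrite mcoeffZ psum_tupleE mcoeff_psum_prod.
have [->|bj] := eqVneq (b j) 0; first by rewrite mul0r.
have [-> |pw] := posnP (psum_words (part i) (part j)); first by rewrite mulr0.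
have [le eqs] := psum_words_gt0 (part_mem i) (part_mem j) pw.
case/eqP: ne; apply/esym/part_inj/eqs/eqP; rewrite eqn_leq le /=.
exact: max.
Qed.

End PowerSums.

(** * Expansion of symmetric polynomials in the monomial basis *)

Section SymmetricExpansion.
Variables (F : fieldType) (n : nat).
Local Notation R := {mpoly F[n.+1]}.
Local Notation Lam := (dhomog n.+1 F n).
Local Notation P := (psum_fun F n).
Local Notation parts := (partitions n).
Local Notation pos s := [seq k <- s | (0 < k)%N].
Implicit Types (la mu s : seq nat).

Lemma psum_sym k : P k \is symmetric.
Proof.
apply/issymP => s; rewrite /psum_fun rmorph_sum [RHS](reindex_inj (@perm_inj _ s)) /=.
apply: eq_bigr => i _; rewrite rmorphXn /= msymX; congr ('X_[_] ^+ _).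
apply/mnmP => j; rewrite mnmE !mnm1E; congr nat_of_bool.
by apply/eqP/eqP => [->|<-]; rewrite ?permKV ?permK.
Qed.

Lemma psum_prod_sym s : \prod_(k <- s) P k \is symmetric.
Proof.
elim/big_rec: _ => [|k p _ hp]; first by apply/issymP => w; rewrite rmorph1.
apply/issymP => w; rewrite rmorphM /=.
by have /issymP -> := psum_sym k; have /issymP -> := hp.
Qed.

(** The lengths determine the number of zeros. *)
Lemma perm_pos s t : size s = size t -> perm_eq (pos s) (pos t) -> perm_eq s t.
Proof.
move=> est /seq.permP e; have cp u : count (fun k => 0 < k)%N u = size (pos u) by rewrite size_filter.
have key u x : count_mem x u = if (0 < x)%N then count_mem x (pos u)
    else (size u - count (fun k => 0 < k)%N u)%N.
  case: ifP => x0.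
    rewrite count_filter; apply: eq_count => y /=.
    by case: eqP => // ->; rewrite x0.
  rewrite -(count_predC (fun k => 0 < k)%N u) addKn; apply: eq_count => y /=.
  by rewrite lt0n negbK; move: x0; case: x.
apply/allP => x _ /=; rewrite (key s x) (key t x) est; case: ifP => _; first by rewrite e.
by rewrite !cp -!count_predT e.
Qed.

Lemma pos_shape la : 0%N \notin la -> (size la <= n.+1)%N ->
  pos (shape_mon la n : seq nat) = la.
Proof.
move=> l0 sl.
have -> : (shape_mon la n : seq nat) = [seq nth 0%N la i | i <- iota 0 n.+1].
  by rewrite -val_enum_ord -map_comp.
rewrite -(subnKC sl) iotaD map_cat filter_cat map_nth_iota0 // take_size add0n.
rewrite (_ : pos (map _ _) = [::]) ?cats0.
  by apply/all_filterP/allP => x; rewrite lt0n; apply: contraTneq => ->.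
apply/eqP; rewrite -(negbK (_ == _)) -has_filter; apply/hasPn => x /mapP[j].
by rewrite mem_iota => /andP[h _] ->; rewrite nth_default.
Qed.

Lemma mcoeff_msym la (m : 'X_{1..n.+1}) : (mdeg m < n.+1)%N ->
  (msym_fun F n la)@_m = (perm_eq (pos (m : seq nat)) la)%:R.
Proof.
move=> hm; rewrite /msym_fun raddf_sum /=.
under eq_bigr => m' _ do rewrite mcoeffX.
case: (boolP (perm_eq _ _)) => hp.
  rewrite (bigD1 (BMultinom hm)) //= eqxx big1 ?addr0 // => m' /andP[_ ne].
  by case: eqP => // e; case/eqP: ne; apply: val_inj.
rewrite big1 // => m' hm'; case: eqP => // e; by move: hm'; rewrite e (negbTE hp).
Qed.

Lemma mdeg_part (m : 'X_{1..n.+1}) : mdeg m = n -> sort geq (pos (m : seq nat)) \in parts.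
Proof.
move=> hm; apply: sort_part; first by rewrite mem_filter.
by rewrite sumn_filter_pos; apply: etrans hm; rewrite mdegE sumnE big_tuple.
Qed.

Lemma sym_coeff (f : R) (m : 'X_{1..n.+1}) : f \is symmetric -> mdeg m = n ->
  f@_m = f@_(shape_mon (sort geq (pos (m : seq nat))) n).
Proof.
move=> fs hm; set la := sort _ _.
have hla : la \in parts by exact: mdeg_part.
have : perm_eq (shape_mon la n : n.+1.-tuple nat) (m : n.+1.-tuple nat).
  apply: perm_pos; first by rewrite !size_tuple.
  rewrite pos_shape; first by rewrite /la perm_sort.
    exact: part_pos hla.
  exact: leq_trans (part_size hla) (leqnSn n).
case/tuple_permP => s e; rewrite -(msym_coeff m s fs); congr (f@_ _).
apply/mnmP => i; rewrite mnmE; apply/esym.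
by rewrite /fun_of_multinom -[LHS]/(tnth (shape_mon la n : n.+1.-tuple nat) i) (val_inj e) tnth_mktuple.
Qed.

(** Each monomial is a rearrangement of [x^la], with [la] the sorted list of its nonzero exponents,
    so symmetry determines [f] by its coefficients [mcoef]. *)
Lemma sym_expand (f : Lam) : val f \is symmetric ->
  f = \sum_(la <- parts) mcoef la f *: indhomog n (msym_fun F n la).
Proof.
move=> fs; apply: val_inj; rewrite val_lincomb; apply/mpolyP => m.
rewrite raddf_sum /=.
have [hm|hm] := eqVneq (mdeg m) n; last first.
  rewrite (dhomog_nemf_coeff (dhomog_is_dhomog f)) // big1 // => la _.
  by rewrite mcoeffZ (dhomog_nemf_coeff (dhomog_is_dhomog _)) ?mulr0.
set la0 := sort geq (pos (m : seq nat)).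
have h0 : la0 \in parts by exact: mdeg_part.
rewrite (bigD1_seq la0) ?uniq_partitions //= big1_seq ?addr0.
  rewrite mcoeffZ val_indhomog ?msym_fun_homog -?mem_partitions //.
  rewrite mcoeff_msym ?hm // -(perm_sym la0) perm_sort perm_refl mulr1.
  exact: sym_coeff.
move=> la /andP[ne hla]; rewrite mcoeffZ val_indhomog ?msym_fun_homog -?mem_partitions //.
rewrite mcoeff_msym ?hm //; case: (boolP (perm_eq _ _)) => hp; last by rewrite mulr0.
case/eqP: ne; apply: (part_eq hla h0); rewrite perm_sym; apply: perm_trans hp.
by rewrite perm_sort.
Qed.

End SymmetricExpansion.

(** * Rescaling power sums, and Newton's identities *)

Section PowerSumScaling.
Variables (F : fieldType) (n : nat).
Hypothesis char0 : forall j, j.+1%:R != 0 :> F.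
Local Notation R := {mpoly F[n.+1]}.
Local Notation Lam := (dhomog n.+1 F n).
Local Notation P := (psum_fun F n).
Local Notation parts := (partitions n).
Local Notation part i := (tnth (in_tuple parts) i).
Implicit Types (la mu s : seq nat) (e : nat -> F).

(* The plethysm [p_j |-> e j * p_j]. *)
Definition pscale e (f : Lam) : R :=
  \sum_i coord (psum_tuple F n) i f *: \prod_(k <- part i) (e k *: P k).

Fact pscale_is_linear e : linear (pscale e).
Proof.
move=> a f g; rewrite /pscale scaler_sumr -big_split; apply: eq_bigr => i _ /=.
by rewrite linearP scalerDl scalerA.
Qed.

Lemma pscale_lincomb e I (r : seq I) (b : I -> F) (X : I -> Lam) :
  pscale e (\sum_(i <- r) b i *: X i) = \sum_(i <- r) b i *: pscale e (X i).
Proof.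
have lin := pscale_is_linear e; elim: r => [|i r IH].
  by rewrite !big_nil; have := lin (-1) 0 0; rewrite scaler0 addr0 scaleN1r addNr.
by rewrite !big_cons lin IH.
Qed.

(** The graph of [p_j |-> e j * p_j] on expansions. As a relation it passes through sums and
    products without appeal to freeness, which enters only in [pscaledP]. *)
Definition pscaled e (f g : R) := exists b : 'I_(size parts) -> F,
  f = \sum_i b i *: \prod_(k <- part i) P k /\
  g = \sum_i b i *: \prod_(k <- part i) (e k *: P k).

Lemma pscaledP e (f : Lam) g : pscaled e (val f) g -> pscale e f = g.
Proof.
case=> b [ef ->]; apply: eq_bigr => i _; congr (_ *: _).
have -> : f = \sum_i b i *: (psum_tuple F n)`_i.
  apply: val_inj; rewrite val_lincomb ef; apply: eq_bigr => j _.
  by rewrite psum_tupleE.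
exact: coord_sum_free (free_psum n char0).
Qed.

Lemma pscaled_sym e (f g : R) : pscaled e f g -> f \is symmetric.
Proof.
case=> b [-> _]; apply/issymP => s; rewrite rmorph_sum; apply: eq_bigr => i _.
by rewrite /= msymZ; have /issymP -> := psum_prod_sym F n (part i).
Qed.

Lemma pscaled_homog e (f g : R) : pscaled e f g -> f \is n.-homog.
Proof.
case=> b [-> _]; apply: rpred_sum => i _; apply/rpredZ/psum_homog.
exact: part_mem.
Qed.

Lemma pscaled0 e : pscaled e 0 0.
Proof. by exists (fun=> 0); split; rewrite big1 // => i _; rewrite scale0r. Qed.

Lemma pscaledD e f g f' g' : pscaled e f g -> pscaled e f' g' -> pscaled e (f + f') (g + g').
Proof.
move=> [b [-> ->]] [b' [-> ->]]; exists (fun i => b i + b' i).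
by split; rewrite -big_split; apply: eq_bigr => i _; rewrite /= scalerDl.
Qed.

Lemma pscaledZ e a f g : pscaled e f g -> pscaled e (a *: f) (a *: g).
Proof.
move=> [b [-> ->]]; exists (fun i => a * b i).
by split; rewrite scaler_sumr; apply: eq_bigr => i _; rewrite scalerA.
Qed.

Lemma pscaled_sum e I (r : seq I) f g : (forall i, pscaled e (f i) (g i)) ->
  pscaled e (\sum_(i <- r) f i) (\sum_(i <- r) g i).
Proof.
move=> h; elim: r => [|i r IH]; first by rewrite !big_nil; exact: pscaled0.
by rewrite !big_cons; apply: pscaledD.
Qed.

Lemma pscaled_psum e s : 0%N \notin s -> sumn s = n ->
  pscaled e (\prod_(k <- s) P k) (\prod_(k <- s) (e k *: P k)).
Proof.
move=> s0 sn; have [i hi] := part_index (sort_part s0 sn).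
have pick (G : 'I_(size parts) -> R) : \sum_j (j == i)%:R *: G j = G i.
  rewrite (bigD1 i) //= eqxx scale1r big1 ?addr0 // => j ne.
  by rewrite (negbTE ne) scale0r.
exists (fun j => (j == i)%:R); rewrite !pick -hi.
by split; apply: perm_big; rewrite perm_sym perm_sort.
Qed.

(** Newton's identities for [A(u) = exp (sum_(j >= 0) c_j p_(j+1) u^(j+1) / (j+1))]. *)
Definition newton (c : nat -> F) (A : nat -> R) := A 0%N = 1 /\
  forall j, j%:R * A j = \sum_(i < j) c i *: (P i.+1 * A (j - i.+1)%N).

(** Newton's identities trade a factor [A k] for power sums, collected in [s], times earlier terms
    of [A]; the rescaled identities do the same for [A']. *)
Lemma pscaled_newton e c A A' al s :
  newton c A -> newton (fun j => c j * e j.+1) A' ->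
  0%N \notin s -> (sumn s + sumn al)%N = n ->
  pscaled e (\prod_(k <- s) P k * \prod_(k <- al) A k)
            (\prod_(k <- s) (e k *: P k) * \prod_(k <- al) A' k).
Proof.
move=> [A0 hA] [A'0 hA'].
(* The size in the measure pays for parts equal to [0], which are dropped without lowering the
   sum. *)
move: {2}(sumn al + size al)%N (leqnn (sumn al + size al)) => N.
elim: N al s => [|N IH] [|k al] s //=.
- by move=> _ s0; rewrite addn0 !big_nil !mulr1; apply: pscaled_psum.
- by rewrite addnS.
- by move=> _ s0; rewrite addn0 !big_nil !mulr1; apply: pscaled_psum.
case: k => [|k] le s0 es.
  by rewrite !big_cons A0 A'0 !mul1r; apply: IH => //; lia.
have cancel (Y X p : R) : k.+1%:R * X = Y ->
    forall Z, p * (X * Z) = (k.+1%:R^-1 : F) *: (p * (Y * Z)).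
  by move=> <- Z; rewrite mulr_natl -scaler_nat -scalerAl -scalerAr scalerA mulVf // scale1r.
rewrite !big_cons (cancel _ _ _ (hA k.+1)) (cancel _ _ _ (hA' k.+1)).
apply: pscaledZ; rewrite !mulr_suml !mulr_sumr; apply: pscaled_sum => i.
have := IH ((k.+1 - i.+1)%N :: al) (i.+1 :: s); rewrite !big_cons /=.
have lti := ltn_ord i.
move=> h; have {h} := h _ _ _; rewrite inE /= s0.
have h1 : (k - i + sumn al + (size al).+1 <= N)%N by move: le lti; clear; lia.
have h2 : (i.+1 + sumn s + (k - i + sumn al) = n)%N by move: es lti; clear; lia.
rewrite !subSS => /(_ h1 isT h2) /(pscaledZ (c i)).
congr pscaled.
  by rewrite -!scalerAl -!scalerAr; congr (_ *: _); ring.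
by rewrite -!scalerAl -!scalerAr scalerA; congr (_ *: _); ring.
Qed.

Corollary pscaled_newton_prod e c A A' al :
  newton c A -> newton (fun j => c j * e j.+1) A' -> sumn al = n ->
  pscaled e (\prod_(k <- al) A k) (\prod_(k <- al) A' k).
Proof.
move=> hA hA' es; have := @pscaled_newton e c A A' al [::] hA hA' isT es.
by rewrite !big_nil !mul1r.
Qed.

(* Stated dually: the products of the [A k] span the same space as those of the
   [p_k]. *)
Lemma newton_span c A (beta : {linear R -> F^o}) :
  newton c A -> (forall j, c j != 0) ->
  (forall al, sumn al = n -> all (leq 1) al -> beta (\prod_(k <- al) A k) = 0) ->
  forall s, 0%N \notin s -> sumn s = n -> beta (\prod_(k <- s) P k) = 0.
Proof.
move=> [A0 hA] c0 hb.
suff K m s al : (sumn s <= m)%N -> 0%N \notin s -> all (leq 1) al -> (sumn s + sumn al)%N = n ->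
    beta (\prod_(k <- s) P k * \prod_(k <- al) A k) = 0.
  move=> s s0 sn; have := K _ s [::] (leqnn _) s0 isT.
  by rewrite addn0 big_nil mulr1; apply.
elim: m s al => [|m IH] [|k s] al //=.
- by move=> _ _ ha; rewrite big_nil mul1r => /hb; apply.
- by case: k.
- by move=> _ _ ha; rewrite big_nil mul1r => /hb; apply.
case: k => // k le; rewrite inE /= => s0 ha es.
(* Newton's identity solved for its last term [c k * p_(k+1) * A 0], where [A 0 = 1]. *)
have pE : P k.+1 = (c k)^-1 *: (k.+1%:R *: A k.+1) +
    \sum_(i < k) - ((c k)^-1 * c i) *: (P i.+1 * A (k.+1 - i.+1)%N).
  have := hA k.+1; rewrite mulr_natl -scaler_nat => ->.
  rewrite big_ord_recr /= subnn A0 mulr1 scalerDr scalerA mulVf // scale1r addrAC.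
  rewrite scaler_sumr -big_split big1 ?add0r // => i _ /=.
  by rewrite scalerA -scalerDl subrr scale0r.
have s0' : 0%N \notin s by [].
rewrite big_cons pE !mulrDl linearD /= -!scalerAl !linearZ /=.
have -> : A k.+1 * \prod_(j <- s) P j * \prod_(j <- al) A j =
  \prod_(j <- s) P j * \prod_(j <- k.+1 :: al) A j by rewrite big_cons; ring.
rewrite (IH s (k.+1 :: al)) ?scaler0 ?add0r //=; first last.
- by move: es; clear; lia.
- by move: le; clear; lia.
rewrite !mulr_suml linear_sum big1 // => i _; have lti := ltn_ord i.
rewrite -!scalerAl linearZ /=.
have -> : P i.+1 * A (k.+1 - i.+1)%N * \prod_(j <- s) P j * \prod_(j <- al) A j =
  \prod_(j <- i.+1 :: s) P j * \prod_(j <- (k.+1 - i.+1)%N :: al) A j.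
  by rewrite !big_cons; ring.
rewrite IH ?scaler0 //=.
- by move: le lti; clear; lia.
- by rewrite ha andbT; move: lti; clear; lia.
- by move: es lti; clear; lia.
Qed.

End PowerSumScaling.

(** * The four functionals *)

Section LinearCharacters.
Variables (F : fieldType) (q : F) (n : nat) (k : F).
Hypothesis k_root : k ^+ 2 = (q - 1) * k + q.
Local Notation H := (hecke q n).
Local Notation T := (T q).
Local Notation chi := (linear_ext (fun w : 'S_n => k ^+ len w)).
Local Notation rho := (linear_repr (fun w : 'S_n => k ^+ len w)).

Lemma linear_extT (f : 'S_n -> F) w : linear_ext f (T w) = f w.
Proof.
rewrite /linear_ext (bigD1 w) //= coefT eqxx mul1r big1 ?addr0 // => v ne.
by rewrite coefT (negbTE ne) mul0r.
Qed.

Lemma linear_extZ (f : 'S_n -> F) a (D : H) : linear_ext f (a *: D) = a * linear_ext f D.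
Proof. exact: linearZ. Qed.

(** On a descent this is exactly [k_root], the quadratic relation, whose roots are [-1] and [q]. *)
Lemma lin_char_simple i (D : H) : chi (T (simple i) * D) = k * chi D.
Proof.
rewrite (hecke_sum D) mulr_sumr !linear_sum mulr_sumr; apply: eq_bigr => w _.
rewrite -scalerAr !linearZ /= [RHS]mulrCA; congr (_ * _).
rewrite T_simpleM; case: ifP => di; last first.
  by rewrite !linear_extT len_simple di exprS.
rewrite linearD !linearZ /= !linear_extT len_simple di.
have := len_descent di; case: (len w) => // l _ /=.
transitivity ((q - 1) * (k * k ^+ l) + q * k ^+ l); first by rewrite -exprS.
by rewrite -exprS -exprS -addn2 exprD k_root exprS; ring.
Qed.

Lemma lin_char1 : chi (1 : H) = 1.
Proof. by rewrite -T1 linear_extT len1. Qed.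

Lemma lin_charM (D E : H) : chi (D * E) = chi D * chi E.
Proof.
have K w : chi (T w * E) = chi (T w) * chi E.
  elim/len_ind: w => [|i w di IH]; first by rewrite T1 mul1r lin_char1 mul1r.
  have -> : T w = T (simple i) * T (simple i * w)%g.
    by rewrite T_simpleM descentM di /= simpleK.
  set w' := (simple i * w)%g in IH *.
  have -> : T (simple i) * T w' * E = T (simple i) * (T w' * E) by rewrite mulrA.
  by rewrite (lin_char_simple i (T w' * E)) (lin_char_simple i (T w')) IH; exact: mulrA.
rewrite (hecke_sum D) mulr_suml !linear_sum mulr_suml; apply: eq_bigr => w _.
by rewrite /= -scalerAl !linear_extZ K; exact: mulrA.
Qed.

Lemma lin_char_Tseq s : chi (Tseq q s) = k ^+ size s.
Proof.
elim: s => [|i s IH]; first by rewrite /Tseq big_nil lin_char1.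
by rewrite Tseq_cons lin_char_simple IH -exprS.
Qed.

Lemma lin_char_repr (B : {vspace H}) : is_repr B (rho : {linear H -> 'M_1}).
Proof.
split=> [|u v _ _]; rewrite /= /linear_repr ?lin_char1 //.
by rewrite lin_charM scalar_mxM.
Qed.

Lemma lin_char_ind (b : 'I_n -> nat) :
  (forall x y : 'I_n, (x <= y)%N -> (b x <= b y)%N) ->
  forall h, ind_char (block_alg b q) (rho : {linear H -> 'M_1}) h = induce b chi h.
Proof.
move=> b_mono h; rewrite ind_charE //; last exact: lin_char_repr.
by apply: eq_bigr => d _; rewrite mxtrace_scalar.
Qed.

End LinearCharacters.

Section CoefficientOfOne.
Variables (F : fieldType) (q : F) (n : nat).
Local Notation H := (hecke q n).
Local Notation T := (T q).
Implicit Types (i j : 'I_n.-1) (s : seq 'I_n.-1) (D E : H).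

Definition tau D : F^o := coef D 1%g.

Fact tau_is_linear : linear tau.
Proof. by move=> a D E; rewrite /tau coefD coefZ. Qed.

HB.instance Definition _ := GRing.isLinear.Build F H F^o _ tau tau_is_linear.

(** The maximal parabolic subgroup generated by the reflections other than [simple j]. *)
Definition stable_below j : pred 'S_n :=
  [pred w : 'S_n | [forall a : 'I_n, (w a <= j)%N == (a <= j)%N]].

Lemma stable_below_simple i j w : i != j ->
  stable_below j (simple i * w)%g = stable_below j w.
Proof.
move=> ne; have le_simple (a : 'I_n) : (simple i a <= j)%N = (a <= j)%N.
  have : val i <> val j by move=> /val_inj e; case/eqP: ne.
  rewrite simpleE /=; case: eqP => [->|_]; first by lia.
  by case: eqP => [->|_]; lia.
apply/forallP/forallP => h a.
  by rewrite -(le_simple a) -(eqP (h (simple i a))) permM tpermK.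
by rewrite permM (eqP (h _)) le_simple.
Qed.

(** The coefficient of [T_s D] at [1] is [q] times that of [D] at [s], and [simple j] lies outside
    that subgroup. *)
Lemma coef1_simpleM j D : supp_in (stable_below j) D -> tau (T (simple j) * D) = 0.
Proof.
move=> sD; rewrite /tau simple_mulE coef_simple_mul /descent !perm1 /= ltnNge leqnSn /=.
rewrite mulg1 sD ?mulr0 //; apply/negP => /forallP/(_ (lpos j)).
by rewrite tpermL /= ltnn leqnn.
Qed.

Lemma supp_stable_one j : supp_in (stable_below j) (1 : H).
Proof. by rewrite -T1; apply: supp_inT; apply/forallP => a; rewrite perm1. Qed.

Lemma supp_stable_simple i j D : i != j -> supp_in (stable_below j) D ->
  supp_in (stable_below j) (T (simple i) * D).
Proof. by move=> ne; apply: supp_in_simple => w; apply: stable_below_simple. Qed.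

(** The letters after the first differ from it, so their product is supported in the parabolic
    subgroup that omits it. *)
Lemma tau_Tseq s : uniq s -> tau (Tseq q s) = 0 ^+ size s.
Proof.
case: s => [_|j s /= /andP[js _]]; first by rewrite /Tseq big_nil -T1 /tau coefT eqxx.
rewrite Tseq_cons exprS mul0r coef1_simpleM //.
elim: s js => [|i s IH]; first by rewrite /Tseq big_nil => _; apply: supp_stable_one.
rewrite inE negb_or eq_sym Tseq_cons => /andP[ne /IH]; exact: supp_stable_simple.
Qed.

Hypothesis q0 : q != 0.

(** [alpha] turns each factor into [(q - 1) - T_s], and the part containing the first [T_s] has no
    coefficient at [1]. *)
Lemma Rtrace_Tseq s : uniq s -> Rtrace (Tseq q s) = (q - 1) ^+ size s.
Proof.
have alpha1 : alpha (1 : H) = 1.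
  by rewrite -T1 alphaT /alpha_fun len1 invg1 T1 invr1 expr0 scale1r.
have aE j D : alpha (T (simple j) * D) = (q - 1) *: alpha D - T (simple j) * alpha D.
  by rewrite alphaM // alpha_simple // mulrBl -scalerAl mul1r.
elim: s => [_|j s IH /= /andP[js /IH e]].
  by rewrite /Tseq big_nil /Rtrace alpha1 -T1 coefT eqxx.
rewrite /Rtrace Tseq_cons aE -[LHS]/(tau _) linearB linearZ /= coef1_simpleM.
  by rewrite subr0 exprS -e.
elim: s js {IH e} => [|i s IH].
  by rewrite /Tseq big_nil alpha1 => _; apply: supp_stable_one.
rewrite inE negb_or eq_sym Tseq_cons aE => /andP[ne /IH sA].
rewrite -scaleN1r; apply: supp_inD; apply: supp_inZ => //.
exact: supp_stable_simple.
Qed.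

End CoefficientOfOne.

(** * Comparison of traces *)

Lemma increasing_uniq n (s : seq 'I_n.-1) : increasing s -> uniq s.
Proof. by apply: sorted_uniq => [x y z|x]; [exact: ltn_trans|exact: ltnn]. Qed.

Section ConstantBlocks.
Variables (n : nat) (b : 'I_n -> nat) (c : nat).
Hypothesis bc : forall x, b x = c.

(** With a single block, the case of one-row shapes, induction is from the whole algebra. *)
Lemma const_minrep : minrep b = [set 1%g].
Proof.
have b_mono (x y : 'I_n) : (x <= y)%N -> (b x <= b y)%N by rewrite !bc.
apply/setP => d; rewrite in_set1; apply/idP/eqP => [hd|->]; last exact: minrep1.
by apply: (minrep_word_inj b_mono hd (minrep1 b)) => a; rewrite !bc.
Qed.

Lemma const_induce (F : fieldType) (q : F) (f : hecke q n -> F) h : induce b f h = f h.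
Proof.
rewrite /induce const_minrep big_set1 T1 mulr1; congr f.
rewrite [RHS]hecke_sum /block_coef; apply: eq_big => [v|v _]; last by rewrite mul1g.
by apply/blockP => a; rewrite !bc.
Qed.

End ConstantBlocks.

Section Assembly.
Variables (F : fieldType) (q : F) (n : nat).
Hypothesis char0 : forall j, j.+1%:R != 0 :> F.
Hypothesis q0 : q != 0.
Hypothesis qn1 : forall j, q ^+ j.+1 - 1 != 0.
Local Notation H := (hecke q n).
Local Notation T := (T q).
Local Notation R := {mpoly F[n.+1]}.
Local Notation Lam := (dhomog n.+1 F n).
Local Notation parts := (partitions n).
Local Notation part i := (tnth (in_tuple parts) i).
Local Notation W := (Wpoly q n).
Local Notation shape la := (shape_mon la n).
Implicit Types (la mu : seq nat) (s : seq 'I_n.-1) (D E : H) (k : F).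

Let q1 : q - 1 != 0. Proof. by have := qn1 0; rewrite expr1. Qed.

Lemma Wser_newtonP k : newton (fun j => k ^+ j.+1 - (k - (q - 1)) ^+ j.+1) (Wser q n k).
Proof. by split=> [|j]; [exact: Wser0|exact: Wser_newton]. Qed.

Lemma eq_newton c c' (A : nat -> R) : c =1 c' -> newton c A -> newton c' A.
Proof.
move=> e [A0 hA]; split=> // j; rewrite hA; apply: eq_bigr => i _.
by rewrite e.
Qed.

(** Both polynomials factor along the same runs, and the Newton weights of their series differ by
    the factor [e]. *)
Lemma Wpoly_pscaled e k k' s : increasing s ->
  (forall j, e j.+1 * (k ^+ j.+1 - (k - (q - 1)) ^+ j.+1) =
     k' ^+ j.+1 - (k' - (q - 1)) ^+ j.+1) ->
  pscaled e (W k s) (W k' s).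
Proof.
move=> /increasing_uniq us he; have [al [_ sal hW]] := @Wpoly_factor F q n n s us.
have WE x : W x s = ((q - 1) ^+ size al)^-1 *: \prod_(r <- al) Wser q n x r.
  by rewrite -hW scalerA mulVf ?expf_neq0 // scale1r.
rewrite !WE; apply: pscaledZ.
have N' : newton (fun j => (k ^+ j.+1 - (k - (q - 1)) ^+ j.+1) * e j.+1) (Wser q n k').
  by apply: eq_newton (Wser_newtonP k') => j; rewrite -he mulrC.
exact: (pscaled_newton_prod char0 (Wser_newtonP k) N').
Qed.

Lemma Wpoly_self k s : increasing s -> pscaled (fun=> 1) (W k s) (W k s).
Proof. by move=> incs; apply: Wpoly_pscaled => // j; rewrite mul1r. Qed.

Lemma Wpoly_homog k s : increasing s -> W k s \is n.-homog.
Proof. by move/(Wpoly_self k)/pscaled_homog. Qed.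

Definition Wlam k s : Lam := indhomog n (W k s).

Lemma val_Wlam k s : increasing s -> val (Wlam k s) = W k s.
Proof. by move=> incs; apply/val_indhomog/Wpoly_homog. Qed.

Lemma mcoefE la (f : Lam) : mcoef la f = (val f)@_(shape la). Proof. by []. Qed.

Lemma Wlam_expand k s : increasing s ->
  Wlam k s = \sum_(la <- parts) (W k s)@_(shape la) *: indhomog n (msym_fun F n la).
Proof.
move=> incs; rewrite {1}(@sym_expand F n (Wlam k s)); last first.
  by rewrite val_Wlam //; apply: pscaled_sym (Wpoly_self k incs).
by apply: eq_bigr => la _; rewrite mcoefE val_Wlam.
Qed.

Lemma pscale_Wlam e k k' s : increasing s ->
  (forall j, e j.+1 * (k ^+ j.+1 - (k - (q - 1)) ^+ j.+1) =
     k' ^+ j.+1 - (k' - (q - 1)) ^+ j.+1) ->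
  pscale e (Wlam k s) = W k' s.
Proof.
move=> incs he; apply: pscaledP => //; rewrite val_Wlam //; exact: Wpoly_pscaled.
Qed.

Lemma signE la D : eps q n la D = ind_char (block_alg (yblk la) q)
   (linear_repr (fun w : 'S_n => (-1) ^+ len w)) D.
Proof. by rewrite lfunE. Qed.

Lemma etaE la D : eta q n la D = ind_char (block_alg (yblk la) q)
   (linear_repr (fun w : 'S_n => q ^+ len w)) D.
Proof. by rewrite lfunE. Qed.

Lemma sign_root : (-1) ^+ 2 = (q - 1) * -1 + q :> F. Proof. by ring. Qed.
Lemma q_root : q ^+ 2 = (q - 1) * q + q. Proof. by ring. Qed.

Lemma eps_comm la D E : eps q n la (D * E) = eps q n la (E * D).
Proof.
rewrite !signE; apply: ind_char_comm; first exact: yblk_mono.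
exact: lin_char_repr sign_root _.
Qed.

Lemma eta_comm la D E : eta q n la (D * E) = eta q n la (E * D).
Proof.
rewrite !etaE; apply: ind_char_comm; first exact: yblk_mono.
exact: lin_char_repr q_root _.
Qed.

Lemma part_shape la : la \in parts -> sumn la = n /\ (size la <= n.+1)%N.
Proof. by move=> h; rewrite (part_sum h); split=> //; apply: leqW; apply: part_size. Qed.

Lemma eps_Tseq la s : la \in parts -> increasing s ->
  eps q n la (Tseq q s) = (W (-1) s)@_(shape la).
Proof.
move=> /part_shape[sla lN] incs; rewrite signE (lin_char_ind sign_root (@yblk_mono n la)).
by apply: induce_Wpoly => // s' _; apply: lin_char_Tseq sign_root _.
Qed.

Lemma eta_Tseq la s : la \in parts -> increasing s ->
  eta q n la (Tseq q s) = (W q s)@_(shape la).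
Proof.
move=> /part_shape[sla lN] incs; rewrite etaE (lin_char_ind q_root (@yblk_mono n la)).
by apply: induce_Wpoly => // s' _; apply: lin_char_Tseq q_root _.
Qed.

Lemma Yq_Tseq s : increasing s -> Yq (Tseq q s : H) = Wlam (-1) s.
Proof.
move=> incs; rewrite Wlam_expand // /Yq; apply: eq_big_seq => la hla.
by rewrite eps_Tseq.
Qed.

Lemma val_pleth (f : Lam) : val (pleth q f) = pscale (fun j => (q ^+ j - 1)^-1) f.
Proof.
rewrite /pleth val_lincomb; apply: eq_bigr => i _; congr (_ *: _).
by rewrite val_indhomog // psum_prod_homog // -mem_partitions part_mem.
Qed.

(** The parts add up to [n], so [c^n] distributes as [c^j] over each [p_j]. *)
Lemma pscaleZ c e (f : Lam) :
  c ^+ n *: pscale e f = pscale (fun j => c ^+ j * e j) f.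
Proof.
rewrite /pscale scaler_sumr; apply: eq_bigr => i _.
rewrite scalerA mulrC -scalerA; congr (_ *: _).
have K t : c ^+ sumn t *: \prod_(j <- t) (e j *: psum_fun F n j) =
    \prod_(j <- t) ((c ^+ j * e j) *: psum_fun F n j).
  elim: t => [|j t IH]; first by rewrite !big_nil scale1r.
  rewrite !big_cons /= exprD -IH; move: (psum_fun F n j) (\prod_(_ <- t) _) => x y.
  by rewrite -!scalerAl -!scalerAr !scalerA mulrAC.
by rewrite -K (part_sum (part_mem i)).
Qed.

Definition llt_scale (j : nat) : F := (q - 1) ^+ j * (q ^+ j - 1)^-1.

Lemma val_Zq D : val (Zq D) = pscale llt_scale (Yq D).
Proof.
rewrite /Zq -[LHS]/((q - 1) ^+ n *: val (pleth q (Yq D))) val_pleth.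
exact: pscaleZ.
Qed.

Lemma eps_LLT_Tseq la s : increasing s ->
  eps_LLT q n la (Tseq q s) = (W 0 s)@_(shape la).
Proof.
move=> incs; rewrite lfunE /= /eps_LLT_fun mcoefE val_Zq Yq_Tseq //.
(* For [j >= 1] the required identity is [(q-1)^j / (q^j - 1) * ((-1)^j - (-q)^j) = - (1-q)^j]. *)
rewrite (@pscale_Wlam _ (-1) 0) // => j; rewrite /llt_scale.
have -> : -1 - (q - 1) = - q by ring.
rewrite !sub0r expr0n /= sub0r (exprNn q) (exprNn (q - 1)).
have qj := qn1 j; set Q := q ^+ j.+1 in qj *; set S := (-1) ^+ j.+1; set C := (q - 1) ^+ j.+1.
have -> : S - S * Q = - S * (Q - 1) by ring.
by rewrite -mulrA (mulrCA _ (- S)) mulVf // mulr1; ring.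
Qed.

Lemma eps_LLT_comm la D E : eps_LLT q n la (D * E) = eps_LLT q n la (E * D).
Proof.
rewrite !lfunE /= /eps_LLT_fun /Zq; congr (mcoef _ (_ *: pleth q _)).
by apply: eq_bigr => mu _; rewrite eps_comm.
Qed.

(** For [n = 0] the one-row shape is the empty partition, as [[:: 0]] is not a partition. *)
Definition top_part : seq nat := if n is 0%N then [::] else [:: n].

Lemma top_partP : top_part \in parts.
Proof. by rewrite mem_partitions /top_part; case: n => // m; rewrite /is_partition /= addn0 eqxx. Qed.

Lemma induce_top (f : H -> F) D : induce (yblk top_part) f D = f D.
Proof.
apply: (@const_induce _ _ 0%N) => x; apply/eqP; rewrite -leqn0 -ltnS.
apply: leq_trans (yblk_lt (part_sum top_partP) x) _.
by rewrite /top_part; case: n.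
Qed.

Lemma top_shape k s (f : {linear H -> F^o}) : increasing s ->
  (forall s', uniq s' -> f (Tseq q s') = k ^+ size s') ->
  f (Tseq q s) = (W k s)@_(shape top_part).
Proof.
move=> incs hf; have [sla lN] := part_shape top_partP.
by rewrite -(induce_Wpoly sla lN hf incs) induce_top.
Qed.

Lemma tauE D : tau D = eps_LLT q n top_part D.
Proof.
apply: (trace_ext (q := q)) => [D' E|D' E|s incs].
- exact: coef1_trace.
- exact: eps_LLT_comm.
- apply: etrans (esym (eps_LLT_Tseq top_part incs)).
  by apply: top_shape => //; apply: tau_Tseq.
Qed.

Definition eps_comb (a : 'I_(size parts) -> F) D := \sum_i a i * eps q n (part i) D.

(** The coefficients are those of [m_la] in the rescaled [m_mu]. Being a combination of characters
    is what inducing [tau] and [Rtrace] requires. *)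
Lemma eps_LLT_comb la : exists a, forall D, eps_LLT q n la D = eps_comb a D.
Proof.
exists (fun i => (pscale llt_scale (indhomog n (msym_fun F n (part i))))@_(shape la)) => D.
rewrite lfunE /= /eps_LLT_fun mcoefE val_Zq /Yq (big_nth [::]) big_mkord.
rewrite pscale_lincomb raddf_sum; apply: eq_bigr => i _ /=.
by rewrite mcoeffZ mulrC (tnth_nth [::]).
Qed.

(* A trace of [H_n] that is a combination of characters restricts to [H_la], so it
   can be induced back using the restricted representations. *)
Lemma induce_comb la (g : {linear H -> F^o}) a (Theta theta : H -> F) :
  (forall D, g D = eps_comb a D) ->
  {in parabolic q n la, forall u, theta u = g u} ->
  (forall h, Theta h = induce (yblk la) g h) ->
  induced_trace (parabolic q n la) theta Theta.
Proof.
move=> hg hth hTh.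
pose sgn : {linear H -> 'M[F]_1} := linear_repr (fun w : 'S_n => (-1) ^+ len w).
have sgnP B : is_repr B sgn by exact: lin_char_repr sign_root B.
pose rho i : {linear H -> 'M[F]_#|ind_index (yblk (part i)) 1|} :=
  ind_mx (yblk (part i)) sgn.
have mono mu := @yblk_mono n mu.
have rhoP i B : is_repr B (rho i).
  by split=> [|u v _ _]; [exact: (ind_mx1 (mono _) (sgnP _))|exact: (ind_mxM (mono _) (sgnP _))].
have rhotr i D : \tr (rho i D) = eps q n (part i) D.
  by rewrite signE; apply: (ind_mx_tr (mono _) (sgnP _)).
exists (size parts), a, _, rho; split=> [i|u hu|h]; first exact: rhoP.
  by rewrite hth // hg; apply: eq_bigr => i _; rewrite rhotr.
rewrite hTh /induce; under eq_bigr => d _ do rewrite hg /eps_comb.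
rewrite exchange_big; apply: eq_bigr => i _ /=.
rewrite (ind_charE (mono la) (rhoP i _)) -mulr_sumr; congr (_ * _).
by apply: eq_bigr => d _; rewrite rhotr.
Qed.

Lemma induced_trace_comm (B : {vspace H}) (theta Theta : H -> F) la :
  B = parabolic q n la -> induced_trace B theta Theta ->
  forall D E, Theta (D * E) = Theta (E * D).
Proof.
move=> -> [k [c [d [rho [hr _ hT]]]]] D E; rewrite !hT; apply: eq_bigr => i _.
by congr (_ * _); apply: (ind_char_comm (@yblk_mono n la) (hr i)).
Qed.

End Assembly.

(** * Linear independence of the [eps], and the passage to [eta] *)

Section Freeness.
Variables (F : fieldType) (q : F) (n : nat).
Hypothesis char0 : forall j, j.+1%:R != 0 :> F.
Hypothesis q0 : q != 0.
Hypothesis qn1 : forall j, q ^+ j.+1 - 1 != 0.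
Local Notation H := (hecke q n).
Local Notation T := (T q).
Local Notation R := {mpoly F[n.+1]}.
Local Notation Lam := (dhomog n.+1 F n).
Local Notation parts := (partitions n).
Local Notation part i := (tnth (in_tuple parts) i).
Local Notation W := (Wpoly q n).
Local Notation shape la := (shape_mon la n).
Local Notation P := (psum_fun F n).
Local Notation msym la := (indhomog n (msym_fun F n la) : Lam).
Implicit Types (la mu : seq nat) (s : seq 'I_n.-1) (D E : H) (k : F).

(** The power sums are free and lie in the span of the [m_la], of which there are equally many. *)
Lemma msym_span la : la \in parts -> msym la \in <<psum_tuple F n>>%VS.
Proof.
pose M := [seq msym mu | mu <- parts]; move=> hla.
have hM mu : mu \in parts -> msym mu \in <<M>>%VS by move=> h; apply/memv_span/map_f.
suff -> : <<psum_tuple F n>>%VS = <<M>>%VS by exact: hM.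
apply/eqP; rewrite eqEdim; apply/andP; split.
  apply/span_subvP => f /tnthP[i ->].
  rewrite (@sym_expand F n (tnth _ i)); last first.
    by rewrite (tnth_nth 0) psum_tupleE psum_prod_sym.
  by rewrite big_seq; apply: rpred_sum => mu hmu; apply/memvZ/hM.
apply: leq_trans (dim_span _) _; rewrite size_map.
by have /eqP -> := free_psum n char0; rewrite size_tuple.
Qed.

Lemma shape_mdeg la : la \in parts -> (mdeg (shape la) < n.+1)%N.
Proof.
move=> hla; rewrite ltnS mdegE.
have -> : (\sum_i shape la i = sumn (shape la : seq nat))%N by rewrite sumnE big_tuple.
by rewrite -sumn_filter_pos pos_shape ?(part_pos hla) ?(leqW (part_size hla)) ?(part_sum hla).
Qed.

Definition coef_comb (b : 'I_(size parts) -> F) (f : R) : F^o :=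
  \sum_i b i * f@_(shape (part i)).

Fact coef_comb_is_linear b : linear (coef_comb b).
Proof.
move=> a f g; rewrite /coef_comb scaler_sumr -big_split; apply: eq_bigr => i _ /=.
by rewrite mcoeffD mcoeffZ mulrDr mulrCA.
Qed.

HB.instance Definition _ b := GRing.isLinear.Build F R F^o _ (coef_comb b) (coef_comb_is_linear b).

Lemma coef_combZ b a f : coef_comb b (a *: f) = a * coef_comb b f.
Proof. exact: linearZ. Qed.

(** A relation [b] gives a functional [coef_comb b] that kills every [W (-1) s], hence every product
    of the series [Wser], hence by [newton_span] all power sums and all [m_la]; its value at [m_la]
    is a coefficient of [b]. *)
Lemma free_eps : free (eps_tuple q n).
Proof.
apply/freeP => b b0 i.
have E s : increasing s -> coef_comb b (W (-1) s) = 0.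
  move=> incs; have := congr1 (fun f : 'Hom(H, F^o) => f (Tseq q s)) b0.
  rewrite sum_lfunE zero_lfunE => <-; apply: eq_bigr => j _.
  rewrite scale_lfunE -tnth_nth tnth_map eps_Tseq //; exact: part_mem.
(* The Newton weight at [k = -1] is [(-1)^(j+1) * (1 - q^(j+1))]. *)
have c0 j : (-1) ^+ j.+1 - (-1 - (q - 1)) ^+ j.+1 != 0 :> F.
  have -> : -1 - (q - 1) = - q by ring.
  rewrite (exprNn q) -{1}[(-1) ^+ _]mulr1 -mulrBr mulf_neq0 ?signr_eq0 //.
  by rewrite -opprB oppr_eq0.
have hb := newton_span (beta := coef_comb b) (@Wser_newtonP F q n (-1)) c0.
have kill f : f \in <<psum_tuple F n>>%VS -> coef_comb b (val f) = 0.
  move/coord_span => ->; rewrite val_lincomb linear_sum big1 // => j _.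
  rewrite [LHS]coef_combZ psum_tupleE hb ?mulr0 //.
  - move=> al sal hal; have [s incs <-] := @Wpoly_onto F q n n al hal sal.
    by rewrite -[LHS]/(coef_comb b _) coef_combZ E ?mulr0.
  - exact: part_pos (part_mem j).
  - exact: part_sum (part_mem j).
have := kill _ (msym_span (part_mem i)).
rewrite val_indhomog ?msym_fun_homog -?mem_partitions ?part_mem //.
rewrite /coef_comb (bigD1 i) //= big1 => [|j ne]; last first.
  have hj := part_mem j; rewrite mcoeff_msym ?(shape_mdeg hj) //.
  rewrite pos_shape ?(part_pos hj) ?(leqW (part_size hj)) //.
  case: (boolP (perm_eq _ _)) => [|_]; last by rewrite mulr0.
  move/(part_eq hj (part_mem i))/part_inj => e; by rewrite e eqxx in ne.
have hi := part_mem i; rewrite mcoeff_msym ?(shape_mdeg hi) //.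
by rewrite pos_shape ?(part_pos hi) ?(leqW (part_size hi)) // perm_refl mulr1 addr0.
Qed.

(** The involution [omega], for which [omega p_j = (-1)^(j-1) p_j]. *)
Definition omega_scale (j : nat) : F := - (-1) ^+ j.

(** The coefficient of [m_la] in [omega m_mu], which turns out to be that of [eps^mu] in
    [eta^la]. *)
Definition eta_coord la (i : 'I_(size parts)) : F :=
  (pscale omega_scale (msym (part i)))@_(shape la).

Lemma eta_coord_Wlam la k s : increasing s ->
  \sum_i eta_coord la i * (W k s)@_(shape (part i)) =
  (pscale omega_scale (Wlam q k s))@_(shape la).
Proof.
move=> incs; rewrite (Wlam_expand char0 qn1) // (big_nth [::]) big_mkord pscale_lincomb.
rewrite raddf_sum; apply: eq_bigr => i _ /=.
by rewrite mcoeffZ mulrC /eta_coord (tnth_nth [::]).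
Qed.

Lemma eta_expand la : la \in parts ->
  eta q n la = \sum_i eta_coord la i *: (eps_tuple q n)`_i.
Proof.
move=> hla; apply/lfunP.
have sumE D : (\sum_i eta_coord la i *: (eps_tuple q n)`_i : 'Hom(H, F^o)) D =
    \sum_i eta_coord la i * eps q n (part i) D.
  rewrite sum_lfunE; apply: eq_bigr => i _.
  by rewrite scale_lfunE -tnth_nth tnth_map.
apply: (trace_ext (q := q)) => [D E|D E|s incs].
- exact: eta_comm.
- apply: etrans (sumE _) (etrans _ (esym (sumE _))).
  by apply: eq_bigr => i _; rewrite eps_comm.
suff e : eta q n la (Tseq q s) = \sum_i eta_coord la i * eps q n (part i) (Tseq q s).
  exact: etrans e (esym (sumE _)).
apply: (etrans (eta_Tseq q hla incs)).
rewrite (eq_bigr (fun i => eta_coord la i * (W (-1) s)@_(shape (part i)))) => [|i _]; last first.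
  by rewrite eps_Tseq // part_mem.
rewrite eta_coord_Wlam // (@pscale_Wlam _ _ _ char0 qn1 _ (-1) q) // => j.
have -> : -1 - (q - 1) = - q by ring.
have -> : q - (q - 1) = 1 by ring.
rewrite /omega_scale (exprNn q) expr1n -{2}[(-1) ^+ _]mulr1 -mulrBr mulrA mulNr -expr2.
by rewrite sqrr_sign; ring.
Qed.

(** Linear independence of the [eps] identifies the coordinates used in [LLT] with [eta_coord]. *)
Lemma eta_LLTE la D : la \in parts ->
  eta_LLT q n la D = \sum_i eta_coord la i * eps_LLT q n (part i) D.
Proof.
move=> hla; rewrite /eta_LLT /LLT sum_lfunE; apply: eq_bigr => i _.
by rewrite scale_lfunE {1}eta_expand // coord_sum_free // free_eps.
Qed.

Lemma eta_LLT_comm la D E : la \in parts ->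
  eta_LLT q n la (D * E) = eta_LLT q n la (E * D).
Proof. by move=> hla; rewrite !eta_LLTE //; apply: eq_bigr => i _; rewrite eps_LLT_comm. Qed.

Lemma eta_LLT_Tseq la s : la \in parts -> increasing s ->
  eta_LLT q n la (Tseq q s) = (W (q - 1) s)@_(shape la).
Proof.
move=> hla incs; rewrite eta_LLTE //.
rewrite (eq_bigr (fun i => eta_coord la i * (W 0 s)@_(shape (part i)))) => [|i _]; last first.
  by rewrite eps_LLT_Tseq.
(* For [j >= 1], [omega] carries the weight [- (1-q)^j] of [k = 0] to the weight [(q-1)^j] of
   [k = q - 1]. *)
rewrite eta_coord_Wlam // (@pscale_Wlam _ _ _ char0 qn1 _ 0 (q - 1)) // => j.
rewrite subrr sub0r expr0n /= sub0r subr0 (exprNn (q - 1)) /omega_scale mulrNN mulrA -expr2.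
by rewrite sqrr_sign mul1r.
Qed.

Lemma RtraceE_top D : Rtrace D = eta_LLT q n (top_part n) D.
Proof.
have ht := top_partP n.
apply: (trace_ext (q := q)) => [D' E|D' E|s incs].
- exact: Rtrace_comm.
- exact: eta_LLT_comm.
- apply: etrans (esym (eta_LLT_Tseq ht incs)).
  by apply: top_shape => // s' us; apply: Rtrace_Tseq.
Qed.

Lemma Rtrace_comb : exists a, forall D, Rtrace D = eps_comb a D.
Proof.
have /fin_all_exists[a ha] : forall i : 'I_(size parts), exists a,
    forall D, eps_LLT q n (part i) D = eps_comb a D.
  by move=> i; apply: eps_LLT_comb.
exists (fun j => \sum_i eta_coord (top_part n) i * a i j) => D.
rewrite RtraceE_top eta_LLTE ?top_partP // /eps_comb.
under eq_bigr => i _ do rewrite ha mulr_sumr.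
rewrite exchange_big; apply: eq_bigr => j _.
by rewrite mulr_suml; apply: eq_bigr => i _; rewrite mulrA.
Qed.

Lemma tau_comb : exists a, forall D : H, tau D = eps_comb a D.
Proof.
have [a ha] := eps_LLT_comb q n (top_part n).
by exists a => D; rewrite (tauE char0 qn1) ha.
Qed.

Lemma induce_linear b (g : {linear H -> F^o}) : linear (induce b g : H -> F^o).
Proof.
move=> a D E; rewrite /induce scaler_sumr -big_split; apply: eq_bigr => d _ /=.
by rewrite mulrDl -scalerAl block_coefP linearP.
Qed.

(** [induce_comb] makes [induce] of [g] an induced trace; it equals [Theta] because both are traces
    with the same values on increasing products. *)
Lemma comb_induced la (g theta : {linear H -> F^o}) (Theta : {linear H -> F^o}) k :
  la \in parts -> (exists a, forall D, g D = eps_comb a D) ->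
  (forall s, uniq s -> g (Tseq q s) = k ^+ size s) ->
  (forall D E, Theta (D * E) = Theta (E * D)) ->
  (forall s, increasing s -> Theta (Tseq q s) = (W k s)@_(shape la)) ->
  {in parabolic q n la, forall u, theta u = g u} ->
  induced_trace (parabolic q n la) theta Theta.
Proof.
move=> hla [a ha] hk hC hW hth.
pose I : {linear H -> F^o} := HB.pack (induce (yblk la) g : H -> F^o)
  (GRing.isLinear.Build F H F^o _ _ (induce_linear (yblk la) g)).
have ind := @induce_comb F q n la g a _ _ ha hth (fun h => erefl (I h)).
suff e : Theta =1 I.
  by case: ind => [m [c [d [rho [hr ht hT]]]]]; exists m, c, d, rho; split=> // h; rewrite e.
apply: (trace_ext (q := q)) => //; first exact: induced_trace_comm (erefl _) ind.
move=> s incs; rewrite hW //; have [sla lN] := part_shape hla.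
by rewrite -(induce_Wpoly sla lN hk incs).
Qed.

End Freeness.

(** * Young subgroups *)

Section YoungFactors.
Variables (n : nat) (la : seq nat).
Hypothesis la_sum : sumn la = n.
Local Notation lak k := (nth 0%N la k).
Local Notation G := (blockgrp (yblk la : 'I_n -> nat)).
Implicit Types (w x : 'S_n) (i : 'I_n.-1).

Lemma ypos_lt k (c : 'I_(lak k)) : (flatten_index la k c < n)%N.
Proof. by rewrite -la_sum flatten_indexP. Qed.

Definition ypos k (c : 'I_(lak k)) : 'I_n := Ordinal (ypos_lt c).

Lemma yblk_ypos k (c : 'I_(lak k)) : yblk la (ypos c) = k.
Proof. exact: flatten_indexKl. Qed.

Lemma ypos_inj k : injective (@ypos k).
Proof.
move=> c c' [e]; apply: val_inj => /=.
by rewrite -(flatten_indexKr (ltn_ord c)) e flatten_indexKr.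
Qed.

Lemma ypos_ltn k (c c' : 'I_(lak k)) : (ypos c < ypos c')%N = (c < c')%N.
Proof. by rewrite /= /flatten_index ltn_add2l. Qed.

Lemma ypos_onto (a : 'I_n) k : yblk la a = k -> exists c : 'I_(lak k), a = ypos c.
Proof.
move=> <-; have lt : (reshape_offset la a < lak (yblk la a))%N.
  by rewrite reshape_offsetP // la_sum.
by exists (Ordinal lt); apply: val_inj; rewrite /= reshape_indexK.
Qed.

Lemma young_proj_exists k w : w \in G ->
  exists u : 'S_(lak k), forall c, w (ypos c) = ypos (u c).
Proof.
move=> /blockP hw; have h (c : 'I_(lak k)) : exists c' : 'I_(lak k), w (ypos c) == ypos c'.
  have [c' e] := ypos_onto (etrans (hw _) (yblk_ypos c)).
  by exists c'; rewrite e.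
pose f c := xchoose (h c).
have fE c : w (ypos c) = ypos (f c) by exact/eqP/(xchooseP (h c)).
have fI : injective f.
  by move=> c c' e; apply/(@ypos_inj k)/(@perm_inj _ w); rewrite !fE e.
by exists (perm fI) => c; rewrite permE fE.
Qed.

(** On the Young subgroup the [pick] inside [young_proj] succeeds, so its default value never
    appears. *)
Lemma young_projE k w (c : 'I_(lak k)) : w \in G -> w (ypos c) = ypos (young_proj la k w c).
Proof.
move=> hw; have [u hu] := young_proj_exists k hw; rewrite /young_proj.
case: pickP => [u'|/(_ u)/negP[]] /=.
  move/forallP/(_ c)/forallP/(_ (ypos c)); rewrite eqxx /= => /eqP e.
  exact: val_inj.
apply/forallP => c'; apply/forallP => a; apply/implyP => /eqP ea.
have -> : a = ypos c' by apply: val_inj.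
by rewrite hu.
Qed.

Lemma young_proj_eq k w (u : 'S_(lak k)) : w \in G ->
  (forall c, w (ypos c) = ypos (u c)) -> young_proj la k w = u.
Proof.
move=> hw hu; apply/permP => c; apply: (@ypos_inj k).
by rewrite -young_projE // hu.
Qed.

Lemma young_proj1 k : young_proj la k (1 : 'S_n)%g = 1%g.
Proof. by apply: young_proj_eq => [|c]; rewrite ?block1 // !perm1. Qed.

Lemma young_eq1 w : w \in G ->
  (w == 1%g) = [forall k : 'I_(size la), young_proj la k w == 1%g].
Proof.
move=> hw; apply/eqP/forallP => [-> k|h]; first by rewrite young_proj1.
apply/permP => a; rewrite perm1.
have lt := yblk_lt la_sum a; have [c ->] := ypos_onto (erefl (yblk la a)).
by rewrite young_projE // (eqP (h (Ordinal lt))) perm1.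
Qed.

Lemma simple_ypos i : simple i \in G ->
  exists2 k, (k < size la)%N & exists2 j : 'I_(lak k).-1,
    lpos i = ypos (lpos j) & rpos i = ypos (rpos j).
Proof.
rewrite block_simple => /eqP e; set k := yblk la (lpos i) in e.
have lt : (k < size la)%N by exact: yblk_lt.
exists k => //.
have [c ec] := ypos_onto (erefl k); have [c' ec'] := ypos_onto (esym e).
have adj : (val c' = (val c).+1)%N.
  have e1 : nat_of_ord i = (sumn (take k la) + c)%N := congr1 val ec.
  have e2 : i.+1 = (sumn (take k la) + c')%N := congr1 val ec'.
  by apply: (@addnI (sumn (take k la))); rewrite -e2 e1 addnS.
have hj : (c < (lak k).-1)%N by rewrite -subn1 ltn_subRL add1n -adj ltn_ord.
exists (Ordinal hj); first by rewrite ec; congr ypos; apply: val_inj.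
by rewrite ec'; congr ypos; apply: val_inj; rewrite /= adj.
Qed.

Section Simple.
Variables (i : 'I_n.-1) (k : nat) (j : 'I_(lak k).-1).
Hypotheses (ei : lpos i = ypos (lpos j)) (er : rpos i = ypos (rpos j)).
Variable w : 'S_n.
Hypothesis hw : w \in G.

Lemma simple_blockM : (simple i * w)%g \in G.
Proof. by apply: blockM => //; rewrite block_simple ei er !yblk_ypos. Qed.

Lemma young_proj_simple : young_proj la k (simple i * w)%g = (simple j * young_proj la k w)%g.
Proof.
apply: young_proj_eq => [|c]; first exact: simple_blockM.
rewrite !permM -young_projE //; congr (w _).
rewrite /simple ei er; case: (tpermP (lpos j)) => [->|->|/eqP nl /eqP nr].
- by rewrite tpermL.
- by rewrite tpermR.
- by rewrite tpermD // (inj_eq (@ypos_inj k)) eq_sym.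
Qed.

Lemma young_proj_simple_other l : l != k ->
  young_proj la l (simple i * w)%g = young_proj la l w.
Proof.
move=> ne; apply: young_proj_eq => [|c]; first exact: simple_blockM.
rewrite permM /simple ei er tpermD ?young_projE //;
  by apply: contraNneq ne => e; rewrite -(yblk_ypos c) -e yblk_ypos.
Qed.

Lemma young_proj_descent : descent i w = descent j (young_proj la k w).
Proof. by rewrite /descent ei er !young_projE // ypos_ltn. Qed.

End Simple.

Section Coefficients.
Variables (F : fieldType) (q : F).
Hypothesis q0 : q != 0.

Lemma coef_alpha_simple m (v x : 'S_m) (j : 'I_m.-1) : ~~ descent j v ->
  coef (alpha (T q (simple j * v)%g)) x = (q - 1) * coef (alpha (T q v)) x -
   (if descent j x then coef (alpha (T q v)) (simple j * x)%g + (q - 1) * coef (alpha (T q v)) x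
    else q * coef (alpha (T q v)) (simple j * x)%g).
Proof.
move=> nd; have -> : T q (simple j * v)%g = T q (simple j) * T q v.
  by rewrite T_simpleM (negbTE nd).
rewrite alphaM // alpha_simple // mulrBl -scalerAl mul1r -scaleN1r coefD !coefZ.
by rewrite mulN1r simple_mulE coef_simple_mul.
Qed.

(** Only [x = 1] is wanted, but the recursion on a left reflection of [w] also moves [x]. That
    reflection acts on one tensor factor and leaves the others alone. *)
Lemma coef_alpha_young w x : w \in G -> x \in G ->
  coef (alpha (T q w)) x =
  \prod_(k < size la) coef (alpha (T q (young_proj la k w))) (young_proj la k x).
Proof.
have c1 m (y : 'S_m) : coef (alpha (T q 1%g)) y = (y == 1%g)%:R.
  by rewrite alphaT /alpha_fun len1 invg1 T1 invr1 expr0 scale1r -T1 coefT.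
elim/len_ind: w x => [|i v di IH] x hv hx.
  rewrite c1 young_eq1 //.
  under eq_bigr => k _ do rewrite young_proj1 c1.
  case: forallP => [h|nh]; first by rewrite big1 // => k _; rewrite h.
  have /existsP[k hk] : [exists k : 'I_(size la), young_proj la k x != 1%g].
    by rewrite -negb_forall; apply/negP => /forallP.
  by rewrite (bigD1 k) //= (negbTE hk) mul0r.
have hi := block_desc (@yblk_mono n la) hv di.
have [k ltk [j ei er]] := simple_ypos hi.
set v' := (simple i * v)%g in IH.
have hv' : v' \in G by exact: blockM.
have vE : v = (simple i * v')%g by rewrite simpleK.
have ndi : ~~ descent i v' by rewrite descentM di.
have hsx : (simple i * x)%g \in G by exact: blockM.
pose K := Ordinal ltk.
pose f (a y : 'S_n) (l : 'I_(size la)) : F := coef (alpha (T q (young_proj la l a))) (young_proj la l y).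
pose P a y := \prod_(l < size la | l != K) f a y l.
have fP a y : \prod_l f a y l = f a y K * P a y by exact: bigD1.
have Pv : P (simple i * v')%g x = P v' x.
  by apply: eq_bigr => l ne; rewrite /f (young_proj_simple_other ei er hv').
have Px : P v' (simple i * x)%g = P v' x.
  by apply: eq_bigr => l ne; rewrite /f (young_proj_simple_other ei er hx).
have e1 : coef (alpha (T q v')) x = f v' x K * P v' x by rewrite -fP; exact: IH.
have e2 : coef (alpha (T q v')) (simple i * x)%g = f v' (simple i * x)%g K * P v' x.
  by rewrite -Px -fP; exact: IH.
clearbody v'; rewrite vE (coef_alpha_simple x ndi) e1 e2.
transitivity (f (simple i * v')%g x K * P v' x); last by rewrite -Pv -fP.
have ndk : ~~ descent j (young_proj la k v') by rewrite -(young_proj_descent ei er hv').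
rewrite /f /= (young_proj_simple ei er hv') (young_proj_simple ei er hx).
rewrite (young_proj_descent ei er hx) (coef_alpha_simple _ ndk).
by case: ifP => _; ring.
Qed.

Lemma tensor_trace_young (theta : forall k, 'Hom(hecke q (lak k), F^o))
    (g : {linear hecke q n -> F^o}) :
  (forall w, w \in G -> \prod_(k < size la) theta k (T q (young_proj la k w)) = g (T q w)) ->
  {in parabolic q n la, forall u, tensor_trace n theta u = g u}.
Proof.
move=> h u hu; rewrite lfunE /= {2}(block_sum (hu : u \in block_alg (yblk la) q)) linear_sum.
rewrite /linear_ext (bigID (mem G)) /= [X in _ + X]big1 ?addr0 => [|w nw].
  by apply: eq_bigr => w hw; rewrite h // linearZ.
have /mem_block_alg su : u \in block_alg (yblk la) q by [].
by rewrite su ?mul0r.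
Qed.

Lemma prod_tau_young w : w \in G ->
  \prod_(k < size la) tau (T q (young_proj la k w)) = tau (T q w).
Proof.
move=> hw; rewrite /tau coefT eq_sym young_eq1 //.
under eq_bigr => k _ do rewrite coefT eq_sym.
case: forallP => [h|nh]; first by rewrite big1 // => k _; rewrite h.
have /existsP[k hk] : [exists k : 'I_(size la), young_proj la k w != 1%g].
  by rewrite -negb_forall; apply/negP => /forallP.
by rewrite (bigD1 k) //= (negbTE hk) mul0r.
Qed.

Lemma prod_Rtrace_young w : w \in G ->
  \prod_(k < size la) Rtrace (T q (young_proj la k w)) = Rtrace (T q w).
Proof.
move=> hw; rewrite /Rtrace coef_alpha_young ?block1 //.
by apply: eq_bigr => k _; rewrite young_proj1.
Qed.

End Coefficients.
End YoungFactors.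

(** * The statements for a nonzero parameter that is not a root of unity *)

Section Generic.
Variables (F : fieldType) (q : F).
Hypothesis char0 : forall j, j.+1%:R != 0 :> F.
Hypothesis q0 : q != 0.
Hypothesis qn1 : forall j, q ^+ j.+1 - 1 != 0.

Lemma top_part_gt0 m : (0 < m)%N -> top_part m = [:: m].
Proof. by case: m. Qed.

Lemma part_nth_gt0 n la k : la \in partitions n -> (k < size la)%N -> (0 < nth 0%N la k)%N.
Proof.
move=> /part_pos l0 lt; rewrite lt0n; apply: contraNneq l0 => <-.
exact: mem_nth.
Qed.

Lemma eps_LLT_induced n la : la \in partitions n ->
  induced_trace (parabolic q n la)
    (tensor_trace n (fun k => eps_LLT q (nth 0%N la k) [:: nth 0%N la k]))
    (eps_LLT q n la).
Proof.
move=> hla; apply: (@comb_induced F q n la (@tau F q n) _ _ 0 hla).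
- exact: tau_comb.
- exact: tau_Tseq.
- exact: eps_LLT_comm.
- by move=> s; apply: eps_LLT_Tseq.
apply: tensor_trace_young => w hw; 
transitivity (\prod_(k < size la) tau (T q (young_proj la k w))); last first.
  exact: (prod_tau_young (part_sum hla)).
apply: eq_bigr => k _; rewrite (tauE char0 qn1) top_part_gt0 //.
exact: (part_nth_gt0 hla (ltn_ord k)).
Qed.

Lemma eps_LLT_row m (w : 'S_m) : (0 < m)%N ->
  eps_LLT q m [:: m] (T q w) = (if w == 1%g then 1 else 0).
Proof.
move=> m0; rewrite -top_part_gt0 // -(tauE char0 qn1) /tau coefT eq_sym.
by case: (w == 1%g).
Qed.

Lemma eta_LLT_induced n la : la \in partitions n ->
  induced_trace (parabolic q n la)
    (tensor_trace n (fun k => eta_LLT q (nth 0%N la k) [:: nth 0%N la k]))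
    (eta_LLT q n la).
Proof.
move=> hla; apply: (@comb_induced F q n la (@Rtrace F q n) _ _ (q - 1) hla).
- exact: Rtrace_comb.
- by move=> s us; apply: Rtrace_Tseq.
- by move=> D E; apply: eta_LLT_comm.
- by move=> s incs; apply: eta_LLT_Tseq.
apply: tensor_trace_young => w hw; 
transitivity (\prod_(k < size la) Rtrace (T q (young_proj la k w))); last first.
  exact: (prod_Rtrace_young (part_sum hla) q0).
apply: eq_bigr => k _; rewrite (RtraceE_top char0 q0 qn1) top_part_gt0 //.
exact: (part_nth_gt0 hla (ltn_ord k)).
Qed.

Lemma eta_LLT_row m (R : 'S_m -> 'S_m -> {poly int}) (w : 'S_m) : (0 < m)%N ->
  is_R_polynomials q R -> eta_LLT q m [:: m] (T q w) = (map_poly intr (R 1%g w)).[q].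
Proof.
by move=> m0 hR; rewrite -top_part_gt0 // -(RtraceE_top char0 q0 qn1) (RtraceE q0 w hR).
Qed.

End Generic.

(** * Specialization to the field of rational functions in [q^(1/2)] *)

Lemma Qqh_char0 j : j.+1%:R != 0 :> Qqh.
Proof.
rewrite -(rmorph_nat (@tofrac {poly rat})) tofrac_eq0 -polyC_natr polyC_eq0.
by rewrite Num.Theory.pnatr_eq0.
Qed.

Lemma qgen_neq0 : qgen != 0.
Proof. by rewrite /qgen expf_neq0 // /qh tofrac_eq0 polyX_eq0. Qed.

Lemma qgen_expn_neq1 j : qgen ^+ j.+1 - 1 != 0.
Proof.
rewrite /qgen /qh -!rmorphXn /= -exprM -tofrac1 -tofracB tofrac_eq0 -polyC1 -size_poly_eq0.
by rewrite size_XnsubC.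
Qed.

Theorem theorem3p6 :
  [/\ forall (n : nat) (la : seq nat), is_partition n la ->
        induced_trace (parabolic qgen n la)
          (tensor_trace n
             (fun k => eps_LLT qgen (nth 0%N la k) [:: nth 0%N la k]))
          (eps_LLT qgen n la),
      forall m : nat, (0 < m)%N -> forall w : 'S_m,
        eps_LLT qgen m [:: m] (T qgen w) = (if w == 1%g then 1 else 0),
      forall (n : nat) (la : seq nat), is_partition n la ->
        induced_trace (parabolic qgen n la)
          (tensor_trace n
             (fun k => eta_LLT qgen (nth 0%N la k) [:: nth 0%N la k]))
          (eta_LLT qgen n la)
    & forall m : nat, (0 < m)%N ->
        forall R : 'S_m -> 'S_m -> {poly int}, is_R_polynomials qgen R ->
        forall w : 'S_m,
        eta_LLT qgen m [:: m] (T qgen w) = (map_poly intr (R 1%g w)).[qgen]].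
Proof.
have [c0 [q0 qn1]] := (Qqh_char0, (qgen_neq0, qgen_expn_neq1)).
split=> [n la hla|m m0 w|n la hla|m m0 R hR w].
- by apply: eps_LLT_induced; rewrite ?mem_partitions.
- exact: eps_LLT_row.
- by apply: eta_LLT_induced; rewrite ?mem_partitions.
- exact: eta_LLT_row.
Qed.
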